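(* Let $g:[0,+\infty)\to[0,+\infty)$ be non-decreasing with $g(0)=0$. For $u\in[0,+\infty)$ define $g^{\rightarrow}(u)=\sup\{s\ge0:\ g(s)\le u\}\in[0,+\infty]$. Let $\Delta=-\sum_{i=1}^n\frac{\partial^2}{\partial x_i^2}$ on $\mathbb R^n$. Then: (i) For every $t>0$ and every $f\in\mathcal D(g(\Delta))\cap L^1(\mathbb R^n)$, $$\|f\|_2^2\le t\,(g(\Delta)f,f)+\tilde\beta\left(\frac1{g^{\rightarrow}(t^{-1})}\right)\|f\|_1^2,\qquad\text{where }\ \tilde\beta(t)=c_n\,\omega_n\,t^{-n/2}.$$ (ii) For every $f\in\mathcal D(g(\Delta))\cap L^1(\mathbb R^n)$ with $\|f\|_1\le1$, $$\|f\|_2^2\,\tilde D_g(\|f\|_2^2)\le(g(\Delta)f,f),\qquad\text{where }\ \tilde D_g(x)=\sup_{t>0}\left(t-\frac tx\,c_n\,\omega_n\left[g^{\rightarrow}(t)\right]^{n/2}\right).$$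
   Context: $\omega_n$ is the volume of the unit ball of $\mathbb R^n$ and $c_n=(2\pi)^{-n}$. Norms $\|\cdot\|_p$ and the inner product $(\cdot,\cdot)$ are those of $L^p(\mathbb R^n)$, $L^2(\mathbb R^n)$ with Lebesgue measure. The Fourier transform is $\mathcal Ff(x)=\int_{\mathbb R^n}f(y)e^{-ix\cdot y}\,dy$. The operator $g(\Delta)$ is defined by $\mathcal F(g(\Delta)f)(x)=g(|x|^2)\,\mathcal Ff(x)$ on the domain $\mathcal D(g(\Delta))=\{f\in L^2(\mathbb R^n):\int_{\mathbb R^n}|g(|x|^2)|^2|\mathcal Ff(x)|^2dx<+\infty\}$. Conventions: $\tilde\beta\left(1/g^{\rightarrow}(u)\right)=c_n\omega_n[g^{\rightarrow}(u)]^{n/2}$, which equals $+\infty$ if $g^{\rightarrow}(u)=+\infty$ and $0$ if $g^{\rightarrow}(u)=0$; for $f=0$ both inequalities are read as $0\le0$. *)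

(* Defs.v *)
From HB Require Import structures.
From mathcomp Require Import all_boot all_order all_algebra.
From mathcomp Require Import all_classical all_reals all_analysis.
From mathcomp.real_closed Require Export complex.

Set Implicit Arguments.
Unset Strict Implicit.
Unset Printing Implicit Defensive.
Import Order.TTheory GRing.Theory Num.Theory.
Import numFieldNormedType.Exports.

Local Open Scope classical_set_scope.
Local Open Scope ring_scope.
Local Open Scope complex_scope.

(* R^n with its Borel sigma-algebra (the product sigma-algebra on tuples). *)
Notation Rn R n := (n.-tuple (measurableTypeR R)).

Section product_step.
Context {R : realType} (n : nat)
  (l : {sigma_finite_measure set (measurableTypeR R) -> \bar R})
  (m : {sigma_finite_measure set (Rn R n) -> \bar R}).

Definition cons_Rn (p : measurableTypeR R * Rn R n) : Rn R n.+1 :=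
  [the Rn R n.+1 of p.1 :: p.2].

Definition uncons_Rn (x : Rn R n.+1) : measurableTypeR R * Rn R n :=
  (thead x, [tuple of behead x]).

Lemma measurable_cons_Rn : measurable_fun setT cons_Rn.
Proof. exact: measurable_cons. Qed.

Lemma measurable_uncons_Rn : measurable_fun setT uncons_Rn.
Proof.
apply/measurable_fun_pairP; split; first exact: measurable_tnth.
exact: measurable_behead.
Qed.

Lemma cons_RnK : cancel cons_Rn uncons_Rn.
Proof.
by move=> [a x]; rewrite /cons_Rn /uncons_Rn/=; congr pair; apply/val_inj.
Qed.

Definition cons_measure : set (Rn R n.+1) -> \bar R :=
  pushforward (l \x m)%E cons_Rn.

HB.instance Definition _ := Measure.copy cons_measure
  (measure_function_pushforward__canonical__measure_function_Measure
    (l \x m)%E measurable_cons_Rn).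

Lemma sigma_finite_cons_measure : sigma_finite setT cons_measure.
Proof.
have /sigma_finiteP[F [TF ndF Foo]] := sigma_finiteT l.
have /sigma_finiteP[G [TG ndG Goo]] := sigma_finiteT m.
exists (fun k => uncons_Rn @^-1` (F k `*` G k)).
  rewrite -preimage_bigcup; apply/esym/seteqP; split => // x _ /=.
  have : [set: measurableTypeR R] (uncons_Rn x).1 by [].
  have : [set: Rn R n] (uncons_Rn x).2 by [].
  rewrite TF TG => -[j _ Gj] [i _ Fi]; exists (maxn i j) => //; split.
    by move: Fi; exact/subsetPset/ndF/leq_maxl.
  by move: Gj; exact/subsetPset/ndG/leq_maxr.
move=> k; have [mF Fk] := Foo k; have [mG Gk] := Goo k; split.
  by rewrite -[X in measurable X]setTI; apply: measurable_uncons_Rn => //;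
    exact: measurableX.
rewrite /cons_measure /pushforward -comp_preimage.
rewrite (_ : uncons_Rn \o cons_Rn = id); last first.
  by apply/funext => p; exact: cons_RnK.
by rewrite preimage_id product_measure1E// lte_mul_pinfty// ge0_fin_numE.
Qed.

HB.instance Definition _ := Measure_isSigmaFinite.Build _ _ _ cons_measure
  sigma_finite_cons_measure.

End product_step.

(* n-dimensional Lebesgue measure, as the n-fold product of the
   one-dimensional one (R^0 being a point of mass 1). *)
Fixpoint lebesgue_Rn {R : realType} (n : nat) :
    {sigma_finite_measure set (Rn R n) -> \bar R} :=
  match n with
  | 0 => [the {sigma_finite_measure set (Rn R 0) -> \bar R} of
           \d_([tuple] : Rn R 0)]
  | n'.+1 => [the {sigma_finite_measure set (Rn R n'.+1) -> \bar R} of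
               cons_measure (@lebesgue_measure R) (lebesgue_Rn n')]
  end.

Section euclidean.
Context {R : realType} {n : nat}.

Definition dotRn (x y : Rn R n) : R :=
  \sum_(i < n) (tnth x i : R) * (tnth y i : R).

Definition sqnormRn (x : Rn R n) : R := dotRn x x.

End euclidean.

Definition omega (R : realType) (n : nat) : R :=
  fine (lebesgue_Rn n [set x : Rn R n | sqnormRn x <= 1]).

Definition cfourier (R : realType) (n : nat) : R := (2 * pi) ^- n.

Section complex_functions.
Context {R : realType} {n : nat}.
Implicit Types f h phi : Rn R n -> R[i].

Definition cmeasurable f :=
  measurable_fun [set: Rn R n] (fun x => complex.Re (f x)) /\
  measurable_fun [set: Rn R n] (fun x => complex.Im (f x)).

Definition cintegral f : R[i] :=
  Rintegral (lebesgue_Rn n) setT (fun x => complex.Re (f x)) +i*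
  Rintegral (lebesgue_Rn n) setT (fun x => complex.Im (f x)).

Definition cLnorm (p : R) f : \bar R :=
  Lnorm (lebesgue_Rn n) p%:E (fun x => (Normc.normc (f x))%:E).

Definition inLp (p : R) f := cmeasurable f /\ (cLnorm p f < +oo)%E.

Definition inner f h : R[i] := cintegral (fun x => f x * (h x)^*).

Definition expi (theta : R) : R[i] := cos theta +i* sin theta.

(* Meaningful when [inLp 1 f]. *)
Definition fourierL1 f (x : Rn R n) : R[i] :=
  cintegral (fun y => f y * expi (- dotRn x y)).

(* [phi] represents the Fourier transform of the class of [f] in L^2, i.e. the
   extension by continuity of [fourierL1] from L^1 /\ L^2. *)
Definition is_fourierL2 f phi :=
  [/\ inLp 2 f, inLp 2 phi &
    exists u : nat -> Rn R n -> R[i],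
      [/\ forall k, inLp 1 (u k) /\ inLp 2 (u k),
          (fun k => cLnorm 2 (fun x => u k x - f x)) @ \oo --> 0%E &
          (fun k => cLnorm 2 (fun x => fourierL1 (u k) x - phi x)) @ \oo
            --> 0%E]].

(* A representative, determined up to a null set (0 if there were none). *)
Definition fourier f : Rn R n -> R[i] :=
  xget (fun=> 0) [set phi | is_fourierL2 f phi].

(* Below, [Delta] is the nonnegative Laplacian, of Fourier symbol |x|^2. *)
Definition dom_gDelta (g : R -> R) f :=
  inLp 2 f /\
  (\int[lebesgue_Rn n]_x
     (`|g (sqnormRn x)| ^+ 2 * Normc.normc (fourier f x) ^+ 2)%:E < +oo)%E.

(* The h in L^2 with F h = g(|.|^2) F f, again up to a null set. *)
Definition gDelta (g : R -> R) f : Rn R n -> R[i] :=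
  xget (fun=> 0)
    [set h | is_fourierL2 h (fun x => (g (sqnormRn x))%:C * fourier f x)].

End complex_functions.

Section rate_functions.
Context {R : realType}.
Implicit Types (g : R -> R) (n : nat).

Definition rarrow g (u : R) : \bar R :=
  ereal_sup [set s%:E | s in [set s : R | 0 <= s /\ g s <= u]].

(* c_n omega_n t^(-n/2) on [0, +oo]: the power is taken of t^-1, where
   0^-1 = +oo and +oo^-1 = 0, because [poweR] sends +oo to +oo even for a
   negative exponent. *)
Definition beta n (t : \bar R) : \bar R :=
  ((cfourier R n * omega R n)%:E * (t^-1) `^ (n%:R / 2))%E.

Definition Dg n g (x : R) : \bar R :=
  ereal_sup [set (t%:E - (t / x * cfourier R n * omega R n)%:E *
                         (rarrow g t) `^ (n%:R / 2))%E
            | t in [set t : R | 0 < t]].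

End rate_functions.

(* Main.v *)
Require Import Defs.
From HB Require Import structures.
From mathcomp Require Import all_boot all_order all_algebra.
From mathcomp Require Import all_classical all_reals all_analysis.
From mathcomp Require Import measurable_realfun ring lra.

Set Implicit Arguments.
Unset Strict Implicit.
Unset Printing Implicit Defensive.
Import Order.TTheory GRing.Theory Num.Theory.
Import numFieldNormedType.Exports.

Local Open Scope classical_set_scope.
Local Open Scope ring_scope.
Local Open Scope complex_scope.

Local Notation normc := Normc.normc.
Local Notation Re := complex.Re.
Local Notation Im := complex.Im.
Local Notation "z ^*" := (complex.conjc z) : ring_scope.

(** Write [phi] for the Fourier transform of [f], [q] for [(g(Delta) f, f)],
    [N1] and [N2] for the [L^1] norm and the squared [L^2] norm of [f]. By
    Plancherel and Parseval, [N2 = c_n \int |phi|^2] and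
    [q = c_n \int g(|x|^2) |phi|^2]. Given [t > 0], split the frequencies. Where
    [g(|x|^2) > 1/t], [|phi|^2] is at most [t g(|x|^2) |phi|^2], and these points
    are paid for by [t q]. Elsewhere [|x|^2] is at most [rho], the supremum
    defining the generalized inverse of [g] at [1/t]; on that ball, of volume
    [omega_n rho^(n/2)], [|phi|] is at most [N1]. Hence
    [N2 <= t q + c_n omega_n rho^(n/2) N1^2] ([frequency_splitting],
    [ball_volumeE], [nash_finite]). If [rho] is infinite, the right-hand side of
    the first inequality is infinite unless [f] vanishes almost everywhere.
    Taking [1/t] for [t], bounding [N1] by 1 and dividing by [N2] gives the
    second one.

    Most of what follows builds the transform of [L^2]. Plancherel's identity on
    the line ([plancherel_line]) comes from the weight [exp (- eps |x|)], whose
    transform is the Poisson kernel [P]: Fubini's theorem and the law of cosines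
    turn [\int exp (- eps |x|) |F f|^2] into
    [2 pi N2 - 1/2 \int \int |f(y) - f(z)|^2 P(y - z)], and the double integral
    tends to 0 with [eps] because translations are continuous in [L^2]. The
    exponential kernel of a product space is the product of the kernels of the
    factors, whence the identity on [R^n] ([plancherel_prodker], [plancherel_Rn]).

    That identity is then used for an arbitrary symmetric kernel of modulus 1.
    The existence of [g(Delta) f] requires the transform to be onto
    ([L2transform_onto]). Its range is dense, because cutting off the inverse
    transform of a function of [L^1 /\ L^2] to a set of finite measure makes an
    error that the identity computes exactly ([sqnorm2_trunc_itransform]); it is
    closed because the transform multiplies norms by a constant and [L^2] is
    complete ([sq_cintegrable_complete]). [fourier] and [gDelta] pick arbitrary
    representatives; [L2transform_unique] and [L2transform_parseval] show that
    the choice changes neither the bound by [N1] nor the form [q]. *)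

(** * Complex-valued functions on a measure space *)

Section complex_numbers.
Context {R : realType}.
Implicit Types (z w : R[i]) (a : R).

Lemma Re_addc z w : Re (z + w) = Re z + Re w. Proof. by case: z; case: w. Qed.
Lemma Im_addc z w : Im (z + w) = Im z + Im w. Proof. by case: z; case: w. Qed.
Lemma Re_subc z w : Re (z - w) = Re z - Re w. Proof. by case: z; case: w. Qed.
Lemma Im_subc z w : Im (z - w) = Im z - Im w. Proof. by case: z; case: w. Qed.
Lemma Re_mulc z w : Re (z * w) = Re z * Re w - Im z * Im w.
Proof. by case: z; case: w. Qed.
Lemma Im_mulc z w : Im (z * w) = Re z * Im w + Im z * Re w.
Proof. by case: z; case: w. Qed.
Lemma Re_conjc z : Re z^* = Re z. Proof. by case: z. Qed.
Lemma Im_conjc z : Im z^* = - Im z. Proof. by case: z. Qed.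

Lemma complex_eqP z w : Re z = Re w -> Im z = Im w -> z = w.
Proof. by case: z w => [a b] [c d] /= -> ->. Qed.

Lemma sqr_normcE z : normc z ^+ 2 = Re z ^+ 2 + Im z ^+ 2.
Proof. by case: z => a b; rewrite sqr_sqrtr// addr_ge0 ?sqr_ge0. Qed.

Lemma normc_ge0 z : 0 <= normc z.
Proof. by case: z => a b; exact: sqrtr_ge0. Qed.

Lemma normc_opp z : normc (- z) = normc z.
Proof. by case: z => a b /=; rewrite !sqrrN. Qed.

Lemma conjc_mul z w : (z * w)^* = z^* * w^*.
Proof. exact: rmorphM. Qed.

Lemma normc_conj z : normc z^* = normc z.
Proof. by case: z => a b /=; rewrite sqrrN. Qed.

Lemma normc_real a : normc a%:C = `|a|.
Proof. by rewrite /= expr0n/= addr0 sqrtr_sqr. Qed.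

Lemma ler_Re_normc z : `|Re z| <= normc z.
Proof.
rewrite -[leRHS]ger0_norm ?normc_ge0// -ler_sqr ?nnegrE//.
by rewrite !real_normK ?num_real// sqr_normcE lerDl sqr_ge0.
Qed.

Lemma ler_Im_normc z : `|Im z| <= normc z.
Proof.
rewrite -[leRHS]ger0_norm ?normc_ge0// -ler_sqr ?nnegrE//.
by rewrite !real_normK ?num_real// sqr_normcE lerDr sqr_ge0.
Qed.

Lemma ler_normc z : normc z <= `|Re z| + `|Im z|.
Proof.
rewrite -ler_sqr ?nnegrE ?normc_ge0 ?addr_ge0//.
rewrite sqr_normcE sqrrD !real_normK ?num_real// addrAC lerDl mulrn_wge0// mulr_ge0.
Qed.

Lemma mulc_conj z : z * z^* = (normc z ^+ 2)%:C.
Proof.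
apply: complex_eqP; rewrite ?Re_mulc ?Im_mulc Re_conjc Im_conjc /=; last by ring.
by rewrite sqr_normcE; ring.
Qed.

Lemma sqr_normcB z w :
  normc (z - w) ^+ 2 = normc z ^+ 2 + normc w ^+ 2 - 2 * Re (z * w^*).
Proof. by rewrite !sqr_normcE !(Re_subc, Im_subc, Re_mulc, Im_mulc, Re_conjc, Im_conjc); ring. Qed.

Lemma sqr_normcD_le z w :
  normc (z + w) ^+ 2 <= 2 * (normc z ^+ 2 + normc w ^+ 2).
Proof.
rewrite !sqr_normcE !(Re_addc, Im_addc); move: (Re z) (Im z) (Re w) (Im w) => a b c d.
by have := sqr_ge0 (a - c); have := sqr_ge0 (b - d); lra.
Qed.

Lemma normcM_le z w : normc (z * w) <= normc z ^+ 2 + normc w ^+ 2.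
Proof.
rewrite Normc.normcM; move: (normc_ge0 z) (normc_ge0 w).
move: (normc z) (normc w) => a b a0 b0.
by have := sqr_ge0 (a - b); have := mulr_ge0 a0 b0; lra.
Qed.

Lemma normc_expi a : normc (expi a) = 1.
Proof. by rewrite /= cos2Dsin2 sqrtr1. Qed.

Lemma expiD a b : expi (a + b) = expi a * expi b :> R[i].
Proof. by apply: complex_eqP; rewrite ?Re_mulc ?Im_mulc /= ?cosD ?sinD//; ring. Qed.

Lemma expiN a : expi (- a) = (expi a)^* :> R[i].
Proof. by rewrite /expi cosN sinN. Qed.

End complex_numbers.

Section complex_measurability.
Context d (T : measurableType d) (R : realType).
Implicit Types f g : T -> R[i].

Definition cmeas f := measurable_fun [set: T] (fun x => Re (f x)) /\
  measurable_fun [set: T] (fun x => Im (f x)).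

Lemma cmeas_cst (c : R[i]) : cmeas (fun=> c).
Proof. by split; exact: measurable_cst. Qed.

Lemma cmeasD f g : cmeas f -> cmeas g -> cmeas (fun x => f x + g x).
Proof.
move=> [? ?] [? ?]; split.
  by under eq_fun do rewrite Re_addc; exact: measurable_funD.
by under eq_fun do rewrite Im_addc; exact: measurable_funD.
Qed.

Lemma cmeasB f g : cmeas f -> cmeas g -> cmeas (fun x => f x - g x).
Proof.
move=> [? ?] [? ?]; split.
  by under eq_fun do rewrite Re_subc; exact: measurable_funB.
by under eq_fun do rewrite Im_subc; exact: measurable_funB.
Qed.

Lemma cmeasM f g : cmeas f -> cmeas g -> cmeas (fun x => f x * g x).
Proof.
move=> [? ?] [? ?]; split.
  by under eq_fun do rewrite Re_mulc; apply: measurable_funB; exact: measurable_funM.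
by under eq_fun do rewrite Im_mulc; apply: measurable_funD; exact: measurable_funM.
Qed.

Lemma cmeasJ f : cmeas f -> cmeas (fun x => (f x)^*).
Proof.
move=> [? ?]; split; first by under eq_fun do rewrite Re_conjc.
by under eq_fun do rewrite Im_conjc; exact: measurableT_comp.
Qed.

Lemma cmeas_real (h : T -> R) : measurable_fun setT h -> cmeas (fun x => (h x)%:C).
Proof. by move=> mh; split => //=; exact: measurable_cst. Qed.

Lemma cmeas_expi (h : T -> R) : measurable_fun setT h -> cmeas (fun x => expi (h x)).
Proof.
move=> mh; split => /=.
  apply: (measurableT_comp _ mh).
  by apply: continuous_measurable_fun; exact: continuous_cos.
apply: (measurableT_comp _ mh).
by apply: continuous_measurable_fun; exact: continuous_sin.
Qed.

Lemma measurable_sqr_normc f : cmeas f ->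
  measurable_fun setT (fun x => normc (f x) ^+ 2).
Proof.
move=> [? ?]; under eq_fun do rewrite sqr_normcE.
by apply: measurable_funD; exact: measurable_funX.
Qed.

Lemma measurable_normc f : cmeas f -> measurable_fun setT (fun x => normc (f x)).
Proof.
move=> mf; under eq_fun => x.
  rewrite -[normc (f x)]ger0_norm ?normc_ge0// -sqrtr_sqr; over.
apply: (@measurableT_comp _ _ _ _ _ _ (@Num.sqrt R)).
  by apply: continuous_measurable_fun; exact: sqrt_continuous.
exact: measurable_sqr_normc.
Qed.

End complex_measurability.

Lemma cmeas_comp d d' (T : measurableType d) (U : measurableType d')
    (R : realType) (f : U -> R[i]) (h : T -> U) :
  cmeas f -> measurable_fun setT h -> cmeas (fun x => f (h x)).
Proof.
by move=> [mr mi] mh; split;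
  [exact: (measurableT_comp mr mh)|exact: (measurableT_comp mi mh)].
Qed.

Section real_integrable.
Context d (T : measurableType d) (R : realType).
Variable mu : {measure set T -> \bar R}.
Implicit Types (f g : T -> R) (c : R).
Local Notation rintegrable h := (mu.-integrable setT (EFin \o h)).

Lemma rintegrableD f g : rintegrable f -> rintegrable g ->
  rintegrable (fun x => f x + g x).
Proof.
move=> fi gi; have := integrableD measurableT fi gi.
by apply: eq_integrable => // x _; rewrite /= ?EFinD ?EFinB.
Qed.

Lemma rintegrableB f g : rintegrable f -> rintegrable g ->
  rintegrable (fun x => f x - g x).
Proof.
move=> fi gi; have := integrableB measurableT fi gi.
by apply: eq_integrable => // x _; rewrite /= ?EFinD ?EFinB.
Qed.

Lemma rintegrableZl c f : rintegrable f -> rintegrable (fun x => c * f x).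
Proof.
move=> fi; have := integrableZl measurableT c fi.
by apply: eq_integrable => // x _; rewrite /= EFinM.
Qed.

Lemma ge0_rintegrable f : measurable_fun setT f -> (forall x, 0 <= f x) ->
  (\int[mu]_x (f x)%:E < +oo)%E -> rintegrable f.
Proof.
move=> mf f0 foo; apply/integrableP; split; first exact/measurable_EFinP.
by under eq_integral => x _ do rewrite gee0_abs ?lee_fin//.
Qed.

End real_integrable.

Section complex_integral.
Context d (T : measurableType d) (R : realType).
Variable mu : {measure set T -> \bar R}.
Implicit Types (f g : T -> R[i]) (c : R[i]).

(** The integral and the norms are taken over an arbitrary measure because the
    transforms are studied on the line and on products as well as on R^n. *)
Definition cint f : R[i] :=
  Rintegral mu setT (fun x => Re (f x)) +i*
  Rintegral mu setT (fun x => Im (f x)).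

Definition norm1 f : \bar R := (\int[mu]_x (normc (f x))%:E)%E.

Definition sqnorm2 f : \bar R := (\int[mu]_x (normc (f x) ^+ 2)%:E)%E.

Definition cintegrable f := cmeas f /\ (norm1 f < +oo)%E.

Definition sq_cintegrable f := cmeas f /\ (sqnorm2 f < +oo)%E.

Lemma norm1_ge0 f : (0 <= norm1 f)%E.
Proof. by apply: integral_ge0 => x _; rewrite lee_fin normc_ge0. Qed.

Lemma sqnorm2_ge0 f : (0 <= sqnorm2 f)%E.
Proof. by apply: integral_ge0 => x _; rewrite lee_fin sqr_ge0. Qed.

Lemma le_norm1 f g : cmeas f -> cmeas g ->
  (forall x, normc (f x) <= normc (g x)) -> (norm1 f <= norm1 g)%E.
Proof.
move=> mf mg fg; apply: ge0_le_integral => //.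
- by move=> x _; rewrite lee_fin normc_ge0.
- exact/measurable_EFinP/measurable_normc.
- exact/measurable_EFinP/measurable_normc.
- by move=> x _; rewrite lee_fin.
Qed.

Lemma le_sqnorm2 f g : cmeas f -> cmeas g ->
  (forall x, normc (f x) <= normc (g x)) -> (sqnorm2 f <= sqnorm2 g)%E.
Proof.
move=> mf mg fg; apply: ge0_le_integral => //.
- by move=> x _; rewrite lee_fin sqr_ge0.
- exact/measurable_EFinP/measurable_sqr_normc.
- exact/measurable_EFinP/measurable_sqr_normc.
- by move=> x _; rewrite lee_fin lerXn2r// ?nnegrE ?normc_ge0.
Qed.

Lemma cintegrable_Re f : cintegrable f -> mu.-integrable setT (EFin \o (fun x => Re (f x))).
Proof.
move=> [mf foo]; apply/integrableP; split; first exact/measurable_EFinP/mf.1.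
apply: le_lt_trans foo; apply: ge0_le_integral => //.
- by apply: measurableT_comp => //; exact/measurable_EFinP/mf.1.
- exact/measurable_EFinP/measurable_normc.
- by move=> x _; rewrite lee_fin ler_Re_normc.
Qed.

Lemma cintegrable_Im f : cintegrable f -> mu.-integrable setT (EFin \o (fun x => Im (f x))).
Proof.
move=> [mf foo]; apply/integrableP; split; first exact/measurable_EFinP/mf.2.
apply: le_lt_trans foo; apply: ge0_le_integral => //.
- by apply: measurableT_comp => //; exact/measurable_EFinP/mf.2.
- exact/measurable_EFinP/measurable_normc.
- by move=> x _; rewrite lee_fin ler_Im_normc.
Qed.

Lemma cintegrableP f : mu.-integrable setT (EFin \o (fun x => Re (f x))) ->
  mu.-integrable setT (EFin \o (fun x => Im (f x))) -> cintegrable f.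
Proof.
move=> /integrableP[/measurable_EFinP mr rf] /integrableP[/measurable_EFinP mi if_].
have mf : cmeas f by split.
split=> //; apply: (@le_lt_trans _ _ (\int[mu]_x `|(Re (f x))%:E| +
    \int[mu]_x `|(Im (f x))%:E|)%E); last by rewrite lte_add_pinfty.
rewrite -ge0_integralD//; last 2 first.
- by apply: measurableT_comp => //; exact/measurable_EFinP.
- by apply: measurableT_comp => //; exact/measurable_EFinP.
apply: ge0_le_integral => //.
- by move=> x _; rewrite lee_fin normc_ge0.
- exact/measurable_EFinP/measurable_normc.
- by apply: emeasurable_funD; apply: measurableT_comp => //; exact/measurable_EFinP.
- by move=> x _; rewrite lee_fin ler_normc.
Qed.

Lemma le_cintegrable f g : cmeas f ->
  (forall x, normc (f x) <= normc (g x)) -> cintegrable g -> cintegrable f.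
Proof. by move=> mf fg [mg goo]; split=> //; exact: le_lt_trans (le_norm1 mf mg fg) goo. Qed.

Lemma cintegrableD f g : cintegrable f -> cintegrable g ->
  cintegrable (fun x => f x + g x).
Proof.
move=> fi gi; apply: cintegrableP.
  have := integrableD measurableT (cintegrable_Re fi) (cintegrable_Re gi).
  by apply: eq_integrable => // x _; rewrite /= Re_addc.
have := integrableD measurableT (cintegrable_Im fi) (cintegrable_Im gi).
by apply: eq_integrable => // x _; rewrite /= Im_addc.
Qed.

Lemma cintegrableJ f : cintegrable f -> cintegrable (fun x => (f x)^*).
Proof.
move=> fi; apply: le_cintegrable (fi); first exact/cmeasJ/fi.1.
by move=> x; rewrite normc_conj.
Qed.

Lemma norm1Z c f : cmeas f -> norm1 (fun x => c * f x) = ((normc c)%:E * norm1 f)%E.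
Proof.
move=> mf; rewrite /norm1 -ge0_integralZl//.
- by apply: eq_integral => x _; rewrite Normc.normcM EFinM.
- exact/measurable_EFinP/measurable_normc.
- by move=> x _; rewrite lee_fin normc_ge0.
- by rewrite lee_fin normc_ge0.
Qed.

Lemma sqnorm2Z c f : cmeas f ->
  sqnorm2 (fun x => c * f x) = ((normc c ^+ 2)%:E * sqnorm2 f)%E.
Proof.
move=> mf; rewrite /sqnorm2 -ge0_integralZl//.
- by apply: eq_integral => x _; rewrite Normc.normcM exprMn EFinM.
- exact/measurable_EFinP/measurable_sqr_normc.
- by move=> x _; rewrite lee_fin sqr_ge0.
- by rewrite lee_fin sqr_ge0.
Qed.

Lemma cintegrableZ c f : cintegrable f -> cintegrable (fun x => c * f x).
Proof.
move=> [mf foo]; split; first by apply: cmeasM => //; exact: cmeas_cst.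
by rewrite norm1Z// lte_mul_pinfty// lee_fin normc_ge0.
Qed.

Lemma eq_cint f g : f =1 g -> cint f = cint g.
Proof. by move=> /funext ->. Qed.

Lemma cintD f g : cintegrable f -> cintegrable g ->
  cint (fun x => f x + g x) = (cint f + cint g).
Proof.
move=> fi gi; apply: complex_eqP; rewrite ?(Re_addc, Im_addc) /=.
- under eq_Rintegral do rewrite Re_addc.
  by rewrite RintegralD//; exact: cintegrable_Re.
- under eq_Rintegral do rewrite Im_addc.
  by rewrite RintegralD//; exact: cintegrable_Im.
Qed.

Lemma cintZ c f : cintegrable f -> cint (fun x => c * f x) = (c * cint f).
Proof.
move=> fi; have ri := cintegrable_Re fi; have ii := cintegrable_Im fi.
apply: complex_eqP; rewrite ?(Re_mulc, Im_mulc) /=.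
- under eq_Rintegral do rewrite Re_mulc.
  by rewrite RintegralB//= ?RintegralZl//; exact: rintegrableZl.
- under eq_Rintegral do rewrite Im_mulc.
  by rewrite RintegralD//= ?RintegralZl//; exact: rintegrableZl.
Qed.

Lemma cintJ f : cintegrable f -> cint (fun x => (f x)^*) = ((cint f)^*).
Proof.
move=> fi; apply: complex_eqP; rewrite ?(Re_conjc, Im_conjc) /=.
  by under eq_Rintegral do rewrite Re_conjc.
under eq_Rintegral do rewrite Im_conjc -mulN1r.
by rewrite RintegralZl ?mulN1r//; exact: cintegrable_Im.
Qed.

(** Rotating the integral onto the positive axis reduces the triangle
    inequality to the real part of the integrand. *)
Lemma normc_cint_le f : cintegrable f -> ((normc (cint f))%:E <= norm1 f)%E.
Proof.
move=> fi; set z := cint f.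
have [z0|z0] := eqVneq (normc z) 0; first by rewrite z0 norm1_ge0.
have zgt0 : (0 < normc z) by rewrite lt_neqAle eq_sym z0 normc_ge0.
rewrite -(@lee_pmul2l _ (normc z)%:E) ?lte_fin// -EFinM -expr2.
have gi : cintegrable (fun x => z^*%C * f x) by exact: cintegrableZ.
have -> : (normc z ^+ 2) = Re (cint (fun x => z^*%C * f x)).
  by rewrite cintZ// -/z mulrC mulc_conj.
rewrite -[normc z in leRHS]normc_conj -norm1Z//; last exact: fi.1.
rewrite /cint /= /Rintegral fineK; last first.
  by apply: integrable_fin_num => //; exact: cintegrable_Re.
apply: le_integral => //; first exact: cintegrable_Re.
  by apply: ge0_rintegrable gi.2; [exact/measurable_normc/gi.1|
    move=> x; exact: normc_ge0].
by move=> x _; rewrite lee_fin (le_trans _ (ler_Re_normc _)) ?ler_norm.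
Qed.

Lemma norm1_eq0 f : cmeas f -> norm1 f = 0%E -> ae_eq mu setT f (fun=> 0).
Proof.
move=> mf f0.
have /ae_eq_integral_abs : measurable_fun setT (EFin \o (fun x => normc (f x))).
  exact/measurable_EFinP/measurable_normc.
move=> /(_ mu measurableT)[+ _].
under eq_integral => x _ do rewrite gee0_abs ?lee_fin ?normc_ge0//.
by move=> /(_ f0); apply: filterS => x /= /(_ I)[] /Normc.eq0_normc.
Qed.

Lemma ae_eq_cint f g : cmeas f -> cmeas g -> ae_eq mu setT f g -> cint f = cint g.
Proof.
move=> [? ?] [? ?] fg; apply: complex_eqP; congr fine; apply: ae_eq_integral => //.
- exact/measurable_EFinP.
- exact/measurable_EFinP.
- by apply: filterS fg => x /= /[apply] ->.
- exact/measurable_EFinP.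
- exact/measurable_EFinP.
- by apply: filterS fg => x /= /[apply] ->.
Qed.

Lemma ae_eq_sqnorm2 f g : cmeas f -> cmeas g -> ae_eq mu setT f g ->
  sqnorm2 f = sqnorm2 g.
Proof.
move=> mf mg fg; apply: ae_eq_integral => //.
- exact/measurable_EFinP/measurable_sqr_normc.
- exact/measurable_EFinP/measurable_sqr_normc.
- by apply: filterS fg => x /= /[apply] ->.
Qed.

Lemma ae_eq_norm1 f g : cmeas f -> cmeas g -> ae_eq mu setT f g ->
  norm1 f = norm1 g.
Proof.
move=> mf mg fg; apply: ae_eq_integral => //.
- exact/measurable_EFinP/measurable_normc.
- exact/measurable_EFinP/measurable_normc.
- by apply: filterS fg => x /= /[apply] ->.
Qed.

Lemma sqnorm2J f : sqnorm2 (fun x => (f x)^*) = sqnorm2 f.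
Proof. by apply: eq_integral => x _; rewrite normc_conj. Qed.

Lemma sqnorm2D_le f g : cmeas f -> cmeas g ->
  (sqnorm2 (fun x => (f x + g x)%R) <= 2%:E * (sqnorm2 f + sqnorm2 g))%E.
Proof.
move=> mf mg; have mf2 := measurable_sqr_normc mf; have mg2 := measurable_sqr_normc mg.
rewrite -ge0_integralD//=; last 4 first.
- by move=> x _; rewrite lee_fin sqr_ge0.
- exact/measurable_EFinP.
- by move=> x _; rewrite lee_fin sqr_ge0.
- exact/measurable_EFinP.
rewrite -ge0_integralZl//=; last 2 first.
- by apply: emeasurable_funD; exact/measurable_EFinP.
- by move=> x _; rewrite adde_ge0// lee_fin sqr_ge0.
apply: ge0_le_integral => //=.
- by move=> x _; rewrite lee_fin sqr_ge0.
- exact/measurable_EFinP/measurable_sqr_normc/cmeasD.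
- by apply: emeasurable_funM => //; apply: emeasurable_funD; exact/measurable_EFinP.
- by move=> x _; rewrite -EFinD -EFinM lee_fin sqr_normcD_le.
Qed.

Lemma sq_cintegrableZ c f : sq_cintegrable f -> sq_cintegrable (fun x => c * f x).
Proof.
move=> [mf foo]; split; first by apply: cmeasM => //; exact: cmeas_cst.
by rewrite sqnorm2Z// lte_mul_pinfty// lee_fin sqr_ge0.
Qed.

Lemma sq_cintegrableD f g : sq_cintegrable f -> sq_cintegrable g ->
  sq_cintegrable (fun x => f x + g x).
Proof.
move=> [mf foo] [mg goo]; split; first exact: cmeasD.
apply: le_lt_trans (sqnorm2D_le mf mg) _.
by rewrite lte_mul_pinfty// lte_add_pinfty.
Qed.

Lemma sq_cintegrableN f : sq_cintegrable f -> sq_cintegrable (fun x => - f x).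
Proof.
move=> /(sq_cintegrableZ (-1)); congr sq_cintegrable.
by apply/funext => x; rewrite mulN1r.
Qed.

Lemma sq_cintegrableB f g : sq_cintegrable f -> sq_cintegrable g ->
  sq_cintegrable (fun x => f x - g x).
Proof. by move=> fi gi; apply: sq_cintegrableD => //; exact: sq_cintegrableN. Qed.

Lemma sq_cintegrableJ f : sq_cintegrable f -> sq_cintegrable (fun x => (f x)^*).
Proof. by move=> [mf foo]; split; [exact: cmeasJ|rewrite sqnorm2J]. Qed.

Lemma cintegrableM f g : sq_cintegrable f -> sq_cintegrable g ->
  cintegrable (fun x => f x * g x).
Proof.
move=> [mf foo] [mg goo]; split; first exact: cmeasM.
apply: (@le_lt_trans _ _ (sqnorm2 f + sqnorm2 g)%E); last exact: lte_add_pinfty.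
have mf2 := measurable_sqr_normc mf; have mg2 := measurable_sqr_normc mg.
rewrite -ge0_integralD//=; last 4 first.
- by move=> x _; rewrite lee_fin sqr_ge0.
- exact/measurable_EFinP.
- by move=> x _; rewrite lee_fin sqr_ge0.
- exact/measurable_EFinP.
apply: ge0_le_integral => //.
- by move=> x _; rewrite lee_fin normc_ge0.
- exact/measurable_EFinP/measurable_normc/cmeasM.
- by apply: emeasurable_funD; exact/measurable_EFinP.
- by move=> x _; rewrite -EFinD lee_fin normcM_le.
Qed.

Lemma sq_cintegrable_integrable f : sq_cintegrable f ->
  mu.-integrable setT (EFin \o (fun x => normc (f x) ^+ 2)).
Proof.
move=> [mf foo]; apply: ge0_rintegrable foo; first exact: measurable_sqr_normc.
by move=> x; exact: sqr_ge0.
Qed.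

Lemma sqnorm2_fin_num f : sq_cintegrable f -> sqnorm2 f \is a fin_num.
Proof. by move=> [_ foo]; rewrite ge0_fin_numE// sqnorm2_ge0. Qed.

Lemma cint_mulJ f : sq_cintegrable f -> cint (fun x => f x * (f x)^*) = (fine (sqnorm2 f))%:C.
Proof.
move=> fi; apply: complex_eqP => /=.
  by under eq_Rintegral do rewrite mulc_conj.
by under eq_Rintegral do rewrite mulc_conj; rewrite Rintegral_cst ?mul0r.
Qed.

(** The law of cosines. It reads a cross term off three norms, so that an
    identity between norms yields one between inner products. *)
Lemma sqnorm2B f g : sq_cintegrable f -> sq_cintegrable g ->
  sqnorm2 (fun x => f x - g x) =
  (fine (sqnorm2 f) + fine (sqnorm2 g) - 2 * Re (cint (fun x => f x * (g x)^*)))%:E.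
Proof.
move=> fi gi; have fgi := cintegrableM fi (sq_cintegrableJ gi).
rewrite -[LHS]fineK; last exact/sqnorm2_fin_num/sq_cintegrableB.
congr EFin; rewrite -/(Rintegral _ _ _).
under eq_Rintegral do rewrite sqr_normcB.
have ri := cintegrable_Re fgi.
rewrite RintegralB//=; last 2 first.
- by apply: rintegrableD; exact: sq_cintegrable_integrable.
- exact: rintegrableZl.
rewrite RintegralD//=; last 2 first.
- exact: sq_cintegrable_integrable.
- exact: sq_cintegrable_integrable.
by rewrite RintegralZl.
Qed.

End complex_integral.

(** * Product measures, changes of variable and the Poisson kernel *)

Section product_sigma_finite.
Context d1 d2 (T1 : measurableType d1) (T2 : measurableType d2) (R : realType).
Variables (m1 : {sigma_finite_measure set T1 -> \bar R})
          (m2 : {sigma_finite_measure set T2 -> \bar R}).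

(** The product measure, packaged as a sigma-finite measure so that products
    can be iterated. *)
Definition prod_measure : set (T1 * T2) -> \bar R := (m1 \x m2)%E.

HB.instance Definition _ := Measure.copy prod_measure
  (lebesgue_integral_fubini_product_measure1__canonical__measure_function_Measure
    m1 m2).

Lemma sigma_finite_prod_measure : sigma_finite setT prod_measure.
Proof.
have /sigma_finiteP[A [UA ndA Aoo]] := sigma_finiteT m1.
have /sigma_finiteP[B [UB ndB Boo]] := sigma_finiteT m2.
exists (fun k => A k `*` B k) => [|k]; last first.
  have [mA Ak] := Aoo k; have [mB Bk] := Boo k; split; first exact: measurableX.
  by rewrite /prod_measure product_measure1E// lte_mul_pinfty// ge0_fin_numE.
apply/esym/seteqP; split => // -[x y] _.
have : [set: T1] x by []. have : [set: T2] y by [].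
rewrite UA UB => -[j _ Bj] [i _ Ai]; exists (maxn i j) => //; split => /=.
  by move: Ai; exact/subsetPset/ndA/leq_maxl.
by move: Bj; exact/subsetPset/ndB/leq_maxr.
Qed.

HB.instance Definition _ := Measure_isSigmaFinite.Build _ _ _ prod_measure
  sigma_finite_prod_measure.

End product_sigma_finite.

Section complex_fubini.
Context d1 d2 (T1 : measurableType d1) (T2 : measurableType d2) (R : realType).
Variables (m1 : {sigma_finite_measure set T1 -> \bar R})
          (m2 : {sigma_finite_measure set T2 -> \bar R}).
Implicit Types (F : T1 * T2 -> R[i]).

Let measurable_fun_Rintegral (f : T1 * T2 -> R) : measurable_fun setT f ->
  measurable_fun setT (fun x => Rintegral m2 setT (fun y => f (x, y))).
Proof.
move=> mf.
have mF : measurable_fun setT (EFin \o f) by exact/measurable_EFinP.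
have mp := @measurable_fun_fubini_tonelli_F _ _ _ _ _ m2 _
  (measurable_funepos mF) (funepos_ge0 _).
have mn := @measurable_fun_fubini_tonelli_F _ _ _ _ _ m2 _
  (measurable_funeneg mF) (funeneg_ge0 _).
rewrite (_ : (fun x => _) = fine \o
  (fun x => fubini_F m2 (EFin \o f)^\+%E x - fubini_F m2 (EFin \o f)^\-%E x)%E).
  by apply: measurableT_comp => //; exact: emeasurable_funB.
apply/funext => x; rewrite /Rintegral integralE /=.
by congr (fine (_ - _)%E); apply: eq_integral => y _; rewrite ?funeposE ?funenegE.
Qed.

Lemma cmeas_cint F : cmeas F -> cmeas (fun x => cint m2 (fun y => F (x, y))).
Proof. by move=> [mr mi]; split;
  [exact: (measurable_fun_Rintegral mr)|exact: (measurable_fun_Rintegral mi)]. Qed.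

Lemma norm1_prod1 F : cmeas F ->
  norm1 (prod_measure m1 m2) F = (\int[m1]_x norm1 m2 (fun y => F (x, y)))%E.
Proof.
move=> mF; apply: fubini_tonelli1; first exact/measurable_EFinP/measurable_normc.
by move=> x; rewrite lee_fin normc_ge0.
Qed.

Lemma norm1_prod2 F : cmeas F ->
  norm1 (prod_measure m1 m2) F = (\int[m2]_y norm1 m1 (fun x => F (x, y)))%E.
Proof.
move=> mF; apply: fubini_tonelli2; first exact/measurable_EFinP/measurable_normc.
by move=> x; rewrite lee_fin normc_ge0.
Qed.

Lemma sqnorm2_prod1 F : cmeas F ->
  sqnorm2 (prod_measure m1 m2) F = (\int[m1]_x sqnorm2 m2 (fun y => F (x, y)))%E.
Proof.
move=> mF; apply: fubini_tonelli1; first exact/measurable_EFinP/measurable_sqr_normc.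
by move=> x; rewrite lee_fin sqr_ge0.
Qed.

Lemma sqnorm2_prod2 F : cmeas F ->
  sqnorm2 (prod_measure m1 m2) F = (\int[m2]_y sqnorm2 m1 (fun x => F (x, y)))%E.
Proof.
move=> mF; apply: fubini_tonelli2; first exact/measurable_EFinP/measurable_sqr_normc.
by move=> x; rewrite lee_fin sqr_ge0.
Qed.

Let rintegrable_fine d (T : measurableType d) (m : {measure set T -> \bar R})
    (f : T -> \bar R) :
  m.-integrable setT f -> m.-integrable setT (EFin \o (fun x => fine (f x))).
Proof.
move=> fi; apply: le_integrable (fi) => //.
  by apply/measurable_EFinP; apply: measurableT_comp => //; exact: measurable_int fi.
by move=> x _ /=; case: (f x) => [r|//|//] /=; rewrite ?normr0 ?leey.
Qed.

Let integral_fine d (T : measurableType d) (m : {measure set T -> \bar R})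
    (f : T -> \bar R) : m.-integrable setT f ->
  Rintegral m setT (fun x => fine (f x)) = fine (\int[m]_x f x)%E.
Proof.
move=> fi; congr fine; apply: ae_eq_integral => //.
- exact: measurable_int (rintegrable_fine fi).
- exact: measurable_int fi.
- have := integrable_ae measurableT fi.
  by apply: filterS => x /= /[apply] /fineK.
Qed.

Lemma cint_prod1 F : cintegrable (prod_measure m1 m2) F ->
  cint m1 (fun x => cint m2 (fun y => F (x, y))) = cint (prod_measure m1 m2) F.
Proof.
move=> Fi; apply: complex_eqP => /=.
  rewrite [LHS](integral_fine (integrable_fubini_F (cintegrable_Re Fi))).
  by rewrite integral12_prod_meas1//; exact: cintegrable_Re.
rewrite [LHS](integral_fine (integrable_fubini_F (cintegrable_Im Fi))).
by rewrite integral12_prod_meas1//; exact: cintegrable_Im.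
Qed.

Let integrable_fubini_G (f : T1 * T2 -> \bar R) :
  (prod_measure m1 m2).-integrable setT f -> m2.-integrable setT (fubini_G m1 f).
Proof.
move=> fi; apply/integrableP; split; first exact: measurable_fubini_G fi.
have mf := measurable_int _ fi.
apply: (@le_lt_trans _ _ (\int[m2]_y \int[m1]_x `|f (x, y)|)%E); last first.
  exact: (integrable21ltyP m1 m2 mf).1 fi.
apply: ge0_le_integral => //.
- by apply: measurableT_comp => //; exact: measurable_fubini_G fi.
- apply: (measurable_fun_fubini_tonelli_G (abse \o f)) => //=.
  exact: measurableT_comp.
- by move=> y _; apply: le_abse_integral => //; exact: measurableT_comp.
Qed.

Lemma cint_prod2 F : cintegrable (prod_measure m1 m2) F ->
  cint m2 (fun y => cint m1 (fun x => F (x, y))) = cint (prod_measure m1 m2) F.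
Proof.
move=> Fi; apply: complex_eqP => /=.
  rewrite [LHS](integral_fine (integrable_fubini_G (cintegrable_Re Fi))).
  by rewrite integral21_prod_meas1//; exact: cintegrable_Re.
rewrite [LHS](integral_fine (integrable_fubini_G (cintegrable_Im Fi))).
by rewrite integral21_prod_meas1//; exact: cintegrable_Im.
Qed.

Lemma cintegrable_prod (f : T1 -> R[i]) (g : T2 -> R[i]) :
  cintegrable m1 f -> cintegrable m2 g ->
  cintegrable (prod_measure m1 m2) (fun p => f p.1 * g p.2).
Proof.
move=> [mf foo] [mg goo].
have mfg : cmeas (fun p : T1 * T2 => f p.1 * g p.2).
  by apply: cmeasM; [exact: (cmeas_comp mf)|exact: (cmeas_comp mg)].
split=> //; rewrite norm1_prod1//=.
under eq_integral do rewrite norm1Z// muleC.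
have gfin : norm1 m2 g \is a fin_num by rewrite ge0_fin_numE// norm1_ge0.
rewrite ge0_integralZl ?norm1_ge0//.
- by rewrite lte_mul_pinfty ?norm1_ge0.
- exact/measurable_EFinP/measurable_normc.
- by move=> x _; rewrite lee_fin normc_ge0.
Qed.

Lemma cint_prod_mul (f : T1 -> R[i]) (g : T2 -> R[i]) :
  cintegrable m1 f -> cintegrable m2 g ->
  cint (prod_measure m1 m2) (fun p => f p.1 * g p.2) = cint m1 f * cint m2 g.
Proof.
move=> fi gi; rewrite -cint_prod1; last exact: cintegrable_prod.
under eq_cint do rewrite /= cintZ// mulrC.
by rewrite cintZ// mulrC.
Qed.

End complex_fubini.

Section affine_change_of_variable.
Context {R : realType}.
Local Notation mu := (@lebesgue_measure R).
Implicit Types (phi : R -> \bar R) (a c : R).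

Let measurable_affine c a : measurable_fun setT
  ((fun x => c * x + a) : measurableTypeR R -> measurableTypeR R).
Proof. by apply: measurable_funD => //; exact: mulrl_measurable. Qed.

Lemma lebesgue_measure_affine c a (A : set R) : 0 < c -> measurable A ->
  (c%:E * mu ((fun x => c * x + a)%R @^-1` A))%E = mu A.
Proof.
move=> c0 mA; have c0' : 0 <= c by exact: ltW.
pose nu := mscale (NngNum c0')
  (measure_function_pushforward__canonical__measure_function_Measure mu
    (measurable_affine c a)).
rewrite -[LHS]/(nu A); apply/esym/lebesgue_measure_unique => // _ [[p q] /= _ <-].
rewrite /nu /mscale /= /pushforward (_ : _ @^-1` _ =
    `](p - a) / c, (q - a) / c]%classic); last first.
  apply/seteqP; split => x /=; rewrite !in_itv/= => /andP[px xq]; apply/andP; split.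
  - by rewrite ltr_pdivrMr// mulrC ltrBlDr.
  - by rewrite ler_pdivlMr// mulrC lerBrDr.
  - by move: px; rewrite ltr_pdivrMr// mulrC ltrBlDr.
  - by move: xq; rewrite ler_pdivlMr// mulrC lerBrDr.
rewrite !lebesgue_measure_itv/= !lte_fin ltr_pM2r ?invr_gt0// ltrD2r.
case: ifPn => _; last by rewrite mule0.
rewrite -EFinD -EFinM -mulrBl mulrCA mulfV ?gt_eqF// mulr1 EFinB; congr EFin.
by ring.
Qed.

Lemma ge0_integral_affine c a phi : 0 < c -> measurable_fun setT phi ->
  (forall x, (0 <= phi x)%E) ->
  (\int[mu]_x phi x = c%:E * \int[mu]_x phi (c * x + a)%R)%E.
Proof.
move=> c0 mphi phi0; have c0' : 0 <= c by exact: ltW.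
pose pf := measure_function_pushforward__canonical__measure_function_Measure mu
  (measurable_affine c a).
rewrite (eq_measure_integral (mscale (NngNum c0') pf)); last first.
  by move=> A mA _ /=; rewrite /mscale/= /pushforward lebesgue_measure_affine.
rewrite ge0_integral_mscale//=; congr (_ * _)%E.
by rewrite (ge0_integral_pushforward (measurable_affine c a)).
Qed.

Lemma ge0_integralN phi : measurable_fun setT phi -> (forall x, (0 <= phi x)%E) ->
  (\int[mu]_x phi x = \int[mu]_x phi (- x)%R)%E.
Proof.
move=> mphi phi0.
have mN : measurable_fun setT (-%R : measurableTypeR R -> measurableTypeR R).
  exact: oppr_measurable.
rewrite (eq_measure_integral
  (measure_function_pushforward__canonical__measure_function_Measure mu mN)).
  by rewrite (ge0_integral_pushforward mN).
by move=> A mA _; rewrite /= lebesgue_measureN.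
Qed.

(** Translation and reflection invariance, in the form used for convolutions. *)
Lemma ge0_integral_subl a phi : measurable_fun setT phi ->
  (forall x, (0 <= phi x)%E) ->
  (\int[mu]_x phi x = \int[mu]_x phi (a - x)%R)%E.
Proof.
move=> mphi phi0; rewrite (ge0_integral_affine a ltr01)// mul1e.
rewrite ge0_integralN//.
  by apply: eq_integral => x _; rewrite mul1r addrC.
by apply: measurableT_comp => //; exact: measurable_affine.
Qed.

Lemma ge0_integral_subr a phi : measurable_fun setT phi ->
  (forall x, (0 <= phi x)%E) ->
  (\int[mu]_x phi x = \int[mu]_x phi (x - a)%R)%E.
Proof.
move=> mphi phi0; rewrite (ge0_integral_affine (- a) ltr01)// mul1e.
by apply: eq_integral => x _; rewrite mul1r.
Qed.

(** Both parts of [f] have the same integral; if it is infinite, the difference is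
    [-oo], whose real value is 0. *)
Lemma Rintegral_odd (f : R -> R) : measurable_fun setT f ->
  (forall x, f (- x) = - f x) -> Rintegral mu setT f = 0.
Proof.
move=> mf fN; rewrite /Rintegral integralE.
rewrite (_ : \int[mu]_x (EFin \o f)^\- x = \int[mu]_x (EFin \o f)^\+ x)%E.
  by rewrite -/(EFin \o f); case: (\int[mu]_x _)%E => //= r; rewrite subrr.
rewrite ge0_integralN//; last exact/measurable_funeneg/measurable_EFinP.
by apply: eq_integral => x _; rewrite funenegE funeposE /= fN opprK.
Qed.

End affine_change_of_variable.

Section poisson_kernel.
Context {R : realType}.
Local Notation mu := (@lebesgue_measure R).
Implicit Types (eps s x : R).

Definition abel eps x : R := expR (- (eps * `|x|)).
Definition poisson eps s : R := 2 * eps / (eps ^+ 2 + s ^+ 2).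

Lemma poisson_ge0 eps s : 0 < eps -> 0 <= poisson eps s.
Proof.
by move=> e0; rewrite divr_ge0 ?mulr_ge0 ?addr_ge0 ?sqr_ge0// ltW.
Qed.

Lemma continuous_poisson eps : 0 < eps -> continuous (poisson eps).
Proof.
move=> e0 s; apply: (@continuousM _ _ (fun=> 2 * eps) (fun s => (eps ^+ 2 + s ^+ 2)^-1)).
  exact: cst_continuous.
apply: continuousV; first by rewrite gt_eqF// ltr_pwDl ?exprn_gt0 ?sqr_ge0.
by apply: continuousD; [exact: cst_continuous|exact: exprn_continuous].
Qed.

Lemma continuous_abel eps : continuous (abel eps).
Proof.
move=> x; apply: continuous_comp; last exact: continuous_expR.
apply: continuousN; apply: continuousM; first exact: cst_continuous.
exact: norm_continuous.
Qed.

Lemma measurable_abel eps : measurable_fun setT (abel eps).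
Proof. by apply: continuous_measurable_fun; exact: continuous_abel. Qed.

(* An antiderivative of [exp (- eps x) (1 + cos (s x))] on the half-line; the 1
   makes the integrand nonnegative, so that no integrability has to be known
   beforehand. *)
Let half eps s x : R := - expR (- (eps * x)) / eps +
  expR (- (eps * x)) * (s * sin (s * x) - eps * cos (s * x)) / (eps ^+ 2 + s ^+ 2).

Let is_derive_half eps s x : 0 < eps ->
  is_derive x 1 (half eps s) (expR (- (eps * x)) * (1 + cos (s * x))).
Proof.
move=> e0; have es0 : eps ^+ 2 + s ^+ 2 != 0.
  by rewrite gt_eqF// ltr_pwDl ?exprn_gt0 ?sqr_ge0.
apply: is_derive_eq.
by rewrite /GRing.scale /=; field; rewrite es0 gt_eqF.
Qed.

Let cvg_exp eps : 0 < eps -> expR (- (eps * x)) @[x --> +oo] --> (0 : R).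
Proof.
move=> e0; apply: (@cvg_comp _ _ _ (fun x : R => eps * x) (fun y : R => expR (- y))
  (pinfty_nbhs R) (pinfty_nbhs R) (nbhs (0 : R)) _ (@cvgr_expR R)).
exact: gt0_cvgMry e0 cvg_id.
Qed.

Let cvg_half eps s : 0 < eps -> half eps s x @[x --> +oo] --> 0.
Proof.
move=> e0; pose K := eps^-1 + (`|s| + eps) / (eps ^+ 2 + s ^+ 2).
have ex : (fun x => expR (- (eps * x)) * K) x @[x --> +oo] --> (0 : R).
  by rewrite -[X in _ --> X](mul0r K); apply: cvgM; [exact: cvg_exp|exact: cvg_cst].
have nex : (fun x => - (expR (- (eps * x)) * K)) x @[x --> +oo] --> (0 : R).
  by rewrite -[X in _ --> X]oppr0; exact: cvgN.
apply: squeeze_cvgr nex ex; apply: nearW => x.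
rewrite -ler_norml /half /K.
have -> : - expR (- (eps * x)) / eps +
  expR (- (eps * x)) * (s * sin (s * x) - eps * cos (s * x)) / (eps ^+ 2 + s ^+ 2) =
  expR (- (eps * x)) * (- eps^-1 + (s * sin (s * x) - eps * cos (s * x)) / (eps ^+ 2 + s ^+ 2)).
  by rewrite [RHS]mulrDr mulrN mulNr mulrA.
rewrite normrM ger0_norm ?expR_ge0// ler_wpM2l ?expR_ge0//.
rewrite (le_trans (ler_normD _ _))// normrN ger0_norm ?invr_ge0 ?(ltW e0)//.
rewrite lerD2l normrM [`|_^-1|]ger0_norm ?invr_ge0 ?addr_ge0 ?sqr_ge0//.
rewrite ler_wpM2r ?invr_ge0 ?addr_ge0 ?sqr_ge0//.
rewrite (le_trans (ler_normB _ _))// !normrM [`|eps|]ger0_norm ?(ltW e0)// lerD//.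
- by rewrite ler_piMr// sin_max.
- by rewrite ler_piMr ?(ltW e0)// cos_max.
Qed.

Let integral_half eps s : 0 < eps ->
  (\int[mu]_x (abel eps x * (1 + cos (s * x)))%:E =
   (2 / eps + poisson eps s)%:E)%E.
Proof.
move=> e0; rewrite ge0_symfun_integralT; last 3 first.
- move=> x; rewrite mulr_ge0 ?expR_ge0// -lerBlDl sub0r cos_geN1//.
- move=> x; apply: continuousM; first exact: continuous_abel.
  apply: continuousD; first exact: cst_continuous.
  apply: continuous_comp; last exact: continuous_cos.
  by apply: continuousM; first exact: cst_continuous.
- by move=> x /=; rewrite /abel normrN mulrN cosN.
rewrite -set_itvcy [X in (_ * X)%E](_ : _ =
    (\int[mu]_(x in `[0%R, +oo[) (expR (- (eps * x)) * (1 + cos (s * x)))%:E)%E); last first.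
  by apply: eq_integral => x; rewrite inE/= in_itv/= andbT => x0; rewrite /abel ger0_norm.
have dF x := is_derive_half s x e0.
have cF : continuous (fun x : R => expR (- (eps * x)) * (1 + cos (s * x))).
  move=> x; apply: (@continuousM _ _ (fun x => expR (- (eps * x)))
    (fun x => 1 + cos (s * x))).
    apply: continuous_comp; last exact: continuous_expR.
    apply: continuousN; apply: continuousM; [exact: cst_continuous|exact: cvg_id].
  apply: continuousD; first exact: cst_continuous.
  apply: continuous_comp; last exact: continuous_cos.
  by apply: continuousM; first exact: cst_continuous.
rewrite (@ge0_continuous_FTC2y _ _ (half eps s) 0 0); first last.
- by move=> x _; have dFx := dF x; rewrite derive1E derive_val.
- apply: cvg_at_right_filter; apply: differentiable_continuous; apply/derivable1_diffP.
  by have [] := dF 0.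
- by move=> x _; have [] := dF x.
- exact: cvg_half.
- exact: continuous_subspaceT.
- by move=> x x0; rewrite mulr_ge0 ?expR_ge0// -lerBlDl sub0r cos_geN1//.
rewrite -EFinN -EFinD -EFinM /half !mulr0 oppr0 expR0 sin0 cos0 /poisson; congr EFin.
have es0 : eps ^+ 2 + s ^+ 2 != 0.
  by rewrite gt_eqF// ltr_pwDl ?exprn_gt0 ?sqr_ge0.
by field; rewrite es0 gt_eqF.
Qed.

Lemma integral_abel eps : 0 < eps -> (\int[mu]_x (abel eps x)%:E = (2 / eps)%:E)%E.
Proof.
move=> e0; have := integral_half 0 e0.
under eq_integral do rewrite mul0r cos0 mulrC EFinM.
rewrite ge0_integralZl//.
- move=> /(congr1 (fun z => (2^-1)%:E * z)%E); rewrite muleA -!EFinM.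
  rewrite (_ : 2^-1 * (1 + 1) = 1) ?mul1e; last by field.
  by move=> ->; congr EFin; rewrite /poisson expr0n/= addr0; field; rewrite gt_eqF.
- by move/measurable_EFinP: (measurable_abel eps).
- by move=> x _; rewrite lee_fin expR_ge0.
Qed.

Lemma rintegrable_abel eps : 0 < eps -> mu.-integrable setT (EFin \o abel eps).
Proof.
move=> e0; apply: ge0_rintegrable.
- exact: measurable_abel.
- by move=> x; exact: expR_ge0.
- by rewrite integral_abel// ltry.
Qed.

(** The Poisson kernel is the Fourier transform of the Abel weight. *)
Lemma cint_abel_expi eps s : 0 < eps ->
  cint mu (fun x => (abel eps x)%:C * expi (- (x * s))) = (poisson eps s)%:C.
Proof.
move=> e0; have ai := rintegrable_abel e0.
have trig_i (h : R -> R) : continuous h -> (forall x, `|h x| <= 1) ->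
    mu.-integrable setT (EFin \o (fun x => abel eps x * h (s * x))).
  move=> ch h1; apply: le_integrable ai => //.
    apply/measurable_EFinP; apply: measurable_funM; first exact: measurable_abel.
    apply: (@measurableT_comp _ _ _ _ _ _ h); last exact: mulrl_measurable.
    exact: continuous_measurable_fun.
  by move=> x _; rewrite lee_fin normrM ler_piMr.
have ci := trig_i _ (@continuous_cos R) (@cos_max R).
apply: complex_eqP => /=.
  have : Rintegral mu setT (fun x => abel eps x + abel eps x * cos (s * x)) =
      2 / eps + poisson eps s.
    by under eq_Rintegral do rewrite -{1}[abel _ _]mulr1 -mulrDr;
      rewrite /Rintegral integral_half.
  rewrite RintegralD// [X in X + _ = _](_ : _ = 2 / eps); last first.
    by rewrite /Rintegral integral_abel.
  move=> /addrI <-; apply: eq_Rintegral => x _.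
  by rewrite mul0r subr0 cosN [x * s]mulrC.
apply: Rintegral_odd.
  apply: measurable_funD; apply: measurable_funM => //.
  - exact: measurable_abel.
  - apply: measurableT_comp.
      by apply: continuous_measurable_fun; exact: continuous_sin.
    by apply: measurableT_comp => //; exact: mulrr_measurable.
  - apply: measurableT_comp.
      by apply: continuous_measurable_fun; exact: continuous_cos.
    by apply: measurableT_comp => //; exact: mulrr_measurable.
by move=> x; rewrite /abel normrN mulNr !sinN !mul0r !addr0 mulrN.
Qed.

(** [2 * atan] is an antiderivative. *)
Lemma integral_poisson1 : (\int[mu]_x (poisson 1 x)%:E = (2 * pi)%:E)%E.
Proof.
have pE x : poisson 1 x = 2 / (1 + x ^+ 2) by rewrite /poisson mulr1 expr1n.
have p0 x : 1 + x ^+ 2 != 0 :> R by rewrite gt_eqF// ltr_pwDl ?sqr_ge0.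
have cp : continuous (poisson 1) by exact: continuous_poisson.
rewrite ge0_symfun_integralT//; last 2 first.
- by move=> x; rewrite poisson_ge0.
- by move=> x /=; rewrite !pE sqrrN.
rewrite -set_itvcy (@ge0_continuous_FTC2y _ _ (fun x => 2 * atan x) 0 (2 * (pi / 2))).
- by rewrite atan0 mulr0 sube0 -EFinM; congr EFin; field.
- by move=> x _; exact: poisson_ge0.
- exact: continuous_subspaceT.
- by apply: cvgM; [exact: cvg_cst|exact: cvgy_atan].
- by move=> x _; apply: derivableM => //; exact: derivable_atan.
- apply: cvg_at_right_filter; apply: cvgM; first exact: cvg_cst.
  exact: continuous_atan.
- move=> x _; rewrite derive1E deriveM//.
  rewrite derive_cst -[X in _ *: X]derive1E derive1_atan pE scaler0 addr0.
  by [].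
Qed.

Lemma poisson_scale eps s : 0 < eps -> eps * poisson eps (eps * s) = poisson 1 s.
Proof.
move=> e0; rewrite /poisson expr1n mulr1 exprMn.
have p0 : 1 + s ^+ 2 != 0 :> R by rewrite gt_eqF// ltr_pwDl ?sqr_ge0.
have -> : eps ^+ 2 + eps ^+ 2 * s ^+ 2 = eps ^+ 2 * (1 + s ^+ 2) by ring.
by field; rewrite p0 gt_eqF.
Qed.

Lemma measurable_poisson eps : 0 < eps -> measurable_fun setT (poisson eps).
Proof. by move=> e0; apply: continuous_measurable_fun; exact: continuous_poisson. Qed.

Lemma integral_poisson eps : 0 < eps ->
  (\int[mu]_x (poisson eps x)%:E = (2 * pi)%:E)%E.
Proof.
move=> e0; rewrite (ge0_integral_affine 0 e0).
- rewrite -integral_poisson1 -ge0_integralZl.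
  + by apply: eq_integral => x _; rewrite addr0 -EFinM poisson_scale.
  + by [].
  + apply/measurable_EFinP; apply: measurableT_comp; first exact: measurable_poisson.
    by apply: measurable_funD => //; exact: mulrl_measurable.
  + by move=> x _; rewrite lee_fin poisson_ge0.
  + by rewrite lee_fin ltW.
- by move/measurable_EFinP: (measurable_poisson e0).
- by move=> x; rewrite lee_fin poisson_ge0.
Qed.

End poisson_kernel.

(** * Continuity of translations in L^2 *)

Section ereal_convergence_to_zero.
Context {R : realType}.
Implicit Types a b : (\bar R)^nat.

(** Stated without finiteness, since the first terms of a sequence of norms may be
    infinite. *)
Lemma ge0_ereal_cvg0P a : (forall k, (0 <= a k)%E) ->
  (a @ \oo --> 0%E) <->
  (forall e : R, 0 < e -> \forall k \near \oo, (a k <= e%:E)%E).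
Proof.
move=> a0; split=> [/fine_cvgP[afin /cvgrPdist_le ac] e e0|h].
  near=> k; rewrite -[a k]fineK; last by near: k.
  rewrite lee_fin (le_trans (ler_norm _))// -normrN -[- _]add0r.
  by near: k; exact: ac.
apply/fine_cvgP; split.
  near=> k; rewrite ge0_fin_numE//; apply: (@le_lt_trans _ _ 1%:E); last exact: ltry.
  by near: k; exact: h.
apply/cvgrPdist_le => e e0; near=> k.
have ak : (a k <= e%:E)%E by near: k; exact: h.
rewrite sub0r normrN ger0_norm ?fine_ge0//.
rewrite -lee_fin fineK// ge0_fin_numE//; exact: le_lt_trans ak (ltry _).
Unshelve. all: by end_near. Qed.

Lemma ge0_ereal_squeeze0 a b : (forall k, (0 <= a k <= b k)%E) ->
  b @ \oo --> 0%E -> a @ \oo --> 0%E.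
Proof.
by move=> ab; apply: squeeze_cvge (cvg_cst 0%E); exact: nearW.
Qed.

End ereal_convergence_to_zero.

Lemma dominated_cvg0 d (T : measurableType d) (R : realType)
    (mu : {measure set T -> \bar R}) (F : nat -> T -> R) (g : T -> R) :
  (forall k, measurable_fun setT (F k)) ->
  (forall k x, 0 <= F k x <= g x) ->
  mu.-integrable setT (EFin \o g) ->
  {ae mu, forall x, F ^~ x @ \oo --> 0} ->
  (fun k => \int[mu]_x (F k x)%:E)%E @ \oo --> 0%E.
Proof.
move=> mF Fg gi Fc.
have := @dominated_convergence _ _ _ mu setT measurableT
  (fun k x => (F k x)%:E) (fun=> 0%E) (EFin \o g).
move=> [].
- by move=> k; exact/measurable_EFinP.
- exact: measurable_cst.
- apply: filterS Fc => x Fx _; apply/fine_cvgP; split; first exact: nearW.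
  exact: Fx.
- by [].
- apply: aeW => x k _ /=; rewrite lee_fin ger0_norm; by have /andP[] := Fg k x.
- by rewrite integral0.
Qed.

Lemma ler_sqr_norm (R : realDomainType) (a b : R) : `|a| <= b -> a ^+ 2 <= b ^+ 2.
Proof.
move=> ab; rewrite -(real_normK (num_real a)).
by rewrite lerXn2r ?nnegrE// (le_trans _ ab).
Qed.

Section clamp.
Context {R : realType}.
Implicit Types M x y : R.

Definition clamp M x := Num.max (- M) (Num.min x M).

Lemma norm_clamp M x : 0 <= M -> `|clamp M x| <= M.
Proof.
move=> M0; rewrite /clamp ler_norml le_max lexx /=.
by rewrite ge_max ge_min lexx orbT andbT; lra.
Qed.

Lemma clamp_id M x : `|x| <= M -> clamp M x = x.
Proof. by rewrite /clamp ler_norml => /andP[a b]; rewrite min_l// max_r. Qed.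

Lemma clamp_dist M x y : 0 <= M -> `|clamp M x - clamp M y| <= `|x - y|.
Proof.
move=> M0; have := ler_norm (x - y); have := ler_norm (y - x); rewrite distrC.
rewrite /clamp /Num.max /Num.min ler_norml.
case: (ltP x M) => ?; case: (ltP y M) => ?; do 2 case: ltP => ?;
  move=> *; apply/andP; split; lra.
Qed.

Lemma norm_sub_clamp M x : 0 <= M -> `|x - clamp M x| <= `|x|.
Proof.
move=> M0; have := ler_norm x; have := ler_norm (- x); rewrite normrN.
rewrite /clamp /Num.max /Num.min ler_norml.
by case: (ltP x M) => ?; case: ltP => ? *; apply/andP; split; lra.
Qed.

Lemma continuous_clamp M : continuous (clamp M).
Proof.
move=> x; apply: (@continuous_max _ _ (fun=> - M) (fun x => Num.min x M)).
  exact: cvg_cst.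
by apply: (@continuous_min _ _ id (fun=> M)); [exact: cvg_id|exact: cvg_cst].
Qed.

Lemma measurable_clamp M : measurable_fun setT (clamp M).
Proof. by apply: continuous_measurable_fun; exact: continuous_clamp. Qed.

End clamp.

Section shift_continuity.
Context {R : realType}.
Local Notation mu := (@lebesgue_measure R).
Implicit Types (f g h : R -> R) (s : R) (u : nat -> R).

Definition shift_dev f s : \bar R := (\int[mu]_y ((f y - f (y - s)) ^+ 2)%:E)%E.

Definition shift_continuous f := forall u, u @ \oo --> 0 ->
  (fun k => shift_dev f (u k)) @ \oo --> 0%E.

Lemma measurable_shift f s : measurable_fun setT f ->
  measurable_fun setT (fun y : R => f (y - s)).
Proof.
move=> mf; apply: (@measurableT_comp _ _ _ _ _ _ f) => //.
by apply: measurable_funB => //; exact: measurable_cst.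
Qed.

Lemma shift_dev_ge0 f s : (0 <= shift_dev f s)%E.
Proof. by apply: integral_ge0 => x _; rewrite lee_fin sqr_ge0. Qed.

(** An [L^2]-limit of functions whose translates depend continuously on the
    shift has the same property, since translations are isometries. *)
Lemma shift_continuous_approx f : measurable_fun setT f ->
  (forall e : R, 0 < e -> exists g, [/\ measurable_fun setT g, shift_continuous g &
    (\int[mu]_x ((f x - g x) ^+ 2)%:E <= e%:E)%E]) ->
  shift_continuous f.
Proof.
move=> mf fg u u0; apply/ge0_ereal_cvg0P; first by move=> k; exact: shift_dev_ge0.
move=> e e0; have e9 : 0 < e / 9 by lra.
have [g [mg gc fge]] := fg _ e9.
have /ge0_ereal_cvg0P := gc _ u0.
move=> /(_ (fun k => shift_dev_ge0 _ _) _ e9); apply: filterS => k gk.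
have mfg : measurable_fun setT (fun x => (f x - g x) ^+ 2).
  by apply: measurable_funX; exact: measurable_funB.
have mgg : measurable_fun setT (fun y => (g y - g (y - u k)) ^+ 2).
  by apply: measurable_funX; apply: measurable_funB => //; exact: measurable_shift.
have mfgs := measurable_shift (u k) mfg.
rewrite (_ : e%:E = 3%:E * ((e / 9)%:E + ((e / 9)%:E + (e / 9)%:E)))%E; last first.
  by rewrite -!EFinD -EFinM; congr EFin; field.
apply: (@le_trans _ _ (3%:E * (\int[mu]_x ((f x - g x) ^+ 2)%:E +
   (shift_dev g (u k) + \int[mu]_x ((f (x - u k) - g (x - u k)) ^+ 2)%:E)))%E); last first.
  rewrite lee_pmul2l ?lte_fin// leeD// leeD//.
  rewrite -(ge0_integral_subr (u k) (phi := fun x => ((f x - g x) ^+ 2)%:E))//.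
    exact/measurable_EFinP.
  by move=> x; rewrite lee_fin sqr_ge0.
rewrite -ge0_integralD//=; last 4 first.
- by move=> x _; rewrite lee_fin sqr_ge0.
- exact/measurable_EFinP.
- by move=> x _; rewrite lee_fin sqr_ge0.
- by move/measurable_EFinP: mfgs.
rewrite -ge0_integralD//=; last 4 first.
- by move=> x _; rewrite lee_fin sqr_ge0.
- exact/measurable_EFinP.
- by move=> x _; rewrite adde_ge0// lee_fin sqr_ge0.
- by apply: emeasurable_funD; [exact/measurable_EFinP|move/measurable_EFinP: mfgs].
rewrite -ge0_integralZl//=; last 2 first.
- apply: emeasurable_funD; first exact/measurable_EFinP.
  by apply: emeasurable_funD; [exact/measurable_EFinP|move/measurable_EFinP: mfgs].
- by move=> x _; rewrite !adde_ge0// lee_fin sqr_ge0.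
apply: ge0_le_integral => //=.
- by move=> x _; rewrite lee_fin sqr_ge0.
- apply/measurable_EFinP; apply: measurable_funX; apply: measurable_funB => //.
  exact: measurable_shift.
- apply: emeasurable_funM => //; apply: emeasurable_funD; first exact/measurable_EFinP.
  by apply: emeasurable_funD; [exact/measurable_EFinP|move/measurable_EFinP: mfgs].
- move=> x _; rewrite -!EFinD -EFinM lee_fin.
  move: (f x) (g x) (f (x - u k)) (g (x - u k)) => a b c d.
  have := sqr_ge0 ((a - b) - (b - d)); have := sqr_ge0 ((a - b) + (c - d)).
  by have := sqr_ge0 ((b - d) + (c - d)); lra.
Qed.

Let itvM (M : R) := `[- M, M]%classic : set R.

(** The base case of the approximation: a bounded function supported in an
    interval and continuous inside it. Its translates converge pointwise except
    at the two endpoints, under an integrable bound. *)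
Lemma shift_continuous_clamp h M : continuous h -> 0 <= M ->
  shift_continuous (fun x => clamp M (h x) * \1_(itvM M) x).
Proof.
move=> ch M0 u u0; rewrite /shift_dev.
set g := fun x => clamp M (h x) * \1_(itvM M) x.
have mg : measurable_fun setT g.
  apply: measurable_funM; last by apply: measurable_indic; exact: measurable_itv.
  apply: measurableT_comp; first exact: measurable_clamp.
  exact: continuous_measurable_fun.
have chM : continuous (clamp M \o h).
  by move=> x; apply: continuous_comp; [exact: ch|exact: continuous_clamp].
have gM x : `|g x| <= M * \1_(itvM M) x.
  by rewrite normrM [`|\1_ _ _|]ger0_norm ?indicE// ler_wpM2r// norm_clamp.
have [B B0 uB] : exists2 B, 0 <= B & forall k, `|u k| <= B.
  have /cvg_seq_bounded[B [_ hB]] : cvgn u by apply/cvg_ex; exists 0.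
  exists (`|B| + 1) => [|k]; first by rewrite addr_ge0.
  by apply: hB => //; rewrite ltr_pwDr// ler_norm.
apply: (@dominated_cvg0 _ _ _ mu (fun k y => (g y - g (y - u k)) ^+ 2)
  (fun x => (2 * M) ^+ 2 * \1_(itvM (M + B)) x)).
- move=> k; apply: measurable_funX; apply: measurable_funB => //.
  exact: measurable_shift.
- move=> k x; rewrite sqr_ge0 /=.
  have [xB|xB] := boolP (x \in itvM (M + B)).
    rewrite indicE xB mulr1 ler_sqr_norm//.
    rewrite (le_trans (ler_normB _ _))// mulr_natl mulr2n.
    by rewrite lerD// (le_trans (gM _))// ler_piMr// indicE lern1 leq_b1.
  rewrite /g !indicE (negbTE xB) mulr0.
  have -> : (x \in itvM M) = false.
    apply: contraNF xB; rewrite !inE /itvM /= !in_itv /= => /andP[a b].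
    by apply/andP; split; lra.
  have -> : (x - u k \in itvM M) = false.
    apply: contraNF xB; rewrite !inE /itvM /= !in_itv /= => /andP[a b].
    by have := uB k; rewrite ler_norml => /andP[c d]; apply/andP; split; lra.
  by rewrite !mulr0 subr0 expr0n.
- apply: rintegrableZl; exact: integrable_indic_itv.
- pose N : set R := [set M; - M].
  have N0 : mu N = 0%E.
    rewrite /N measureU0//; exact: lebesgue_measure_set1.
  exists N; split => //.
    by rewrite /N; apply: measurableU; exact: measurable_set1.
  move=> x /=; apply: contra_notP => xN.
  have xM : 0 < `| `|x| - M |.
    rewrite normr_gt0 subr_eq0; apply/eqP => xM; apply: xN.
    by rewrite /N -xM; have [_|_] := ler0P x; [right; rewrite opprK|left].
  have uxM : \forall k \near \oo, `|u k| < `| `|x| - M |.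
    by move/cvgr0Pnorm_lt : u0; apply.
  have indE y : \1_(itvM M) y = (`|y| <= M)%R%:R :> R.
    rewrite indicE; congr (_%:R); congr nat_of_bool.
    by apply/idP/idP; rewrite inE /itvM/= in_itv/= ler_norml.
  have : (fun k => (\1_(itvM M) x * (clamp M (h x) - clamp M (h (x - u k)))) ^+ 2)
      @ \oo --> 0.
    rewrite -[X in _ --> X](_ : (\1_(itvM M) x * (clamp M (h x) - clamp M (h x))) ^+ 2 = 0);
      last by rewrite subrr mulr0 expr0n.
    apply: (@cvg_comp _ _ _ _ (fun y : R => y ^+ 2) _ (nbhs _)); last exact: exprn_continuous.
    apply: cvgM; first exact: cvg_cst.
    apply: cvgB; first exact: cvg_cst.
    apply: (@cvg_comp _ _ _ (fun k => x - u k) (clamp M \o h) _ (nbhs x)).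
      have : (fun k => x - u k) @ \oo --> x - 0 by apply: cvgB => //; exact: cvg_cst.
      by rewrite subr0.
    exact: chM.
  apply: cvg_trans; apply: near_eq_cvg; apply: filterS uxM => k uxM.
  rewrite /g !indE (_ : (`|x - u k| <= M) = (`|x| <= M)); first by congr (_ ^+ 2); ring.
  move: uxM (ler_normB x (u k)) (lerB_dist x (u k)) => + *.
  by case: (ler0P (`|x| - M)) => ? ?; apply/idP/idP => ?; lra.
Qed.

(** Every square integrable function is an [L^2]-limit of truncations, and
    a truncation is an [L^2]-limit of clamped continuous functions by density
    of continuous functions in [L^1]. *)
Lemma shift_continuous_sq_integrable f : measurable_fun setT f ->
  (\int[mu]_x ((f x) ^+ 2)%:E < +oo)%E -> shift_continuous f.
Proof.
move=> mf foo; apply: shift_continuous_approx => // e e0.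
pose fM M := fun x => clamp M (f x) * \1_(itvM M) x.
have mfM M : measurable_fun setT (fM M).
  apply: measurable_funM; last by apply: measurable_indic; exact: measurable_itv.
  by apply: measurableT_comp => //; exact: measurable_clamp.
have : (fun k : nat => \int[mu]_x ((f x - fM k%:R x) ^+ 2)%:E)%E @ \oo --> 0%E.
  apply: (@dominated_cvg0 _ _ _ mu (fun k x => (f x - fM k%:R x) ^+ 2)
    (fun x => (f x) ^+ 2)).
  - by move=> k; apply: measurable_funX; apply: measurable_funB => //; exact: mfM.
  - move=> k x; rewrite sqr_ge0 /= -(real_normK (num_real (f x))) ler_sqr_norm// /fM indicE.
    by case: (_ \in _); rewrite ?mulr1 ?mulr0 ?subr0// norm_sub_clamp.
  - by apply: ge0_rintegrable foo; [exact: measurable_funX|move=> x; exact: sqr_ge0].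
  - apply: aeW => x; apply: cvg_near_cst.
    near=> k; have xk : Num.max `|x| `|f x| <= k%:R by near: k; exact: nbhs_infty_ger.
    move: xk; rewrite ge_max => /andP[xk fk].
    rewrite /fM clamp_id// indicE mem_set ?mulr1 ?subrr ?expr0n//.
    by rewrite /itvM /= in_itv /= -ler_norml.
move=> /ge0_ereal_cvg0P h; have {h} := h _ _ e0.
move=> []; first by move=> k; apply: integral_ge0 => x _; rewrite lee_fin sqr_ge0.
move=> k _ /(_ k (leqnn k)) /= fk.
exists (fM k%:R); split => //.
apply: shift_continuous_approx => // d d0.
pose M : R := k%:R; have M0 : 0 <= M by [].
have mE : measurable (itvM M) by exact: measurable_itv.
have Eoo : (mu (itvM M) < +oo)%E.
  by rewrite /itvM lebesgue_measure_itv/=; case: ifPn; rewrite ?ltry.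
have fi : mu.-integrable (itvM M) (EFin \o fM M).
  apply: measurable_bounded_integrable => //.
    by apply: measurable_funTS; exact: mfM.
  exists M; split; first exact: num_real.
  move=> x Mx y _; rewrite /= /fM normrM indicE (le_trans _ (ltW Mx))//.
  rewrite (le_trans _ (norm_clamp (f y) M0))// ler_piMr//.
  by rewrite ger0_norm// lern1 leq_b1.
have [h [ch _ hc]] := approximation_continuous_integrable mE Eoo fi.
have dM : 0 < d / (2 * M + 1) by rewrite divr_gt0// ltr_wpDl// mulr_ge0.
have hc0 n : (0 <= \int[mu]_(z in itvM M) `|(fM M z - h n z)%:E|)%E.
  exact: integral_ge0.
have [n _ /(_ n (leqnn n)) /= hn] := (ge0_ereal_cvg0P hc0).1 hc _ dM.
pose g x := clamp M (h n x) * \1_(itvM M) x.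
have mg : measurable_fun setT g.
  apply: measurable_funM; last by apply: measurable_indic; exact: measurable_itv.
  apply: measurableT_comp; first exact: measurable_clamp.
  exact: continuous_measurable_fun.
exists g; split => //; first exact: shift_continuous_clamp.
have mfh : measurable_fun (itvM M) (fun x => fM M x - h n x).
  apply: measurable_funB; apply: measurable_funTS; first exact: mfM.
  exact: continuous_measurable_fun.
have mabs : measurable_fun (itvM M) (fun x => `|(fM M x - h n x)%:E|%E).
  by apply: measurableT_comp => //; exact/measurable_EFinP.
apply: (@le_trans _ _ ((2 * M)%:E * \int[mu]_(z in itvM M) `|(fM M z - h n z)%:E|)%E); last first.
  apply: (@le_trans _ _ ((2 * M)%:E * (d / (2 * M + 1))%:E)%E).
    by rewrite lee_wpmul2l// lee_fin mulr_ge0.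
  rewrite -EFinM lee_fin mulrCA ler_piMr ?(ltW d0)//.
  by rewrite ler_pdivrMr ?mul1r ?lerDl// ltr_wpDl// mulr_ge0.
rewrite -ge0_integralZl//=; last by rewrite lee_fin mulr_ge0.
rewrite [leRHS]integral_mkcond; apply: ge0_le_integral => //.
- by move=> x _; rewrite lee_fin sqr_ge0.
- apply/measurable_EFinP; apply: measurable_funX.
  by apply: measurable_funB => //; exact: mfM.
- by move/(measurable_restrictT _ mE): (measurable_funeM (2 * M)%:E mabs).
- move=> x _; rewrite /patch /fM /g indicE; case: (_ \in _); last first.
    by rewrite !mulr0 subr0 expr0n.
  rewrite !mulr1 -EFinM lee_fin -(real_normK (num_real (_ - _))) expr2.
  rewrite ler_pM//.
    by rewrite (le_trans (ler_normB _ _))// mulr_natl mulr2n lerD// norm_clamp.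
  by rewrite -[in leLHS](@clamp_id _ M (clamp M (f x))) ?norm_clamp// clamp_dist.
Unshelve. all: by end_near. Qed.

Lemma shift_sqnorm2_cvg0 (f : R -> R[i]) u : sq_cintegrable mu f ->
  u @ \oo --> 0 ->
  (fun k => sqnorm2 mu (fun y => f y - f (y - u k))) @ \oo --> 0%E.
Proof.
move=> [mf foo] u0.
have rf : shift_continuous (fun y => Re (f y)).
  apply: shift_continuous_sq_integrable; first exact: mf.1.
  apply: le_lt_trans foo; apply: ge0_le_integral => //.
  - by move=> x _; rewrite lee_fin sqr_ge0.
  - by apply/measurable_EFinP; apply: measurable_funX; exact: mf.1.
  - exact/measurable_EFinP/measurable_sqr_normc.
  - by move=> x _; rewrite lee_fin sqr_normcE lerDl sqr_ge0.
have if_ : shift_continuous (fun y => Im (f y)).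
  apply: shift_continuous_sq_integrable; first exact: mf.2.
  apply: le_lt_trans foo; apply: ge0_le_integral => //.
  - by move=> x _; rewrite lee_fin sqr_ge0.
  - by apply/measurable_EFinP; apply: measurable_funX; exact: mf.2.
  - exact/measurable_EFinP/measurable_sqr_normc.
  - by move=> x _; rewrite lee_fin sqr_normcE lerDr sqr_ge0.
have : (shift_dev (fun y => Re (f y)) (u k) + shift_dev (fun y => Im (f y)) (u k))%E
    @[k --> \oo] --> (0 + 0)%E by apply: cvgeD => //; [exact: rf|exact: if_].
rewrite adde0; apply: cvg_trans; apply: near_eq_cvg; apply: nearW => k.
rewrite /shift_dev -ge0_integralD//=.
- by apply: eq_integral => y _; rewrite sqr_normcE Re_subc Im_subc.
- by move=> x _; rewrite lee_fin sqr_ge0.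
- apply/measurable_EFinP; apply: measurable_funX; apply: measurable_funB; first exact: mf.1.
  by apply: (@measurable_shift (fun y => Re (f y))); exact: mf.1.
- by move=> x _; rewrite lee_fin sqr_ge0.
- apply/measurable_EFinP; apply: measurable_funX; apply: measurable_funB; first exact: mf.2.
  by apply: (@measurable_shift (fun y => Im (f y))); exact: mf.2.
Qed.

End shift_continuity.

(** * Kernel transforms; Plancherel's identity on the line *)

Section kernel_transform.
Context d (T : measurableType d) (R : realType).
Variable mu : {sigma_finite_measure set T -> \bar R}.
Implicit Types (e : T -> T -> R[i]) (f g : T -> R[i]).

Definition unimodular e :=
  cmeas (fun p : T * T => e p.1 p.2) /\ forall x y, normc (e x y) = 1.

Definition ktransform e f x := cint mu (fun y => f y * e x y).

(** A property of the kernel rather than a theorem, so that what follows from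
    Plancherel's identity can be proved once for all kernels. *)
Definition plancherel_for e (c : R) := forall f, cintegrable mu f ->
  sq_cintegrable mu f -> sqnorm2 mu (ktransform e f) = (c%:E * sqnorm2 mu f)%E.

Lemma cmeas_kernel_row e x : unimodular e -> cmeas (e x).
Proof.
move=> [me _]; apply: (cmeas_comp (f := fun p : T * T => e p.1 p.2) (h := pair x)) => //.
Qed.

Lemma cintegrable_mul_unimodular f g : cmeas g -> (forall x, normc (g x) = 1) ->
  cintegrable mu f -> cintegrable mu (fun x => f x * g x).
Proof.
move=> mg g1 fi; apply: le_cintegrable (fi); first by apply: cmeasM => //; exact: fi.1.
by move=> x; rewrite Normc.normcM g1 mulr1.
Qed.

Lemma cintegrable_kernel e f x : unimodular e -> cintegrable mu f ->
  cintegrable mu (fun y => f y * e x y).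
Proof.
move=> ue; apply: cintegrable_mul_unimodular; first exact: cmeas_kernel_row.
exact: ue.2.
Qed.

Lemma cmeas_ktransform e f : unimodular e -> cmeas f -> cmeas (ktransform e f).
Proof.
move=> [me _] mf; apply: (cmeas_cint mu (F := fun p : T * T => f p.2 * e p.1 p.2)).
by apply: cmeasM => //; exact: (cmeas_comp mf).
Qed.

Lemma normc_ktransform_le e f x : unimodular e -> cintegrable mu f ->
  ((normc (ktransform e f x))%:E <= norm1 mu f)%E.
Proof.
move=> ue fi; apply: le_trans (normc_cint_le (cintegrable_kernel x ue fi)) _.
rewrite le_eqVlt; apply/orP; left; apply/eqP; apply: eq_integral => y _.
by rewrite Normc.normcM ue.2 mulr1.
Qed.

Lemma ktransformD e f g x : unimodular e -> cintegrable mu f -> cintegrable mu g ->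
  ktransform e (fun y => f y + g y) x = ktransform e f x + ktransform e g x.
Proof.
move=> ue fi gi; rewrite -cintD; try exact: cintegrable_kernel.
by apply: eq_cint => y; rewrite mulrDl.
Qed.

Lemma ktransformZ e c f x : unimodular e -> cintegrable mu f ->
  ktransform e (fun y => c * f y) x = c * ktransform e f x.
Proof.
move=> ue fi; rewrite -cintZ; last exact: cintegrable_kernel.
by apply: eq_cint => y; rewrite mulrA.
Qed.

End kernel_transform.

Section plancherel_line.
Context {R : realType}.
Local Notation mu := (@lebesgue_measure R).
Local Notation line := (measurableTypeR R).

Definition expker (x y : line) : R[i] := expi (- (x * y)).

Lemma unimodular_expker : unimodular expker.
Proof.
split=> [|x y]; last exact: normc_expi.
by apply: cmeas_expi; apply: measurableT_comp => //; exact: measurable_funM.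
Qed.

Variable f : line -> R[i].
Hypotheses (fi : cintegrable mu f) (f2 : sq_cintegrable mu f).
Let F := ktransform mu expker f.
Let N2 := fine (sqnorm2 mu f).
Let N2E : sqnorm2 mu f = N2%:E.
Proof. by rewrite fineK//; exact: sqnorm2_fin_num. Qed.

Let N2_ge0 : 0 <= N2.
Proof. by rewrite fine_ge0// sqnorm2_ge0. Qed.

(* the squared modulus of continuity of [f] under translation *)
Let D s := sqnorm2 mu (fun y => f y - f (y - s)).

Let cmeas_shift s : cmeas (fun y : line => f (y - s)).
Proof.
apply: (cmeas_comp fi.1 (h := fun y : line => (y - s : line))).
by apply: measurable_funB => //; exact: measurable_cst.
Qed.

Let D_le s : (D s <= (4 * N2)%:E)%E.
Proof.
have -> : (4 * N2)%:E = (2%:E * (sqnorm2 mu f + sqnorm2 mu f))%E.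
  by rewrite N2E -EFinD -EFinM; congr EFin; ring.
have {2}-> : sqnorm2 mu f = sqnorm2 mu (fun y => - f (y - s)).
  rewrite /sqnorm2 (ge0_integral_subr s (phi := fun y => (normc (f y) ^+ 2)%:E)).
  - by apply: eq_integral => y _; rewrite normc_opp.
  - exact/measurable_EFinP/measurable_sqr_normc/fi.1.
  - by move=> y; rewrite lee_fin sqr_ge0.
apply: sqnorm2D_le; first exact: fi.1.
rewrite (_ : (fun y => _) = (fun y => (-1) * f (y - s))).
  by apply: cmeasM; [exact: cmeas_cst|exact: cmeas_shift].
by apply/funext => y; rewrite mulN1r.
Qed.

Let D_ge0 s : (0 <= D s)%E. Proof. exact: sqnorm2_ge0. Qed.

Let cmeas_diff : cmeas (fun p : line * line => f p.1 - f (p.1 - p.2)).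
Proof.
apply: cmeasB; first exact: (cmeas_comp fi.1).
apply: (cmeas_comp fi.1 (h := fun p : line * line => (p.1 - p.2 : line))).
exact: measurable_funB.
Qed.

Let measurable_D : measurable_fun setT D.
Proof.
apply: (measurable_fun_fubini_tonelli_G
  (fun p : line * line => (normc (f p.1 - f (p.1 - p.2)) ^+ 2)%:E)).
  by apply/measurable_EFinP; exact: measurable_sqr_normc.
by move=> p; rewrite lee_fin sqr_ge0.
Qed.

Section fixed_eps.
Variable eps : R.
Hypothesis eps0 : 0 < eps.
Local Notation P := (poisson eps).
Local Notation mu2 := (prod_measure mu mu).

Let measurable_P2 : measurable_fun setT (fun p : line * line => P (p.1 - p.2)).
Proof.
apply: (@measurableT_comp _ _ _ _ _ _ (poisson eps)); first exact: measurable_poisson.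
exact: measurable_funB.
Qed.

Let H1 (p : line * line) := normc (f p.1) ^+ 2 * P (p.1 - p.2).
Let H2 (p : line * line) := normc (f p.2) ^+ 2 * P (p.1 - p.2).
Let H3 (p : line * line) := normc (f p.1 - f p.2) ^+ 2 * P (p.1 - p.2).

Let integral_H1 : (\int[mu2]_p (H1 p)%:E = (2 * pi * N2)%:E)%E.
Proof.
rewrite fubini_tonelli1; last 2 first.
- apply/measurable_EFinP; apply: measurable_funM => //.
  by apply: measurable_sqr_normc; exact: (cmeas_comp fi.1).
- by move=> p; rewrite lee_fin mulr_ge0 ?sqr_ge0 ?poisson_ge0.
rewrite /fubini_F /H1 /=.
transitivity (\int[mu]_x ((normc (f x) ^+ 2)%:E * (2 * pi)%:E))%E.
  apply: eq_integral => x _; under eq_integral do rewrite EFinM.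
  rewrite ge0_integralZl//=; last 3 first.
  - apply/measurable_EFinP; apply: measurableT_comp; first exact: measurable_poisson.
    by apply: measurable_funB => //; exact: measurable_cst.
  - by move=> y _; rewrite lee_fin poisson_ge0.
  - by rewrite lee_fin sqr_ge0.
  congr (_ * _)%E; rewrite -(integral_poisson eps0) (ge0_integral_subl x)//.
  - by move/measurable_EFinP: (measurable_poisson eps0).
  - by move=> y; rewrite lee_fin poisson_ge0.
rewrite ge0_integralZr//; last 3 first.
- exact/measurable_EFinP/measurable_sqr_normc/fi.1.
- by move=> x _; rewrite lee_fin sqr_ge0.
- by rewrite lee_fin mulr_ge0// pi_ge0.
by rewrite -/(sqnorm2 mu f) N2E -EFinM mulrC.
Qed.

Let integral_H2 : (\int[mu2]_p (H2 p)%:E = (2 * pi * N2)%:E)%E.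
Proof.
rewrite fubini_tonelli2; last 2 first.
- apply/measurable_EFinP; apply: measurable_funM => //.
  by apply: measurable_sqr_normc; exact: (cmeas_comp fi.1).
- by move=> p; rewrite lee_fin mulr_ge0 ?sqr_ge0 ?poisson_ge0.
rewrite /fubini_G /H2 /=.
transitivity (\int[mu]_y ((normc (f y) ^+ 2)%:E * (2 * pi)%:E))%E.
  apply: eq_integral => y _; under eq_integral do rewrite EFinM.
  rewrite ge0_integralZl//=; last 3 first.
  - apply/measurable_EFinP; apply: measurableT_comp; first exact: measurable_poisson.
    by apply: measurable_funB => //; exact: measurable_cst.
  - by move=> x _; rewrite lee_fin poisson_ge0.
  - by rewrite lee_fin sqr_ge0.
  congr (_ * _)%E; rewrite -(integral_poisson eps0) (ge0_integral_subr y)//.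
  - by move/measurable_EFinP: (measurable_poisson eps0).
  - by move=> x; rewrite lee_fin poisson_ge0.
rewrite ge0_integralZr//; last 3 first.
- exact/measurable_EFinP/measurable_sqr_normc/fi.1.
- by move=> x _; rewrite lee_fin sqr_ge0.
- by rewrite lee_fin mulr_ge0// pi_ge0.
by rewrite -/(sqnorm2 mu f) N2E -EFinM mulrC.
Qed.

Let measurable_H3 : measurable_fun setT H3.
Proof.
apply: measurable_funM => //; apply: measurable_sqr_normc.
by apply: cmeasB; exact: (cmeas_comp fi.1).
Qed.

(** Substituting first the difference of the two variables, then rescaling it
    by [eps], replaces the varying Poisson kernel by a fixed one. *)
Let integral_H3 : (\int[mu2]_p (H3 p)%:E =
  \int[mu]_s (fine (D (eps * s)) * poisson 1 s)%:E)%E.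
Proof.
have Dfin s : D s = (fine (D s))%:E.
  by rewrite fineK// ge0_fin_numE// (le_lt_trans (D_le s))// ltry.
pose K (p : line * line) := (normc (f p.1 - f (p.1 - p.2)) ^+ 2 * P p.2)%:E.
have mK : measurable_fun setT K.
  apply/measurable_EFinP; apply: measurable_funM.
    exact: measurable_sqr_normc.
  by apply: measurableT_comp => //; exact: measurable_poisson.
have K0 p : (0 <= K p)%E by rewrite lee_fin mulr_ge0 ?sqr_ge0 ?poisson_ge0.
transitivity (\int[mu]_x \int[mu]_s K (x, s))%E.
  rewrite [LHS]fubini_tonelli1; last 2 first.
  - exact/measurable_EFinP.
  - by move=> p; rewrite lee_fin mulr_ge0 ?sqr_ge0 ?poisson_ge0.
  apply: eq_integral => x _; rewrite /fubini_F.
  rewrite (ge0_integral_subl x (phi := fun y => (H3 (x, y))%:E)).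
  - by apply: eq_integral => s _; rewrite /K /H3/= subKr.
  - move/measurable_EFinP : measurable_H3 => mH.
    exact: (measurableT_comp mH (measurable_pair1 x)).
  - by move=> y; rewrite lee_fin mulr_ge0 ?sqr_ge0 ?poisson_ge0.
rewrite fubini_tonelli//.
transitivity (\int[mu]_s (D s * (P s)%:E))%E.
  apply: eq_integral => s _; rewrite /K/=; under eq_integral do rewrite EFinM.
  rewrite ge0_integralZr//.
  - apply/measurable_EFinP/measurable_sqr_normc/cmeasB; first exact: fi.1.
    exact: cmeas_shift.
  - by move=> x _; rewrite lee_fin sqr_ge0.
  - by rewrite lee_fin poisson_ge0.
rewrite (ge0_integral_affine 0 eps0); last 2 first.
- apply: emeasurable_funM => //.
  by move/measurable_EFinP: (measurable_poisson eps0).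
- by move=> s; rewrite mule_ge0// lee_fin poisson_ge0.
rewrite -ge0_integralZl//; last 3 first.
- apply: emeasurable_funM.
    apply: measurableT_comp => //.
    by apply: measurable_funD => //; exact: mulrl_measurable.
  apply/measurable_EFinP; apply: measurableT_comp; first exact: measurable_poisson.
  by apply: measurable_funD => //; exact: mulrl_measurable.
- by move=> s _; rewrite mule_ge0// lee_fin poisson_ge0.
- by rewrite lee_fin ltW.
apply: eq_integral => s _; rewrite addr0 Dfin -!EFinM.
by rewrite mulrCA poisson_scale.
Qed.

Let integral_H3_le : (\int[mu2]_p (H3 p)%:E < +oo)%E.
Proof.
rewrite integral_H3; apply: (@le_lt_trans _ _ (\int[mu]_s ((4 * N2)%:E * (poisson 1 s)%:E))%E).
  have mD1 : measurable_fun setT (fun s : line => D (eps * s)).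
    by apply: measurableT_comp => //; exact: mulrl_measurable.
  have mp1 := measurable_poisson (@ltr01 R).
  apply: ge0_le_integral => //.
  - by move=> s _; rewrite lee_fin mulr_ge0 ?fine_ge0 ?poisson_ge0.
  - apply/measurable_EFinP; apply: measurable_funM => //.
    by apply: measurableT_comp mD1.
  - by apply: measurable_funeM; move/measurable_EFinP: mp1.
  - move=> s _; rewrite -EFinM lee_fin ler_wpM2r ?poisson_ge0//.
    by rewrite -lee_fin fineK ?D_le// ge0_fin_numE// (le_lt_trans (D_le _))// ltry.
rewrite ge0_integralZl//.
- by rewrite integral_poisson// -EFinM ltry.
- by move/measurable_EFinP: (measurable_poisson (@ltr01 R)).
- by move=> s _; rewrite lee_fin poisson_ge0.
- by rewrite lee_fin mulr_ge0.
Qed.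

(** The Fourier side: inserting the Abel weight makes all integrals absolutely
    convergent, so that Fubini's theorem applies. *)
Let weighted_fourier :
  cint mu (fun x => (abel eps x)%:C * (F x * (F x)^*)) =
  cint mu2 (fun p => f p.1 * (f p.2)^* * (P (p.1 - p.2))%:C).
Proof.
pose G (q : line * (line * line)) := (abel eps q.1)%:C *
  ((f q.2.1 * expker q.1 q.2.1) * (f q.2.2 * expker q.1 q.2.2)^*).
have iabel : cintegrable mu (fun x : line => (abel eps x)%:C).
  apply: cintegrableP; first exact: rintegrable_abel.
  by rewrite (_ : _ \o _ = cst 0%E)//; exact: integrable0.
have iff : cintegrable mu2 (fun p : line * line => f p.1 * (f p.2)^*).
  by apply: (cintegrable_prod fi (cintegrableJ fi)).
have [mker ker1] := unimodular_expker.
have Gi : cintegrable (prod_measure mu mu2) G.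
  apply: (le_cintegrable _ _ (cintegrable_prod iabel iff)).
    apply: cmeasM; first exact: (cmeas_comp iabel.1).
    apply: cmeasM.
      apply: cmeasM.
        apply: (cmeas_comp fi.1 (h := fun q : line * (line * line) => q.2.1)).
        by apply: measurableT_comp.
      apply: (cmeas_comp mker (h := fun q : line * (line * line) => (q.1, q.2.1))).
      by apply: measurable_fun_pair => //; apply: measurableT_comp.
    apply: cmeasJ; apply: cmeasM.
      apply: (cmeas_comp fi.1 (h := fun q : line * (line * line) => q.2.2)).
      by apply: measurableT_comp.
    apply: (cmeas_comp mker (h := fun q : line * (line * line) => (q.1, q.2.2))).
    by apply: measurable_fun_pair => //; apply: measurableT_comp.
  by move=> q; rewrite /G !Normc.normcM !normc_conj !Normc.normcM !ker1 !mulr1.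
have := cint_prod1 Gi; rewrite -cint_prod2//.
have innerE x : cint mu2 (fun p => G (x, p)) = (abel eps x)%:C * (F x * (F x)^*).
  have Ki := cintegrable_kernel x unimodular_expker fi; have KJi := cintegrableJ Ki.
  rewrite (_ : (fun p => G (x, p)) = (fun p => (abel eps x)%:C *
    ((f p.1 * expker x p.1) * (f p.2 * expker x p.2)^*)))//.
  by rewrite cintZ ?(cint_prod_mul Ki KJi) ?(cintJ Ki)//; exact: cintegrable_prod Ki KJi.
under [LHS]eq_cint do rewrite innerE.
move=> H; apply: etrans H _; apply: eq_cint => p.
rewrite -(cint_abel_expi (p.1 - p.2) eps0) -cintZ; last first.
  apply: cintegrable_mul_unimodular iabel; last by move=> x; exact: normc_expi.
  apply: cmeas_expi; apply: measurableT_comp => //; exact: mulrr_measurable.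
apply: eq_cint => x; rewrite /G conjc_mul.
have -> : expi (- (x * (p.1 - p.2))) = expker x p.1 * (expker x p.2)^*.
  by rewrite /expker -expiN -expiD; congr expi; ring.
move: ((abel eps x)%:C) (f p.1) (expker x p.1) ((f p.2)^*) ((expker x p.2)^*).
by move=> a b c d e; ring.
Qed.

(** The law of cosines replaces the cross term by [|f(y) - f(z)|^2], which is small
    near the diagonal, where the Poisson kernel concentrates. *)
Lemma weighted_sqnorm : (\int[mu]_x (abel eps x * normc (F x) ^+ 2)%:E =
  (2 * pi * N2)%:E - (2^-1)%:E *
  \int[mu]_s (fine (D (eps * s)) * poisson 1 s)%:E)%E.
Proof.
have mf1 : measurable_fun setT (fun p : line * line => normc (f p.1) ^+ 2).
  by apply: measurable_sqr_normc; exact: (cmeas_comp fi.1).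
have mf2 : measurable_fun setT (fun p : line * line => normc (f p.2) ^+ 2).
  by apply: measurable_sqr_normc; exact: (cmeas_comp fi.1).
have H1i : mu2.-integrable setT (EFin \o H1).
  apply: ge0_rintegrable; first exact: measurable_funM.
    by move=> p; rewrite mulr_ge0 ?sqr_ge0 ?poisson_ge0.
  by rewrite integral_H1 ltry.
have H2i : mu2.-integrable setT (EFin \o H2).
  apply: ge0_rintegrable; first exact: measurable_funM.
    by move=> p; rewrite mulr_ge0 ?sqr_ge0 ?poisson_ge0.
  by rewrite integral_H2 ltry.
have H3i : mu2.-integrable setT (EFin \o H3).
  apply: ge0_rintegrable => //.
  by move=> p; rewrite mulr_ge0 ?sqr_ge0 ?poisson_ge0.
have wi : mu.-integrable setT (EFin \o (fun x => abel eps x * normc (F x) ^+ 2)).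
  have [L L0 Lf] : exists2 L : R, 0 <= L & norm1 mu f = L%:E.
    exists (fine (norm1 mu f)); first by rewrite fine_ge0// norm1_ge0.
    by rewrite fineK// ge0_fin_numE ?fi.2// norm1_ge0.
  apply: (le_integrable _ _ _ (rintegrableZl (L ^+ 2) (rintegrable_abel eps0))) => //.
    apply/measurable_EFinP; apply: measurable_funM; first exact: measurable_abel.
    apply: measurable_sqr_normc.
    by apply: cmeas_ktransform fi.1; exact: unimodular_expker.
  move=> x _; rewrite lee_fin /= !ger0_norm ?mulr_ge0 ?expR_ge0 ?sqr_ge0//.
  rewrite mulrC ler_wpM2r ?expR_ge0// ler_sqr_norm// ger0_norm ?normc_ge0//.
  by rewrite -lee_fin -Lf; apply: normc_ktransform_le fi; exact: unimodular_expker.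
rewrite -integral_H3.
transitivity (Rintegral mu setT (fun x => abel eps x * normc (F x) ^+ 2))%:E.
  by rewrite fineK//; exact: integrable_fin_num.
have -> : Rintegral mu setT (fun x => abel eps x * normc (F x) ^+ 2) =
    Re (cint mu (fun x => (abel eps x)%:C * (F x * (F x)^*))).
  transitivity (Rintegral mu setT (fun x => Re ((abel eps x)%:C * (F x * (F x)^*)))) => //.
  by apply: eq_Rintegral => x _; rewrite mulc_conj Re_mulc [Im _]/= mul0r subr0.
rewrite weighted_fourier /=.
have -> : Rintegral mu2 setT (fun p => Re (f p.1 * (f p.2)^* * (P (p.1 - p.2))%:C)) =
    Rintegral mu2 setT (fun p => 2^-1 * (H1 p + H2 p - H3 p)).
  apply: eq_Rintegral => p _; rewrite Re_mulc/= mulr0 subr0 /H1 /H2 /H3 sqr_normcB.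
  by field.
rewrite RintegralZl//=; last by apply: rintegrableB => //; exact: rintegrableD.
rewrite RintegralB//=; last exact: rintegrableD.
rewrite RintegralD// /Rintegral integral_H1 integral_H2 /=.
rewrite -[X in (_ - _ * X)%E]fineK; last exact: integrable_fin_num H3i.
rewrite -EFinM -EFinB; congr EFin; rewrite /=.
by field.
Qed.

End fixed_eps.
Let eps_ (k : nat) : R := k.+1%:R^-1.

Let eps_gt0 k : 0 < eps_ k. Proof. by rewrite invr_gt0. Qed.

Let eps_cvg0 : eps_ @ \oo --> 0. Proof. exact: cvg_harmonic. Qed.

Let shift_term_cvg0 :
  (fun k => \int[mu]_s (fine (D (eps_ k * s)) * poisson 1 s)%:E)%E @ \oo --> 0%E.
Proof.
have mp1 := measurable_poisson (@ltr01 R).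
apply: (@dominated_cvg0 _ _ _ mu (fun k s => fine (D (eps_ k * s)) * poisson 1 s)
  (fun s => 4 * N2 * poisson 1 s)).
- move=> k; apply: measurable_funM => //.
  apply: (@measurableT_comp _ _ _ _ _ _ fine) => //.
  by apply: measurableT_comp => //; exact: mulrl_measurable.
- move=> k s; rewrite mulr_ge0 ?fine_ge0 ?poisson_ge0//= ler_wpM2r ?poisson_ge0//.
  by rewrite -lee_fin fineK ?D_le// ge0_fin_numE// (le_lt_trans (D_le _))// ltry.
- apply: rintegrableZl; apply: ge0_rintegrable => //.
    by move=> s; exact: poisson_ge0.
  by rewrite integral_poisson// ltry.
- apply: aeW => s; rewrite -[X in _ --> X](mul0r (poisson 1 s)).
  apply: cvgM; last exact: cvg_cst.
  apply: fine_cvg; apply: shift_sqnorm2_cvg0 => //.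
  rewrite -[X in _ --> X](mul0r s); apply: cvgM => //; exact: cvg_cst.
Qed.

Let measurable_F : measurable_fun setT (fun x => normc (F x) ^+ 2).
Proof.
by apply: measurable_sqr_normc; apply: cmeas_ktransform fi.1; exact: unimodular_expker.
Qed.

Let weighted_cvg :
  (fun k => \int[mu]_x (abel (eps_ k) x * normc (F x) ^+ 2)%:E)%E @ \oo -->
  sqnorm2 mu F.
Proof.
have H x : (fun k => (abel (eps_ k) x * normc (F x) ^+ 2)%:E) @ \oo -->
    (normc (F x) ^+ 2)%:E.
  apply: cvg_EFin; first exact: nearW.
  rewrite -[X in _ --> X]mul1r; apply: cvgM; last exact: cvg_cst.
  rewrite -[X in _ --> X](_ : expR (- (0 * `|x|)) = 1); last by rewrite mul0r oppr0 expR0.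
  apply: (@cvg_comp _ _ _ (fun k => - (eps_ k * `|x|)) expR); last exact: continuous_expR.
  by apply: cvgN; apply: cvgM => //; exact: cvg_cst.
rewrite (_ : sqnorm2 mu F = \int[mu]_x limn (fun k => (abel (eps_ k) x * normc (F x) ^+ 2)%:E))%E.
  apply: cvg_monotone_convergence => //.
  - move=> k; apply/measurable_EFinP; apply: measurable_funM => //.
    exact: measurable_abel.
  - by move=> k x _; rewrite lee_fin mulr_ge0 ?expR_ge0 ?sqr_ge0.
  - move=> x _ a b ab; rewrite lee_fin ler_wpM2r ?sqr_ge0// /abel ler_expR lerN2.
    by rewrite ler_wpM2r// lef_pV2 ?posrE// ler_nat.
by apply: eq_integral => x _; apply/esym/cvg_lim.
Qed.

(** As the weight increases to 1, monotone convergence gives the left-hand side,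
    and continuity of translations removes the error term. *)
Lemma plancherel_line_fun : sqnorm2 mu F = ((2 * pi)%:E * sqnorm2 mu f)%E.
Proof.
have lim : (fun k => \int[mu]_x (abel (eps_ k) x * normc (F x) ^+ 2)%:E)%E @ \oo -->
    (2 * pi * N2)%:E.
  under eq_fun do rewrite weighted_sqnorm//.
  have : ((2 * pi * N2)%:E - (2^-1)%:E *
      \int[mu]_s (fine (D (eps_ k * s)) * poisson 1 s)%:E)%E @[k --> \oo] -->
      ((2 * pi * N2)%:E - (2^-1)%:E * 0)%E.
    by apply: cvgeB => //; [exact: cvg_cst|apply: cvgeZl => //; exact: shift_term_cvg0].
  by rewrite mule0 sube0.
by rewrite N2E -EFinM; apply: (cvg_unique _ weighted_cvg lim).
Qed.

End plancherel_line.

Lemma plancherel_line (R : realType) :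
  plancherel_for (@lebesgue_measure R) (@expker R) (2 * pi).
Proof. by move=> f fi f2; exact: plancherel_line_fun. Qed.

(** * Plancherel's identity on products and on R^n *)

Section plancherel_product.
Context d1 d2 (T1 : measurableType d1) (T2 : measurableType d2) (R : realType).
Variables (m1 : {sigma_finite_measure set T1 -> \bar R})
          (m2 : {sigma_finite_measure set T2 -> \bar R}).
Variables (e1 : T1 -> T1 -> R[i]) (e2 : T2 -> T2 -> R[i]).
Hypotheses (ue1 : unimodular e1) (ue2 : unimodular e2).
Local Notation m12 := (prod_measure m1 m2).

Definition prodker (x y : T1 * T2) := e1 x.1 y.1 * e2 x.2 y.2.

Lemma unimodular_prodker : unimodular prodker.
Proof.
split=> [|x y]; last by rewrite Normc.normcM ue1.2 ue2.2 mulr1.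
apply: cmeasM.
  apply: (cmeas_comp ue1.1 (h := fun p : (T1 * T2) * (T1 * T2) => (p.1.1, p.2.1))).
  by apply: measurable_fun_pair; apply: measurableT_comp.
apply: (cmeas_comp ue2.1 (h := fun p : (T1 * T2) * (T1 * T2) => (p.1.2, p.2.2))).
by apply: measurable_fun_pair; apply: measurableT_comp.
Qed.

Variables (c1 c2 : R).
Hypotheses (c1_ge0 : 0 <= c1) (c2_ge0 : 0 <= c2).
Hypotheses (P1 : plancherel_for m1 e1 c1) (P2 : plancherel_for m2 e2 c2).

(* Every section [f (., y2)] is assumed to be in [L^1 /\ L^2], so that the identity
   for [m1] applies to all of them; for a general [f] almost all sections are,
   and [f] is modified on a null set. *)
Section good_sections.
Variable f : T1 * T2 -> R[i].
Hypotheses (fi : cintegrable m12 f) (f2 : sq_cintegrable m12 f).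
Hypothesis fs : forall y2, cintegrable m1 (fun y1 => f (y1, y2)).
Hypothesis fs2 : forall y2, sq_cintegrable m1 (fun y1 => f (y1, y2)).

(* the transform of [f] in the first variable only *)
Let g x1 y2 := ktransform m1 e1 (fun y1 => f (y1, y2)) x1.

Let cmeas_g : cmeas (fun p : T1 * T2 => g p.1 p.2).
Proof.
apply: (cmeas_cint m1 (F := fun q : (T1 * T2) * T1 => f (q.2, q.1.2) * e1 q.1.1 q.2)).
apply: cmeasM.
  apply: (cmeas_comp fi.1 (h := fun q : (T1 * T2) * T1 => (q.2, q.1.2))).
  by apply: measurable_fun_pair => //; apply: measurableT_comp.
apply: (cmeas_comp ue1.1 (h := fun q : (T1 * T2) * T1 => (q.1.1, q.2))).
by apply: measurable_fun_pair => //; apply: measurableT_comp.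
Qed.

Let cmeas_gx x1 : cmeas (g x1).
Proof. by apply: (cmeas_comp cmeas_g (h := pair x1)). Qed.

Let cintegrable_g x1 : cintegrable m2 (g x1).
Proof.
split=> //; have := fi.2; apply: le_lt_trans; rewrite norm1_prod2; last exact: fi.1.
apply: ge0_le_integral => //.
- by move=> y _; rewrite lee_fin normc_ge0.
- exact/measurable_EFinP/measurable_normc.
- apply: (measurable_fun_fubini_tonelli_G (fun p => (normc (f p))%:E)).
    exact/measurable_EFinP/measurable_normc/fi.1.
  by move=> p; rewrite lee_fin normc_ge0.
- by move=> y _; exact: normc_ktransform_le.
Qed.

Let ktransform_prodker x : ktransform m12 prodker f x = ktransform m2 e2 (g x.1) x.2.
Proof.
rewrite /ktransform -cint_prod2; last exact: cintegrable_kernel unimodular_prodker fi.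
apply: eq_cint => y2; rewrite /g /ktransform mulrC -cintZ; last exact: cintegrable_kernel.
by apply: eq_cint => y1; rewrite /prodker/=; ring.
Qed.

Let sqnorm2_g : sqnorm2 m12 (fun p => g p.1 p.2) = (c1%:E * sqnorm2 m12 f)%E.
Proof.
rewrite !sqnorm2_prod2//; last exact: fi.1.
rewrite -ge0_integralZl//; last 2 first.
- apply: (measurable_fun_fubini_tonelli_G (fun p => (normc (f p) ^+ 2)%:E)).
    exact/measurable_EFinP/measurable_sqr_normc/fi.1.
  by move=> p; rewrite lee_fin sqr_ge0.
- by move=> y _; exact: sqnorm2_ge0.
by apply: eq_integral => y _; rewrite -(P1 (fs y) (fs2 y)).
Qed.

(** Transform one variable at a time. *)
Lemma plancherel_good_sections :
  sqnorm2 m12 (ktransform m12 prodker f) = ((c1 * c2)%:E * sqnorm2 m12 f)%E.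
Proof.
rewrite mulrC EFinM -muleA -sqnorm2_g !sqnorm2_prod1//; last first.
  exact: cmeas_ktransform unimodular_prodker fi.1.
have mg : measurable_fun setT (fun x1 => sqnorm2 m2 (g x1)).
  apply: (measurable_fun_fubini_tonelli_F (fun p => (normc (g p.1 p.2) ^+ 2)%:E)).
    by apply/measurable_EFinP; exact: (measurable_sqr_normc cmeas_g).
  by move=> p; rewrite lee_fin sqr_ge0.
rewrite -ge0_integralZl//; last by move=> x _; exact: sqnorm2_ge0.
apply: ae_eq_integral; first exact: measurableT.
- apply: (measurable_fun_fubini_tonelli_F
    (fun p => (normc (ktransform m12 prodker f p) ^+ 2)%:E)).
    apply/measurable_EFinP/measurable_sqr_normc.
    exact: cmeas_ktransform unimodular_prodker fi.1.
  by move=> p; rewrite lee_fin sqr_ge0.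
- exact: measurable_funeM.
have goo : (\int[m1]_x sqnorm2 m2 (g x) < +oo)%E.
  have := sqnorm2_g; rewrite sqnorm2_prod1// => ->.
  by rewrite lte_mul_pinfty//; exact: f2.2.
have : m1.-integrable setT (fun x => sqnorm2 m2 (g x)).
  apply/integrableP; split => //.
  by under eq_integral do rewrite gee0_abs ?sqnorm2_ge0//.
move=> /(integrable_ae measurableT); apply: filterS => x gx _.
have := gx I; rewrite ge0_fin_numE ?sqnorm2_ge0// => gxoo.
rewrite -(P2 (cintegrable_g x) (conj (cmeas_gx x) gxoo)).
by apply: eq_integral => y _; rewrite ktransform_prodker.
Qed.

End good_sections.

Lemma plancherel_prodker : plancherel_for m12 prodker (c1 * c2).
Proof.
move=> f fi f2.
(* the second coordinates whose section is not in [L^1 /\ L^2] *)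
pose N := [set y : T2 | norm1 m1 (fun x => f (x, y)) = +oo%E] `|`
  [set y | sqnorm2 m1 (fun x => f (x, y)) = +oo%E].
have mn1 : measurable_fun setT (fun y => norm1 m1 (fun x => f (x, y))).
  apply: (measurable_fun_fubini_tonelli_G (fun p => (normc (f p))%:E)).
    exact/measurable_EFinP/measurable_normc/fi.1.
  by move=> p; rewrite lee_fin normc_ge0.
have mn2 : measurable_fun setT (fun y => sqnorm2 m1 (fun x => f (x, y))).
  apply: (measurable_fun_fubini_tonelli_G (fun p => (normc (f p) ^+ 2)%:E)).
    exact/measurable_EFinP/measurable_sqr_normc/fi.1.
  by move=> p; rewrite lee_fin sqr_ge0.
have mN : measurable N.
  apply: measurableU; rewrite -[X in measurable X]setTI.
    exact: (mn1 measurableT [set +oo%E] (emeasurable_set1 _)).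
  exact: (mn2 measurableT [set +oo%E] (emeasurable_set1 _)).
have N0 : m2 N = 0%E.
  have h1 : {ae m2, forall y, norm1 m1 (fun x => f (x, y)) \is a fin_num}.
    have : m2.-integrable setT (fun y => norm1 m1 (fun x => f (x, y))).
      apply/integrableP; split => //.
      under eq_integral do rewrite gee0_abs ?norm1_ge0//.
      by rewrite -norm1_prod2; [exact: fi.2|exact: fi.1].
    by move=> /(integrable_ae measurableT); apply: filterS => y /(_ I).
  have h2 : {ae m2, forall y, sqnorm2 m1 (fun x => f (x, y)) \is a fin_num}.
    have : m2.-integrable setT (fun y => sqnorm2 m1 (fun x => f (x, y))).
      apply/integrableP; split => //.
      under eq_integral do rewrite gee0_abs ?sqnorm2_ge0//.
      by rewrite -sqnorm2_prod2; [exact: f2.2|exact: fi.1].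
    by move=> /(integrable_ae measurableT); apply: filterS => y /(_ I).
  apply/negligibleP => //.
  have : {ae m2, forall y, ~ N y}.
    by apply: filterS2 h1 h2 => y a b [E|E]; [move: a|move: b]; rewrite /= E.
  by apply: negligibleS => y Ny /=; exact.
pose chi (p : T1 * T2) : R[i] := (\1_(~` N) p.2)%:C.
have mchi : cmeas chi.
  apply: (cmeas_comp (f := fun y => (\1_(~` N) y)%:C) (h := snd)) => //.
  by apply: cmeas_real; apply: measurable_indic; exact: measurableC.
pose f' p := chi p * f p.
have mf' : cmeas f' by apply: cmeasM => //; exact: fi.1.
have f'f : ae_eq m12 setT f' f.
  exists (setT `*` N); split; first exact: measurableX.
    by rewrite /= /prod_measure product_measure1E// N0 mule0.
  move=> [x y] /= h; split => //; apply: contra_notP h => Ny _.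
  by rewrite /f' /chi indicE mem_set//= mul1r.
have f'i : cintegrable m12 f' by split=> //; rewrite (ae_eq_norm1 mf' fi.1 f'f) fi.2.
have f'2 : sq_cintegrable m12 f' by split=> //; rewrite (ae_eq_sqnorm2 mf' fi.1 f'f) f2.2.
have mfy y : cmeas (fun x => f (x, y)).
  by apply: (cmeas_comp fi.1 (h := fun x => (x, y))).
have f's y : cintegrable m1 (fun x => f' (x, y)) /\ sq_cintegrable m1 (fun x => f' (x, y)).
  have [Ny|Ny] := pselect (N y).
    have -> : (fun x => f' (x, y)) = (fun=> 0).
      by apply/funext => x; rewrite /f' /chi indicE memNset/= ?mul0r//; exact.
    split; split; try exact: cmeas_cst.
      by rewrite /norm1; under eq_integral do rewrite Normc.normc0; rewrite integral0.
    by rewrite /sqnorm2; under eq_integral do rewrite Normc.normc0 expr0n/=; rewrite integral0.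
  have -> : (fun x => f' (x, y)) = (fun x => f (x, y)).
    by apply/funext => x; rewrite /f' /chi indicE mem_set//= mul1r.
  split; split => //; rewrite ltey; apply/eqP => E; apply: Ny; [by left|by right].
rewrite -(ae_eq_sqnorm2 mf' fi.1 f'f).
rewrite -(plancherel_good_sections f'i f'2 (fun y => (f's y).1) (fun y => (f's y).2)).
apply: eq_integral => x _; congr ((normc _ ^+ 2)%:E).
apply: ae_eq_cint.
- exact: (cintegrable_kernel x unimodular_prodker fi).1.
- exact: (cintegrable_kernel x unimodular_prodker f'i).1.
- by apply: filterS f'f => y /= h _; rewrite h.
Qed.

End plancherel_product.

Section transport.
Context d1 d2 (T1 : measurableType d1) (T2 : measurableType d2) (R : realType).
Variables (m1 : {sigma_finite_measure set T1 -> \bar R})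
          (m2 : {sigma_finite_measure set T2 -> \bar R}).
(* The step from a product to [R^(n+1)], whose measure is an image by consing. *)
Variables (phi : T1 -> T2) (mphi : measurable_fun setT phi).
Hypothesis m2E : forall A, measurable A -> m2 A = pushforward m1 phi A.

Let ge0_integral_transport (f : T2 -> \bar R) : measurable_fun setT f ->
  (forall y, (0 <= f y)%E) -> (\int[m2]_y f y = \int[m1]_x f (phi x))%E.
Proof.
move=> mf f0; rewrite (eq_measure_integral
  (measure_function_pushforward__canonical__measure_function_Measure m1 mphi)).
  by rewrite (ge0_integral_pushforward mphi).
by move=> A mA _; exact: m2E.
Qed.

Lemma norm1_transport f : cmeas f -> norm1 m2 f = norm1 m1 (fun x => f (phi x)).
Proof.
move=> mf; apply: ge0_integral_transport; first exact/measurable_EFinP/measurable_normc.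
by move=> y; rewrite lee_fin normc_ge0.
Qed.

Lemma sqnorm2_transport f : cmeas f -> sqnorm2 m2 f = sqnorm2 m1 (fun x => f (phi x)).
Proof.
move=> mf; apply: ge0_integral_transport; first exact/measurable_EFinP/measurable_sqr_normc.
by move=> y; rewrite lee_fin sqr_ge0.
Qed.

Lemma cintegrable_transport f : cintegrable m2 f -> cintegrable m1 (fun x => f (phi x)).
Proof.
move=> [mf foo]; split; first exact: cmeas_comp mphi.
by rewrite -norm1_transport.
Qed.

Lemma sq_cintegrable_transport f :
  sq_cintegrable m2 f -> sq_cintegrable m1 (fun x => f (phi x)).
Proof.
move=> [mf foo]; split; first exact: cmeas_comp mphi.
by rewrite -sqnorm2_transport.
Qed.

Lemma cint_transport f : cintegrable m2 f -> cint m2 f = cint m1 (fun x => f (phi x)).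
Proof.
move=> fi; have fi1 := cintegrable_transport fi.
have H (h : T2 -> R) : measurable_fun setT h ->
    m1.-integrable setT (EFin \o (fun x => h (phi x))) ->
    Rintegral m2 setT h = Rintegral m1 setT (fun x => h (phi x)).
  move=> mh hi; congr fine; rewrite (eq_measure_integral
    (measure_function_pushforward__canonical__measure_function_Measure m1 mphi)).
    by rewrite (integral_pushforward mphi)//; exact/measurable_EFinP.
  by move=> A mA _; exact: m2E.
apply: complex_eqP => /=; apply: H.
- exact: fi.1.1.
- exact: cintegrable_Re.
- exact: fi.1.2.
- exact: cintegrable_Im.
Qed.

Lemma plancherel_transport (e1 : T1 -> T1 -> R[i]) (e2 : T2 -> T2 -> R[i]) c :
  unimodular e2 -> (forall x y, e2 (phi x) (phi y) = e1 x y) ->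
  plancherel_for m1 e1 c -> plancherel_for m2 e2 c.
Proof.
move=> ue2 e21 P1 f fi f2.
rewrite sqnorm2_transport; last exact: cmeas_ktransform fi.1.
rewrite sqnorm2_transport; last exact: fi.1.
rewrite -P1; [|exact: cintegrable_transport|exact: sq_cintegrable_transport].
congr sqnorm2; apply/funext => x.
rewrite /ktransform cint_transport; last exact: cintegrable_kernel.
by apply: eq_cint => y; rewrite e21.
Qed.

End transport.

Section plancherel_Rn.
Context {R : realType}.
Local Notation line := (measurableTypeR R).

Definition kerRn n (x y : Rn R n) : R[i] := expi (- dotRn x y).

Lemma dotRn0 (x y : Rn R 0) : dotRn x y = 0.
Proof. by rewrite /dotRn big_ord0. Qed.

Lemma dotRn_cons n (p q : line * Rn R n) :
  dotRn (cons_Rn p) (cons_Rn q) = p.1 * q.1 + dotRn p.2 q.2.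
Proof.
rewrite /dotRn big_ord_recl !tnth0; congr (_ + _).
by apply: eq_bigr => i _; rewrite !tnthS.
Qed.

Lemma measurable_dotRn n : measurable_fun setT
  (fun p : Rn R n * Rn R n => dotRn p.1 p.2).
Proof.
apply: measurable_sum => i; apply: measurable_funM.
  exact: (measurableT_comp (measurable_tnth i)).
exact: (measurableT_comp (measurable_tnth i)).
Qed.

Lemma measurable_sqnormRn n : measurable_fun setT (@sqnormRn R n).
Proof.
apply: measurable_sum => i.
by apply: measurable_funM; exact: measurable_tnth.
Qed.

Lemma unimodular_kerRn n : unimodular (@kerRn n).
Proof.
split=> [|x y]; last exact: normc_expi.
by apply: cmeas_expi; apply: measurableT_comp => //; exact: measurable_dotRn.
Qed.

Lemma lebesgue_Rn_cons n (A : set (Rn R n.+1)) :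
  lebesgue_Rn n.+1 A =
  pushforward (prod_measure (@lebesgue_measure R) (lebesgue_Rn n)) (@cons_Rn R n) A.
Proof. by []. Qed.

(** Plancherel's identity in dimension [n], by iteration of the line: the
    exponential kernel of a product space is the product of the kernels. *)
Lemma plancherel_Rn n : plancherel_for (lebesgue_Rn n) (@kerRn n) ((2 * pi) ^+ n).
Proof.
elim: n => [|n IHn].
  move=> f fi f2; rewrite expr0 mul1e; apply: eq_integral => x _.
  suff -> : ktransform (lebesgue_Rn 0) (@kerRn 0) f x = f x by [].
  rewrite /ktransform /kerRn; under eq_cint do rewrite dotRn0 oppr0.
  have e0 : expi 0 = 1 :> R[i] by rewrite /expi cos0 sin0.
  under eq_cint do rewrite e0 mulr1.
  have dirac0 (h : Rn R 0 -> R) : measurable_fun setT h ->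
      Rintegral (lebesgue_Rn 0) setT h = h x.
    move=> mh; rewrite /Rintegral /= integral_dirac//; last exact/measurable_EFinP.
    by rewrite diracT mul1e /= [x]tuple0.
  by apply: complex_eqP; [exact: dirac0 fi.1.1|exact: dirac0 fi.1.2].
apply: (@plancherel_transport _ _ _ _ _
  (prod_measure (@lebesgue_measure R) (lebesgue_Rn n)) (lebesgue_Rn n.+1)
  (@cons_Rn R n) (@measurable_cons_Rn R n) _ (prodker (@expker R) (@kerRn n))).
- by [].
- exact: unimodular_kerRn.
- by move=> p q; rewrite /kerRn dotRn_cons opprD expiD.
rewrite exprS; apply: plancherel_prodker => //.
- exact: unimodular_expker.
- exact: unimodular_kerRn.
- by rewrite mulr_ge0// pi_ge0.
- by rewrite exprn_ge0// mulr_ge0// pi_ge0.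
- exact: plancherel_line.
Qed.

End plancherel_Rn.

(** * Truncation, inversion and density of the range *)

Section truncation.
Context d (T : measurableType d) (R : realType).
Variable mu : {sigma_finite_measure set T -> \bar R}.
Implicit Types f : T -> R[i].

Definition trunc (D : set T) f x : R[i] := (\1_D x)%:C * f x.

Lemma truncE D f x : trunc D f x = if x \in D then f x else 0.
Proof. by rewrite /trunc indicE; case: ifPn => _; rewrite ?mul1r ?mul0r. Qed.

Lemma cmeas_trunc D f : measurable D -> cmeas f -> cmeas (trunc D f).
Proof.
by move=> mD mf; apply: cmeasM => //; apply: cmeas_real; exact: measurable_indic.
Qed.

Lemma normc_trunc D f x : normc (trunc D f x) = \1_D x * normc (f x).
Proof. by rewrite Normc.normcM normc_real ger0_norm. Qed.

Lemma normc_trunc_le D f x : normc (trunc D f x) <= normc (f x).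
Proof.
by rewrite normc_trunc indicE; case: (_ \in _); rewrite ?mul1r// mul0r normc_ge0.
Qed.

Lemma sq_cintegrable_trunc D f : measurable D ->
  sq_cintegrable mu f -> sq_cintegrable mu (trunc D f).
Proof.
move=> mD [mf foo]; have mt := cmeas_trunc mD mf; split => //.
by apply: le_lt_trans foo; apply: le_sqnorm2 => // x; exact: normc_trunc_le.
Qed.

Lemma integral_indic_lt (D : set T) : measurable D -> (mu D < +oo)%E ->
  (\int[mu]_x (\1_D x)%:E < +oo)%E.
Proof. by move=> mD Doo; rewrite integral_indic// setIT. Qed.

(** On a set of finite measure, |f| <= 1 + |f|^2. *)
Lemma cintegrable_trunc D f : measurable D -> (mu D < +oo)%E ->
  sq_cintegrable mu f -> cintegrable mu (trunc D f).
Proof.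
move=> mD Doo [mf foo]; split; first exact: cmeas_trunc.
apply: (@le_lt_trans _ _ (\int[mu]_x ((\1_D x)%:E + (normc (f x) ^+ 2)%:E))%E).
  apply: ge0_le_integral => //.
  - by move=> x _; rewrite lee_fin normc_ge0.
  - exact/measurable_EFinP/measurable_normc/cmeas_trunc.
  - apply: emeasurable_funD; first exact/measurable_EFinP/measurable_indic.
    exact/measurable_EFinP/measurable_sqr_normc.
  - move=> x _; rewrite -EFinD lee_fin normc_trunc indicE.
    have := normc_ge0 (f x); have := sqr_ge0 (normc (f x)).
    have := sqr_ge0 (normc (f x) - 1).
    by case: (x \in D) => /=; rewrite ?mulr1n ?mul1r ?mulr0n ?mul0r; lra.
rewrite ge0_integralD//.
- by rewrite lte_add_pinfty// integral_indic_lt.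
- exact/measurable_EFinP/measurable_indic.
- by move=> x _; rewrite lee_fin sqr_ge0.
- exact/measurable_EFinP/measurable_sqr_normc.
Qed.

(** Sigma-finiteness exhausts the space by sets of finite measure; conclude by
    dominated convergence. *)
Lemma trunc_approx f (e : R) : sq_cintegrable mu f -> 0 < e ->
  exists D, [/\ measurable D, (mu D < +oo)%E &
    (sqnorm2 mu (fun x => f x - trunc D f x)%R <= e%:E)%E].
Proof.
move=> f2 e0; have [mf _] := f2.
have /sigma_finiteP[D [UD ndD Doo]] := sigma_finiteT mu.
have mfD k : cmeas (fun x => f x - trunc (D k) f x).
  by apply: cmeasB => //; apply: cmeas_trunc => //; have [] := Doo k.
have : (fun k => sqnorm2 mu (fun x => f x - trunc (D k) f x)%R) @ \oo --> 0%E.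
  apply: (@dominated_cvg0 _ _ _ mu (fun k x => normc (f x - trunc (D k) f x) ^+ 2)
    (fun x => normc (f x) ^+ 2)).
  - by move=> k; exact: measurable_sqr_normc.
  - move=> k x; rewrite sqr_ge0/= lerXn2r ?nnegrE ?normc_ge0//.
    rewrite /trunc indicE; case: (_ \in _); rewrite ?mul0r ?subr0//.
    by rewrite mul1r subrr Normc.normc0 normc_ge0.
  - exact: sq_cintegrable_integrable.
  - apply: aeW => x; apply: cvg_near_cst.
    have [k _ Dk] : (\bigcup_i D i) x by rewrite -UD.
    near=> n; rewrite /trunc indicE mem_set ?mul1r ?subrr ?Normc.normc0 ?expr0n//.
    by apply/(subsetPset _ _ (ndD k n _)) => //; near: n; exact: nbhs_infty_ge.
move/ge0_ereal_cvg0P => /(_ (fun k => sqnorm2_ge0 _ _) _ e0)[k _ /(_ k (leqnn k)) /= h].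
by exists (D k); have [] := Doo k.
Unshelve. all: by end_near. Qed.

End truncation.

Section inversion.
Context d (T : measurableType d) (R : realType).
Variable mu : {sigma_finite_measure set T -> \bar R}.
Variables (e : T -> T -> R[i]) (c : R).
Hypotheses (ue : unimodular e) (e_sym : forall x y, e x y = e y x).
Hypotheses (c0 : 0 < c) (Pl : plancherel_for mu e c).
Local Notation F := (ktransform mu e).
Implicit Types f u psi : T -> R[i].

(** [c^-1] times the transform with the conjugate kernel, that is, the candidate
    for the inverse transform; the conjugations avoid naming a second kernel. *)
Definition itransform psi y : R[i] :=
  (c^-1)%:C * (F (fun x => (psi x)^*) y)^*.

Lemma sq_cintegrable_ktransform f : cintegrable mu f -> sq_cintegrable mu f ->
  sq_cintegrable mu (F f).
Proof.
move=> fi f2; split; first exact: cmeas_ktransform fi.1.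
by rewrite Pl// lte_mul_pinfty ?lee_fin ?(ltW c0)//; exact: f2.2.
Qed.

Lemma sqnorm2_itransform psi : cintegrable mu psi -> sq_cintegrable mu psi ->
  sqnorm2 mu (itransform psi) = ((c^-1)%:E * sqnorm2 mu psi)%E.
Proof.
move=> pi p2; rewrite /itransform sqnorm2Z; last first.
  by apply: cmeasJ; apply: cmeas_ktransform => //; exact: cmeasJ pi.1.
rewrite sqnorm2J Pl; [|exact: cintegrableJ|exact: sq_cintegrableJ].
rewrite sqnorm2J muleA -EFinM normc_real ger0_norm ?invr_ge0 ?(ltW c0)//.
by rewrite expr2 -mulrA mulVf ?mulr1// gt_eqF.
Qed.

Lemma sq_cintegrable_itransform psi : cintegrable mu psi -> sq_cintegrable mu psi ->
  sq_cintegrable mu (itransform psi).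
Proof.
move=> pi p2; split; last first.
  by rewrite sqnorm2_itransform// lte_mul_pinfty ?lee_fin ?invr_ge0 ?(ltW c0)//; exact: p2.2.
apply: cmeasM; first exact: cmeas_cst.
by apply: cmeasJ; apply: cmeas_ktransform => //; exact: cmeasJ pi.1.
Qed.

(** The multiplication formula: Fubini's theorem and the symmetry of the kernel. *)
Lemma cint_ktransform_mul u psi : cintegrable mu u -> cintegrable mu psi ->
  cint mu (fun x => F u x * psi x) = cint mu (fun y => u y * F psi y).
Proof.
move=> ui pi.
have Gi : cintegrable (prod_measure mu mu)
    (fun p : T * T => psi p.1 * u p.2 * e p.1 p.2).
  apply: cintegrable_mul_unimodular; first exact: ue.1.
    by move=> p; exact: ue.2.
  exact: cintegrable_prod.
have H := etrans (cint_prod1 Gi) (esym (cint_prod2 Gi)).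
transitivity (cint mu (fun x => cint mu (fun y => psi x * u y * e x y))).
  apply: eq_cint => x; rewrite /ktransform mulrC -cintZ; last exact: cintegrable_kernel.
  by apply: eq_cint => y; rewrite mulrA.
apply: etrans H _; apply: eq_cint => y.
rewrite /ktransform -cintZ; last exact: cintegrable_kernel.
by apply: eq_cint => x /=; rewrite mulrA (e_sym x y) [psi x * _]mulrC.
Qed.

(** Cutting off the inverse transform: the error is explicit, because the
    cross term is [c] times the squared norm of the truncated function. *)
Lemma sqnorm2_trunc_itransform psi D : cintegrable mu psi -> sq_cintegrable mu psi ->
  measurable D -> (mu D < +oo)%E ->
  let h := itransform psi in
  sqnorm2 mu (fun x => F (trunc D h) x - psi x) =
  (c%:E * sqnorm2 mu (fun x => h x - trunc D h x)%R)%E.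
Proof.
move=> pi p2 mD Doo h; have h2 := sq_cintegrable_itransform pi p2.
set u := trunc D h.
have ui : cintegrable mu u by exact: cintegrable_trunc.
have u2 : sq_cintegrable mu u by exact: sq_cintegrable_trunc.
have F2 := sq_cintegrable_ktransform ui u2.
have fuE : fine (sqnorm2 mu (F u)) = c * fine (sqnorm2 mu u).
  by rewrite Pl// fineM//; exact: sqnorm2_fin_num.
have fpE : fine (sqnorm2 mu psi) = c * fine (sqnorm2 mu h).
  rewrite sqnorm2_itransform// fineM//=; last exact: sqnorm2_fin_num.
  by rewrite mulrA mulfV ?mul1r// gt_eqF.
have uhE : cint mu (fun y => u y * (h y)^*) = (fine (sqnorm2 mu u))%:C.
  rewrite -cint_mulJ//; apply: eq_cint => y; rewrite /u truncE.
  by case: ifP => _ //; rewrite !mul0r.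
have huE : cint mu (fun y => h y * (u y)^*) = (fine (sqnorm2 mu u))%:C.
  rewrite -cint_mulJ//; apply: eq_cint => y; rewrite /u truncE.
  by case: ifP => _ //; rewrite conjc0 !mulr0.
have cross : cint mu (fun x => F u x * (psi x)^*) = c%:C * (fine (sqnorm2 mu u))%:C.
  rewrite cint_ktransform_mul//; last exact: cintegrableJ.
  rewrite -uhE -cintZ; last first.
    exact: (cintegrableM u2 (sq_cintegrableJ h2)).
  apply: eq_cint => y; rewrite /h /itransform conjc_mul conjcK conjc_real.
  rewrite mulrCA mulrA [RHS]mulrA; congr (_ * _).
  by rewrite -mulrA -rmorphM /= mulfV ?mulr1// gt_eqF.
rewrite !sqnorm2B// cross huE fuE fpE -EFinM Re_mulc /= mul0r subr0; congr EFin.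
ring.
Qed.

(** [psi] is cut off to become integrable, its inverse transform is cut off to
    become integrable as well, and the two errors share [d0]. *)
Lemma ktransform_dense psi (d0 : R) : sq_cintegrable mu psi -> 0 < d0 ->
  exists u, [/\ cintegrable mu u, sq_cintegrable mu u &
    (sqnorm2 mu (fun x => F u x - psi x)%R <= d0%:E)%E].
Proof.
move=> p2 d0_gt0.
have dp : 0 < d0 / 4 by lra.
have [A [mA Aoo Ap]] := trunc_approx p2 dp.
have ti := cintegrable_trunc mA Aoo p2; have t2 := sq_cintegrable_trunc mA p2.
have h2 := sq_cintegrable_itransform ti t2.
have dc : 0 < d0 / 4 / c by rewrite divr_gt0.
have [B [mB Boo Bp]] := trunc_approx h2 dc.
exists (trunc B (itransform (trunc A psi))); split.
- exact: cintegrable_trunc.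
- exact: sq_cintegrable_trunc.
have FE := sqnorm2_trunc_itransform ti t2 mB Boo.
set u := trunc B _ in FE *.
rewrite (_ : (fun x => F u x - psi x) =
  (fun x => (F u x - trunc A psi x) + (-1) * (psi x - trunc A psi x))); last first.
  by apply/funext => x; rewrite mulN1r; ring.
have u2 : sq_cintegrable mu u by exact: sq_cintegrable_trunc.
have ui : cintegrable mu u by exact: cintegrable_trunc.
have m1 : cmeas (fun x => F u x - trunc A psi x).
  by apply: cmeasB; [exact: (sq_cintegrable_ktransform ui u2).1|exact: t2.1].
have m2 : cmeas (fun x => (-1) * (psi x - trunc A psi x)).
  by apply: cmeasM; [exact: cmeas_cst|apply: cmeasB; [exact: p2.1|exact: t2.1]].
have H := sqnorm2D_le mu m1 m2; apply: le_trans H _ => {m1 m2}.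
rewrite sqnorm2Z; last by apply: cmeasB; [exact: p2.1|exact: t2.1].
rewrite normc_opp Normc.normc1 expr1n mul1e FE.
apply: (@le_trans _ _ (2%:E * ((d0 / 4)%:E + (d0 / 4)%:E))%E); last first.
  by rewrite -EFinD -EFinM lee_fin; lra.
rewrite lee_pmul2l// leeD//.
apply: (@le_trans _ _ (c%:E * (d0 / 4 / c)%:E)%E); first by rewrite lee_pmul2l// lte_fin.
by rewrite -EFinM mulrCA mulfV ?mulr1// gt_eqF.
Qed.

End inversion.

(** * Completeness of L^2 *)

Section completeness.
Context d (T : measurableType d) (R : realType).
Variable mu : {measure set T -> \bar R}.
Implicit Types f u : T -> R[i].

Lemma limn_einf_le (a : nat -> \bar R) (b : \bar R) :
  (forall k, (a k <= b)%E) -> (limn_einf a <= b)%E.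
Proof.
move=> ab; rewrite limn_einf_lim; apply: lime_le; first exact: is_cvg_einfs.
apply: nearW => k; apply: ge_ereal_inf; exists (a k) => //.
by exists k => /=.
Qed.

(** The telescoping series of the steps converges absolutely. *)
Lemma cvgn_of_geometric_steps (a : nat -> R) C :
  (forall k, `|a k.+1 - a k| <= C * 2^-1 ^+ k) -> cvgn a.
Proof.
move=> aC.
have : cvgn (series (telescope a)).
  apply: normed_cvg; apply: (@series_le_cvg _ _ (geometric C 2^-1)).
  - by move=> k; exact: normr_ge0.
  - by move=> k; exact: le_trans (normr_ge0 _) (aC k).
  - by move=> k; exact: aC.
  - by apply: is_cvg_geometric_series; rewrite ger0_norm ?invr_ge0// invf_lt1// ltr1n.
move=> tc; have -> : a = (fun k => a 0%N + series (telescope a) k).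
  by apply/funext => k; rewrite telescopeK/= addrC subrK.
by apply: is_cvgD => //; exact: is_cvg_cst.
Qed.

(** The sum of the [4^k |v k|^2] has finite integral, hence is finite almost
    everywhere, and its square root serves as the constant. *)
Lemma ae_geometric_steps (v : nat -> T -> R[i]) :
  (forall k, cmeas (v k)) ->
  (forall k, (sqnorm2 mu (v k) <= (8^-1 ^+ k)%:E)%E) ->
  exists G, [/\ measurable G, (forall f, cmeas f -> ae_eq mu setT f (trunc G f)) &
    forall x, G x -> exists C, forall k, normc (v k x) <= C * 2^-1 ^+ k].
Proof.
move=> mv vle.
pose w k x : \bar R := ((4 : R) ^+ k * normc (v k x) ^+ 2)%:E.
have w0 k x : (0 <= w k x)%E.
  by rewrite /w lee_fin; apply: mulr_ge0; [exact: exprn_ge0|exact: sqr_ge0].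
have mw k : measurable_fun setT (w k).
  by apply/measurable_EFinP; apply: measurable_funM => //; exact: measurable_sqr_normc.
pose S x := (\sum_(k <oo) w k x)%E.
have S0 x : (0 <= S x)%E by apply: nneseries_ge0 => k _ _; exact: w0.
have mS : measurable_fun setT S.
  by apply: ge0_emeasurable_sum => // k x _ _; exact: w0.
have Soo : (\int[mu]_x S x < +oo)%E.
  rewrite integral_nneseries//.
  apply: (@le_lt_trans _ _ (\sum_(k <oo) (2 / (2 ^ (k + 1))%:R)%:E)%E).
    apply: lee_nneseries => [k _ _|k _]; first by apply: integral_ge0 => x _; exact: w0.
    rewrite /w; under eq_integral do rewrite EFinM.
    rewrite ge0_integralZl//; last 2 first.
    - exact/measurable_EFinP/measurable_sqr_normc.
    - by move=> x _; rewrite lee_fin sqr_ge0.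
    apply: (@le_trans _ _ ((4 ^+ k)%:E * (8^-1 ^+ k)%:E)%E).
      by rewrite lee_pmul2l ?lte_fin ?exprn_gt0//; exact: vle.
    rewrite -EFinM lee_fin -exprMn natrX addn1 exprS invfM mulrA mulfV// mul1r.
    rewrite -exprVn (_ : 4 * 8^-1 = 2^-1 :> R)//.
    by apply: (mulfI (_ : 8 != 0 :> R)) => //; rewrite mulrCA mulfV//; lra.
  have /cvg_lim H := @cvg_geometric_eseries_half R 2 0.
  have -> := H (@ereal_hausdorff R).
  by rewrite ltry.
have Si : mu.-integrable setT S.
  apply/integrableP; split => //.
  by under eq_integral do rewrite gee0_abs//.
have mG : measurable (S @^-1` `]-oo%E, +oo%E[).
  by rewrite -[X in measurable X]setTI; apply: mS => //; exact: emeasurable_itv.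
exists (S @^-1` `]-oo%E, +oo%E[); split => //.
  move=> f mf; have := integrable_ae measurableT Si.
  apply: filterS => x /(_ I) Sx _; rewrite truncE mem_set//=.
  by rewrite in_itv/=; move: Sx; rewrite fin_numElt.
move=> x /=; rewrite in_itv/= => /andP[_ Sx].
have Sf : S x \is a fin_num by rewrite ge0_fin_numE.
exists (Num.sqrt (fine (S x))) => k.
rewrite -(@ler_pXn2r _ 2%N)// ?nnegrE ?normc_ge0 ?mulr_ge0 ?sqrtr_ge0 ?exprn_ge0 ?invr_ge0//.
rewrite exprMn sqr_sqrtr; last by rewrite fine_ge0.
have -> : (2^-1 ^+ k) ^+ 2 = (4 ^+ k)^-1 :> R.
  by rewrite -exprM mulnC exprM !exprVn -natrX.
rewrite ler_pdivlMr ?exprn_gt0// mulrC -lee_fin fineK//.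
have <- : (\sum_(k <= i < k.+1) w i x = ((4 : R) ^+ k * normc (v k x) ^+ 2)%:E)%E.
  by rewrite big_nat1.
apply: le_trans (nneseries_lim_ge k.+1 _) => //=.
by rewrite big_mkord big_ord_recr/= big_nat1 leeDr// sume_ge0.
Qed.

(** Completeness of [L^2], for sequences that are Cauchy at a geometric rate:
    off a null set the sequence converges pointwise, and Fatou's lemma bounds
    the distance to the limit. *)
Lemma sq_cintegrable_complete (u : nat -> T -> R[i]) :
  (forall k, sq_cintegrable mu (u k)) ->
  (forall j k, (j <= k)%N ->
    (sqnorm2 mu (fun x => u j x - u k x)%R <= (8^-1 ^+ j)%:E)%E) ->
  exists2 h, sq_cintegrable mu h &
    forall j, (sqnorm2 mu (fun x => u j x - h x)%R <= (8^-1 ^+ j)%:E)%E.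
Proof.
move=> u2 uc.
have mud j k : cmeas (fun x => u j x - u k x) by apply: cmeasB; [exact: (u2 _).1|exact: (u2 _).1].
have [G [mG aeG GC]] := ae_geometric_steps (fun k => mud k k.+1)
  (fun k => uc k k.+1 (leqnSn k)).
(* Cutting off to [G] makes the sequence converge at every point. *)
pose v k := trunc G (u k).
have mv k : cmeas (v k) by apply: cmeas_trunc => //; exact: (u2 k).1.
have vstep x : exists C, forall k, normc (v k x - v k.+1 x) <= C * 2^-1 ^+ k.
  have [Gx|Gx] := pselect (G x).
    by have [C HC] := GC x Gx; exists C => k; rewrite /v !truncE mem_set.
  exists 0 => k; rewrite /v !truncE memNset// subrr Normc.normc0.
  by rewrite mul0r.
have cvRe x : cvgn (fun k => Re (v k x)).
  have [C HC] := vstep x; apply: (@cvgn_of_geometric_steps _ C) => k.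
  by rewrite distrC -Re_subc; apply: le_trans (HC k); exact: ler_Re_normc.
have cvIm x : cvgn (fun k => Im (v k x)).
  have [C HC] := vstep x; apply: (@cvgn_of_geometric_steps _ C) => k.
  by rewrite distrC -Im_subc; apply: le_trans (HC k); exact: ler_Im_normc.
pose h x : R[i] := limn (fun k => Re (v k x)) +i* limn (fun k => Im (v k x)).
have mh : cmeas h.
  split; [apply: (@measurable_fun_cvg _ _ _ _ (fun k x => Re (v k x)))|
          apply: (@measurable_fun_cvg _ _ _ _ (fun k x => Im (v k x)))].
  - by move=> k; exact: (mv k).1.
  - by move=> x _; exact: cvRe.
  - by move=> k; exact: (mv k).2.
  - by move=> x _; exact: cvIm.
have vh j : (sqnorm2 mu (fun x => v j x - h x)%R <= (8^-1 ^+ j)%:E)%E.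
  have mf k : measurable_fun setT (fun x => (normc (v j x - v (k + j)%N x) ^+ 2)%:E).
    by apply/measurable_EFinP/measurable_sqr_normc/cmeasB.
  have f0 k x : setT x -> (0 <= (normc (v j x - v (k + j)%N x) ^+ 2)%:E)%E.
    by rewrite lee_fin sqr_ge0.
  have Fa := fatou mu measurableT mf f0.
  have -> : sqnorm2 mu (fun x => v j x - h x)%R =
    (\int[mu]_x limn_einf (fun k => (normc (v j x - v (k + j)%N x) ^+ 2)%:E))%E.
    apply: eq_integral => x _; apply/esym.
    apply: (cvg_limn_einf_sup _).1; apply: cvg_EFin; first exact: nearW.
    rewrite (_ : _ \o _ = (fun k => (Re (v j x) - Re (v (k + j)%N x)) ^+ 2 +
      (Im (v j x) - Im (v (k + j)%N x)) ^+ 2)); last first.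
      by apply/funext => k; rewrite /= sqr_normcE Re_subc Im_subc.
    rewrite sqr_normcE Re_subc Im_subc.
    apply: cvgD; rewrite !expr2.
      have H : (fun k => Re (v j x) - Re (v (k + j)%N x)) @ \oo --> Re (v j x) - Re (h x).
        apply: cvgB; first exact: cvg_cst.
        have := cvRe x; rewrite -(cvg_shiftn j); exact.
      under eq_fun do rewrite expr2.
      exact: (cvgM H H).
    have H : (fun k => Im (v j x) - Im (v (k + j)%N x)) @ \oo --> Im (v j x) - Im (h x).
      apply: cvgB; first exact: cvg_cst.
      have := cvIm x; rewrite -(cvg_shiftn j); exact.
    under eq_fun do rewrite expr2.
    exact: (cvgM H H).
  apply: le_trans Fa _; apply: limn_einf_le => k.
  apply: le_trans (uc j (k + j)%N (leq_addl _ _)).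
  apply: le_sqnorm2 => //; first exact: cmeasB.
  move=> x; rewrite /v /trunc -mulrBr.
  exact: (normc_trunc_le G (fun x => u j x - u (k + j)%N x)).
have uh j : (sqnorm2 mu (fun x => u j x - h x)%R <= (8^-1 ^+ j)%:E)%E.
  apply: le_trans (vh j); rewrite (@ae_eq_sqnorm2 _ _ _ mu _ (fun x => v j x - h x))//.
  - by apply: cmeasB => //; exact: (u2 j).1.
  - exact: cmeasB.
  - by have := aeG (u j) (u2 j).1; apply: filterS => x H _; rewrite (H I).
exists h => //; split => //.
have -> : h = (fun x => u 0%N x + (-1) * (u 0%N x - h x)).
  by apply/funext => x; rewrite mulN1r opprB addrC subrK.
have m2 : cmeas (fun x => u 0%N x - h x) by apply: cmeasB => //; exact: (u2 _).1.
have m3 : cmeas (fun x => (-1) * (u 0%N x - h x)) by apply: cmeasM => //; exact: cmeas_cst.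
have H := sqnorm2D_le mu (u2 0%N).1 m3; apply: le_lt_trans H _.
rewrite lte_mul_pinfty// lte_add_pinfty//; first exact: (u2 0%N).2.
by rewrite sqnorm2Z// normc_opp Normc.normc1 expr1n mul1e (le_lt_trans (uh _))// ltry.
Qed.

End completeness.

(** * The transform on L^2 *)

Section L2_cvg.
Context d (T : measurableType d) (R : realType).
Variable mu : {measure set T -> \bar R}.
Implicit Types f g phi psi : T -> R[i].

Lemma normc_mul_conj (z : R[i]) : normc (z * z^*) = normc z ^+ 2.
Proof. by rewrite Normc.normcM normc_conj expr2. Qed.

Lemma sqnorm2_eq0 f : cmeas f -> sqnorm2 mu f = 0%E ->
  ae_eq mu setT f (fun=> 0).
Proof.
move=> mf f0.
have mff : cmeas (fun x => f x * (f x)^*) by apply: cmeasM => //; exact: cmeasJ.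
have H : norm1 mu (fun x => f x * (f x)^*) = 0%E.
  by rewrite -f0; apply: eq_integral => x _; rewrite normc_mul_conj.
apply: filterS (norm1_eq0 mff H) => x fx _; have {}fx := fx I.
move/(congr1 (@normc R)): fx; rewrite normc_mul_conj Normc.normc0 => /eqP.
by rewrite expf_eq0/= => /eqP/Normc.eq0_normc.
Qed.

(** Young's inequality with weight [s], applied to the cross term of
    [a = b + (a - b)]. *)
Lemma sqr_normc_dist_le (s : R) (a b : R[i]) : 0 < s ->
  `|normc a ^+ 2 - normc b ^+ 2| <=
  s * normc b ^+ 2 + (1 + s^-1) * normc (a - b) ^+ 2.
Proof.
move=> s0; rewrite !sqr_normcE Re_subc Im_subc.
have rs : s^-1 * s = 1 by rewrite mulVf// gt_eqF.
have r0 : 0 <= s^-1 by rewrite invr_ge0 ltW.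
have key (x y : R) : 2 * (x * y) <= s * x ^+ 2 + s^-1 * y ^+ 2.
  have H : 0 <= s^-1 * (s * x - y) ^+ 2 by rewrite mulr_ge0 ?sqr_ge0.
  have E : s^-1 * (s * x - y) ^+ 2 =
    (s^-1 * s) * (s * x ^+ 2) - 2 * (s^-1 * s) * (x * y) + s^-1 * y ^+ 2 by ring.
  by move: H; rewrite E rs; lra.
rewrite ler_norml; apply/andP; split.
  have := key (Re b) (Re b - Re a); have := key (Im b) (Im b - Im a).
  have := sqr_ge0 (Re a - Re b); have := sqr_ge0 (Im a - Im b).
  have := mulr_ge0 r0 (sqr_ge0 (Re a - Re b)).
  by have := mulr_ge0 r0 (sqr_ge0 (Im a - Im b)); lra.
have := key (Re b) (Re a - Re b); have := key (Im b) (Im a - Im b).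
lra.
Qed.

Lemma sqnorm2_dist_le (s : R) f g : 0 < s ->
  sq_cintegrable mu f -> sq_cintegrable mu g ->
  `|fine (sqnorm2 mu f) - fine (sqnorm2 mu g)| <=
  s * fine (sqnorm2 mu g) + (1 + s^-1) * fine (sqnorm2 mu (fun x => f x - g x)).
Proof.
move=> s0 f2 g2; have h2 := sq_cintegrableB f2 g2.
have r0 : 0 <= 1 + s^-1 by rewrite addr_ge0// invr_ge0 ltW.
have i2 u : sq_cintegrable mu u -> mu.-integrable setT (EFin \o (fun x => normc (u x) ^+ 2)).
  exact: sq_cintegrable_integrable.
have FE u : fine (sqnorm2 mu u) = Rintegral mu setT (fun x => normc (u x) ^+ 2) by [].
have iR : mu.-integrable setT (EFin \o
    (fun x => s * normc (g x) ^+ 2 + (1 + s^-1) * normc (f x - g x) ^+ 2)).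
  by apply: rintegrableD; apply: rintegrableZl; exact: i2.
have RE : Rintegral mu setT (fun x => s * normc (g x) ^+ 2 + (1 + s^-1) * normc (f x - g x) ^+ 2)
  = s * fine (sqnorm2 mu g) + (1 + s^-1) * fine (sqnorm2 mu (fun x => f x - g x)).
  rewrite RintegralD//; try by apply: rintegrableZl; exact: i2.
  by rewrite !RintegralZl//; exact: i2.
have H1 : fine (sqnorm2 mu f) <= fine (sqnorm2 mu g) +
    Rintegral mu setT (fun x => s * normc (g x) ^+ 2 + (1 + s^-1) * normc (f x - g x) ^+ 2).
  rewrite !FE -RintegralD//; try exact: i2.
  apply: le_Rintegral => //; try exact: i2.
    by apply: rintegrableD; [exact: i2|].
  by move=> x _; have := sqr_normc_dist_le (f x) (g x) s0; rewrite ler_norml => /andP[]; lra.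
have H2 : fine (sqnorm2 mu g) <= fine (sqnorm2 mu f) +
    Rintegral mu setT (fun x => s * normc (g x) ^+ 2 + (1 + s^-1) * normc (f x - g x) ^+ 2).
  rewrite !FE -RintegralD//; try exact: i2.
  apply: le_Rintegral => //; try exact: i2.
    by apply: rintegrableD; [exact: i2|].
  by move=> x _; have := sqr_normc_dist_le (f x) (g x) s0; rewrite ler_norml => /andP[]; lra.
by rewrite -RE ler_norml; apply/andP; split; lra.
Qed.

(** Choose the weight in [sqnorm2_dist_le] to make its first term small; the
    second one then tends to 0. *)
Lemma sqnorm2_cvg (u : nat -> T -> R[i]) f : (forall k, sq_cintegrable mu (u k)) ->
  sq_cintegrable mu f -> (fun k => sqnorm2 mu (fun x => u k x - f x)) @ \oo --> 0%E ->
  fine (sqnorm2 mu (u k)) @[k --> \oo] --> fine (sqnorm2 mu f).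
Proof.
move=> u2 f2 /ge0_ereal_cvg0P uf.
have {}uf := uf (fun k => sqnorm2_ge0 _ _).
apply/cvgrPdist_le => e e0; set b := fine (sqnorm2 mu f).
have b0 : 0 <= b by rewrite fine_ge0 ?sqnorm2_ge0.
pose s := e / (2 * (b + 1)).
have s0 : 0 < s by rewrite divr_gt0// mulr_gt0// ltr_wpDl.
have sb : s * b <= e / 2.
  have sE : s * (b + 1) = e / 2 by rewrite /s; field; rewrite gt_eqF// ltr_wpDl.
  lra.
have r0 : 0 < 1 + s^-1 by rewrite addr_gt0// invr_gt0.
have d0 : 0 < e / 2 / (1 + s^-1) by rewrite !divr_gt0.
have := uf _ d0; apply: filterS => k hk.
rewrite distrC; apply: le_trans (sqnorm2_dist_le s0 (u2 k) f2) _.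
rewrite -/b; have h : (1 + s^-1) * fine (sqnorm2 mu (fun x => u k x - f x)) <= e / 2.
  rewrite mulrC -ler_pdivlMr// -lee_fin fineK//; apply: sqnorm2_fin_num.
  exact: sq_cintegrableB.
lra.
Qed.

Lemma sqnorm2_cvg0D (u v : nat -> T -> R[i]) :
  (forall k, cmeas (u k)) -> (forall k, cmeas (v k)) ->
  (fun k => sqnorm2 mu (u k)) @ \oo --> 0%E -> (fun k => sqnorm2 mu (v k)) @ \oo --> 0%E ->
  (fun k => sqnorm2 mu (fun x => u k x + v k x)) @ \oo --> 0%E.
Proof.
move=> mu_ mv u0 v0.
apply: (@ge0_ereal_squeeze0 _ _ (fun k => 2%:E * (sqnorm2 mu (u k) + sqnorm2 mu (v k)))%E).
  by move=> k; rewrite sqnorm2_ge0 sqnorm2D_le.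
rewrite -[X in _ --> X](mule0 2%:E); apply: cvgeZl => //.
by rewrite -[X in _ --> X]adde0; apply: cvgeD.
Qed.

Lemma sqnorm2_cvg0Z (c : R[i]) (u : nat -> T -> R[i]) :
  (forall k, cmeas (u k)) -> (fun k => sqnorm2 mu (u k)) @ \oo --> 0%E ->
  (fun k => sqnorm2 mu (fun x => c * u k x)) @ \oo --> 0%E.
Proof.
move=> mu_ u0.
have -> : (fun k => sqnorm2 mu (fun x => c * u k x)) =
  (fun k => ((normc c ^+ 2)%:E * sqnorm2 mu (u k))%E).
  by apply/funext => k; rewrite sqnorm2Z.
by rewrite -[X in _ --> X](mule0 (normc c ^+ 2)%:E); apply: cvgeZl.
Qed.

End L2_cvg.

Section L2_transform.
Context d (T : measurableType d) (R : realType).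
Variable mu : {sigma_finite_measure set T -> \bar R}.
Variables (e : T -> T -> R[i]) (c : R).
Hypotheses (ue : unimodular e) (e_sym : forall x y, e x y = e y x).
Hypotheses (c0 : 0 < c) (Pl : plancherel_for mu e c).
Local Notation F := (ktransform mu e).
Implicit Types f g phi psi : T -> R[i].

(** The closure of the graph of the transform on [L^1 /\ L^2]. For the
    exponential kernel it is [is_fourierL2], with squared norms in place of norms. *)
Definition L2transform f phi :=
  [/\ sq_cintegrable mu f, sq_cintegrable mu phi & exists u : nat -> T -> R[i],
    [/\ forall k, cintegrable mu (u k) /\ sq_cintegrable mu (u k),
      (fun k => sqnorm2 mu (fun x => u k x - f x)) @ \oo --> 0%E &
      (fun k => sqnorm2 mu (fun x => F (u k) x - phi x)) @ \oo --> 0%E]].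

Lemma sqnorm2_subrr f : sqnorm2 mu (fun x => f x - f x) = 0%E.
Proof.
by apply: integral0_eq => x _; rewrite subrr Normc.normc0 expr0n.
Qed.

Lemma L2transform_ktransform f : cintegrable mu f -> sq_cintegrable mu f ->
  L2transform f (F f).
Proof.
move=> fi f2; split => //; first exact: (sq_cintegrable_ktransform ue c0 Pl fi f2).
by exists (fun=> f); split => //; rewrite sqnorm2_subrr; exact: cvg_cst.
Qed.

Lemma L2transformB f g phi psi : L2transform f phi -> L2transform g psi ->
  L2transform (fun x => f x - g x) (fun x => phi x - psi x).
Proof.
move=> [f2 phi2 [u [ui uf uphi]]] [g2 psi2 [v [vi vg vpsi]]].
split; [exact: sq_cintegrableB|exact: sq_cintegrableB|].
have mF w : cintegrable mu w -> cmeas (F w) by move=> wi; exact: cmeas_ktransform ue wi.1.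
have vZ k : cintegrable mu (fun x => (-1) * v k x) by apply: cintegrableZ; exact: (vi k).1.
exists (fun k x => u k x + (-1) * v k x); split.
- move=> k; split.
    by apply: cintegrableD => //; exact: (ui k).1.
  by apply: sq_cintegrableD; [exact: (ui k).2|apply: sq_cintegrableZ; exact: (vi k).2].
- rewrite (_ : (fun k => _) = (fun k => sqnorm2 mu (fun x => (u k x - f x) + (-1) * (v k x - g x)))).
    have mu1 k : cmeas (fun x => u k x - f x).
      by apply: cmeasB; [exact: (ui k).1.1|exact: f2.1].
    have mv1 k : cmeas (fun x => v k x - g x).
      by apply: cmeasB; [exact: (vi k).1.1|exact: g2.1].
    have mv2 k : cmeas (fun x => (-1) * (v k x - g x)) by apply: cmeasM => //; exact: cmeas_cst.
    have v0 := sqnorm2_cvg0Z (-1) mv1 vg.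
    by have := sqnorm2_cvg0D mu1 mv2 uf v0.
  by apply/funext => k; congr sqnorm2; apply/funext => x; ring.
- rewrite (_ : (fun k => _) = (fun k => sqnorm2 mu
    (fun x => (F (u k) x - phi x) + (-1) * (F (v k) x - psi x)))).
    have mu1 k : cmeas (fun x => F (u k) x - phi x).
      by apply: cmeasB; [exact: mF (ui k).1|exact: phi2.1].
    have mv1 k : cmeas (fun x => F (v k) x - psi x).
      by apply: cmeasB; [exact: mF (vi k).1|exact: psi2.1].
    have mv2 k : cmeas (fun x => (-1) * (F (v k) x - psi x)) by apply: cmeasM => //; exact: cmeas_cst.
    have v0 := sqnorm2_cvg0Z (-1) mv1 vpsi.
    by have := sqnorm2_cvg0D mu1 mv2 uphi v0.
  apply/funext => k; congr sqnorm2; apply/funext => x.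
  by rewrite (ktransformD x ue (ui k).1 (vZ k)) (ktransformZ (-1) x ue (vi k).1); ring.
Qed.

Lemma L2transformZ a f phi : L2transform f phi ->
  L2transform (fun x => a * f x) (fun x => a * phi x).
Proof.
move=> [f2 phi2 [u [ui uf uphi]]].
split; [exact: sq_cintegrableZ|exact: sq_cintegrableZ|].
have mF w : cintegrable mu w -> cmeas (F w) by move=> wi; exact: cmeas_ktransform ue wi.1.
exists (fun k x => a * u k x); split.
- by move=> k; split; [apply: cintegrableZ; exact: (ui k).1|
    apply: sq_cintegrableZ; exact: (ui k).2].
- rewrite (_ : (fun k => _) = (fun k => sqnorm2 mu (fun x => a * (u k x - f x)))).
    by apply: sqnorm2_cvg0Z => // k; apply: cmeasB; [exact: (ui k).1.1|exact: f2.1].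
  by apply/funext => k; congr sqnorm2; apply/funext => x; ring.
- rewrite (_ : (fun k => _) = (fun k => sqnorm2 mu (fun x => a * (F (u k) x - phi x)))).
    by apply: sqnorm2_cvg0Z => // k; apply: cmeasB; [exact: mF (ui k).1|exact: phi2.1].
  apply/funext => k; congr sqnorm2; apply/funext => x.
  by rewrite (ktransformZ a x ue (ui k).1); ring.
Qed.

(** Plancherel's identity passes to the limit. *)
Lemma L2transform_sqnorm2 f phi : L2transform f phi ->
  fine (sqnorm2 mu phi) = c * fine (sqnorm2 mu f).
Proof.
move=> [f2 phi2 [u [ui uf uphi]]].
have F2 k : sq_cintegrable mu (F (u k)).
  exact: (sq_cintegrable_ktransform ue c0 Pl (ui k).1 (ui k).2).
have Hf := sqnorm2_cvg (fun k => (ui k).2) f2 uf.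
have Hphi := sqnorm2_cvg F2 phi2 uphi.
apply: (cvg_unique _ Hphi) => //.
rewrite (_ : (fun k => _) = (fun k => c * fine (sqnorm2 mu (u k)))).
  by apply: cvgMr.
apply/funext => k; rewrite (Pl (ui k).1 (ui k).2) fineM//.
exact: sqnorm2_fin_num (ui k).2.
Qed.

(** The difference of two transforms of [f] is a transform of 0, so Plancherel's
    identity makes its norm vanish. *)
Lemma L2transform_unique f phi psi : L2transform f phi -> L2transform f psi ->
  ae_eq mu setT phi psi.
Proof.
move=> fphi fpsi; have H := L2transformB fphi fpsi.
have := L2transform_sqnorm2 H; rewrite sqnorm2_subrr mulr0 => E.
have [_ phi2 _] := fphi; have [_ psi2 _] := fpsi; have h2 := sq_cintegrableB phi2 psi2.
have E0 : sqnorm2 mu (fun x => phi x - psi x) = 0%E.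
  by rewrite -(fineK (sqnorm2_fin_num h2)) E.
have := sqnorm2_eq0 h2.1 E0; apply: filterS => x /(_ I) /eqP; rewrite subr_eq0 => /eqP -> _.
by [].
Qed.

Lemma L2transform_Re_cint f g phi psi : L2transform f phi -> L2transform g psi ->
  Re (cint mu (fun x => phi x * (psi x)^*)) =
  c * Re (cint mu (fun x => f x * (g x)^*)).
Proof.
move=> fphi gpsi; have [f2 phi2 _] := fphi; have [g2 psi2 _] := gpsi.
have := L2transform_sqnorm2 (L2transformB fphi gpsi).
rewrite (sqnorm2B phi2 psi2) (sqnorm2B f2 g2) /=.
rewrite (L2transform_sqnorm2 fphi) (L2transform_sqnorm2 gpsi).
lra.
Qed.

(** Parseval's identity, by polarization: the law of cosines gives the real
    part, and multiplying one function by [i] the imaginary part. *)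
Lemma L2transform_parseval f g phi psi : L2transform f phi -> L2transform g psi ->
  cint mu (fun x => phi x * (psi x)^*) = c%:C * cint mu (fun x => f x * (g x)^*).
Proof.
move=> fphi gpsi; have [f2 phi2 _] := fphi; have [g2 psi2 _] := gpsi.
have pi : cintegrable mu (fun x => phi x * (psi x)^*).
  by apply: cintegrableM => //; exact: sq_cintegrableJ.
have fi : cintegrable mu (fun x => f x * (g x)^*).
  by apply: cintegrableM => //; exact: sq_cintegrableJ.
apply: complex_eqP.
  by rewrite (L2transform_Re_cint fphi gpsi) Re_mulc/= mul0r subr0.
have := L2transform_Re_cint (L2transformZ 'i fphi) gpsi.
have -> : cint mu (fun x => 'i * phi x * (psi x)^*) = 'i * cint mu (fun x => phi x * (psi x)^*).
  by rewrite -cintZ//; apply: eq_cint => x; rewrite mulrA.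
have -> : cint mu (fun x => 'i * f x * (g x)^*) = 'i * cint mu (fun x => f x * (g x)^*).
  by rewrite -cintZ//; apply: eq_cint => x; rewrite mulrA.
by rewrite !Re_mulc Im_mulc/= !mul0r !mul1r addr0; lra.
Qed.

(** The transform is onto: the range is dense by [ktransform_dense], and closed
    because the transform multiplies norms by a constant. *)
Lemma L2transform_onto psi : sq_cintegrable mu psi -> exists h, L2transform h psi.
Proof.
move=> p2.
have d0 k : 0 < 8^-1 ^+ k * (c / 4) by rewrite mulr_gt0 ?exprn_gt0 ?divr_gt0.
have [u Hu] := choice (fun k => ktransform_dense ue e_sym c0 Pl p2 (d0 k)).
have u2 k : sq_cintegrable mu (u k) by have [] := Hu k.
have ui k : cintegrable mu (u k) by have [] := Hu k.
have up k : (sqnorm2 mu (fun x => F (u k) x - psi x)%R <= (8^-1 ^+ k * (c / 4))%:E)%E.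
  by have [] := Hu k.
have mF k : cmeas (fun x => F (u k) x - psi x).
  by apply: cmeasB; [exact: cmeas_ktransform ue (ui k).1|exact: p2.1].
have uc j k : (j <= k)%N -> (sqnorm2 mu (fun x => u j x - u k x)%R <= (8^-1 ^+ j)%:E)%E.
  move=> jk.
  have vi : cintegrable mu (fun x => (-1) * u k x) by exact: cintegrableZ.
  have di : cintegrable mu (fun x => u j x + (-1) * u k x) by exact: cintegrableD.
  have d2 : sq_cintegrable mu (fun x => u j x + (-1) * u k x).
    by apply: sq_cintegrableD => //; exact: sq_cintegrableZ.
  have -> : (fun x => u j x - u k x) = (fun x => u j x + (-1) * u k x).
    by apply/funext => x; ring.
  rewrite -(@lee_pmul2l _ c%:E)// -(Pl di d2).
  have -> : F (fun x => u j x + (-1) * u k x) =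
      (fun x => (F (u j) x - psi x) + (-1) * (F (u k) x - psi x)).
    apply/funext => x.
    by rewrite (ktransformD x ue (ui j) vi) (ktransformZ (-1) x ue (ui k)); ring.
  have m2 : cmeas (fun x => (-1) * (F (u k) x - psi x)) by apply: cmeasM => //; exact: cmeas_cst.
  apply: le_trans (sqnorm2D_le mu (mF j) m2) _.
  rewrite (sqnorm2Z mu (-1) (mF k)) normc_opp Normc.normc1 expr1n mul1e.
  have jk8 : 8^-1 ^+ k <= 8^-1 ^+ j :> R.
    by rewrite ler_wiXn2l// ?invr_ge0// invf_le1 ?ler1n.
  have H : (sqnorm2 mu (fun x => F (u j) x - psi x)%R +
      sqnorm2 mu (fun x => F (u k) x - psi x)%R <= (8^-1 ^+ j * (c / 4))%:E + (8^-1 ^+ j * (c / 4))%:E)%E.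
    apply: leeD => //; apply: le_trans (up k) _.
    by rewrite lee_fin ler_wpM2r// ltW// divr_gt0.
  apply: (@le_trans _ _ (2%:E * ((8^-1 ^+ j * (c / 4))%:E + (8^-1 ^+ j * (c / 4))%:E))%E).
    by rewrite lee_pmul2l.
  by rewrite -EFinD -!EFinM lee_fin; set q := 8^-1 ^+ j; lra.
have [h h2 uh] := sq_cintegrable_complete u2 uc.
have g0 (b : R) : (fun k => (8^-1 ^+ k * b)%:E) @ \oo --> 0%E.
  apply: cvg_EFin; first exact: nearW.
  rewrite -[X in _ --> X](mul0r b); apply: cvgMl; apply: cvg_expr.
  by rewrite ger0_norm ?invr_ge0// invf_lt1// ltr1n.
exists h; split => //; exists u; split => //.
  apply: (@ge0_ereal_squeeze0 _ _ (fun k => (8^-1 ^+ k * 1)%:E)) (g0 1) => k.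
  by rewrite sqnorm2_ge0 mulr1; exact: uh.
apply: (@ge0_ereal_squeeze0 _ _ (fun k => (8^-1 ^+ k * (c / 4))%:E)) (g0 _) => k.
by rewrite sqnorm2_ge0; exact: up.
Qed.

End L2_transform.

(** * The operator g(Delta) in frequency space *)

Section euclidean_L2.
Context {R : realType} {n : nat}.
Local Notation mu := (lebesgue_Rn n : {sigma_finite_measure set (Rn R n) -> \bar R}).
Implicit Types f g h phi : Rn R n -> R[i].

Lemma expe2_poweR (x : \bar R) : (0 <= x)%E -> (x ^+ 2 = x `^ 2)%E.
Proof.
move: x => [r r0| _|//].
  by rewrite poweR_EFin powR_mulrn// -EFin_expe.
by rewrite poweRyr// expe2 mulyy.
Qed.

Lemma lee_expe2 (x : \bar R) (r : R) : (0 <= x)%E -> 0 <= r ->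
  (x ^+ 2 <= (r ^+ 2)%:E)%E = (x <= r%:E)%E.
Proof.
move: x => [s s0 r0| _ r0|//].
  by rewrite -EFin_expe !lee_fin ler_pXn2r// nnegrE.
by rewrite expe2 mulyy.
Qed.

Lemma cLnorm1E f : cLnorm 1 f = norm1 mu f.
Proof.
rewrite /cLnorm Lnorm1; apply: eq_integral => x _.
by rewrite gee0_abs// lee_fin normc_ge0.
Qed.

Lemma cLnorm2E f : (cLnorm 2 f ^+ 2)%E = sqnorm2 mu f.
Proof.
rewrite expe2_poweR ?Lnorm_ge0// powR_Lnorm//; apply: eq_integral => x _.
by rewrite gee0_abs ?lee_fin ?normc_ge0// poweR_EFin powR_mulrn// normc_ge0.
Qed.

Lemma inLp1P f : inLp 1 f <-> cintegrable mu f.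
Proof. by rewrite /inLp cLnorm1E. Qed.

Lemma inLp2P f : inLp 2 f <-> sq_cintegrable mu f.
Proof.
rewrite /inLp /sq_cintegrable -cLnorm2E.
suff -> : (cLnorm 2 f < +oo)%E = (cLnorm 2 f ^+ 2 < +oo)%E by [].
have : (0 <= cLnorm 2 f)%E by exact: Lnorm_ge0.
case: (cLnorm 2 f) => [r _|_|//]; first by rewrite -EFin_expe !ltry.
by rewrite expe2 mulyy.
Qed.

Lemma cvg_cLnorm2 (u : nat -> Rn R n -> R[i]) :
  ((fun k => cLnorm 2 (u k)) @ \oo --> 0%E) <->
  ((fun k => sqnorm2 mu (u k)) @ \oo --> 0%E).
Proof.
have N0 k : (0 <= cLnorm 2 (u k))%E by exact: Lnorm_ge0.
rewrite (ge0_ereal_cvg0P N0) (ge0_ereal_cvg0P (fun k => sqnorm2_ge0 mu (u k))).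
split=> H e e0.
  have s0 : 0 < Num.sqrt e by rewrite sqrtr_gt0.
  apply: filterS (H _ s0) => k; rewrite -lee_expe2 ?(ltW s0)// sqr_sqrtr ?(ltW e0)//.
  by rewrite cLnorm2E.
have s0 : 0 < e ^+ 2 by rewrite exprn_gt0.
by apply: filterS (H _ s0) => k; rewrite -cLnorm2E lee_expe2 ?(ltW e0).
Qed.

Lemma is_fourierL2P f phi : is_fourierL2 f phi <-> L2transform mu (@kerRn R n) f phi.
Proof.
split=> [[/inLp2P f2 /inLp2P p2 [u [ui uf up]]]|[f2 p2 [u [ui uf up]]]].
  split=> //; exists u; split.
  - by move=> k; have [/inLp1P ? /inLp2P ?] := ui k.
  - exact/cvg_cLnorm2.
  - exact/cvg_cLnorm2.
split; [exact/inLp2P|exact/inLp2P|exists u; split].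
- by move=> k; have [/inLp1P ? /inLp2P ?] := ui k.
- exact/cvg_cLnorm2.
- exact/cvg_cLnorm2.
Qed.

Lemma kerRn_sym (x y : Rn R n) : kerRn x y = kerRn y x.
Proof.
by rewrite /kerRn /dotRn; congr (expi (- _)); apply: eq_bigr => i _; rewrite mulrC.
Qed.

Lemma twopi_gt0 : 0 < (2 * pi : R) ^+ n.
Proof. by rewrite exprn_gt0// mulr_gt0// pi_gt0. Qed.

Lemma fourierP f : inLp 1 f -> inLp 2 f ->
  L2transform mu (@kerRn R n) f (fourier f).
Proof.
move=> /inLp1P fi /inLp2P f2; apply/is_fourierL2P.
apply: (@xgetPex _ _ [set phi | is_fourierL2 f phi]).
exists (fourierL1 f); apply/is_fourierL2P.
exact: (L2transform_ktransform (unimodular_kerRn n) twopi_gt0 (@plancherel_Rn R n) fi f2).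
Qed.

Lemma normc_fourier_le f : inLp 1 f -> inLp 2 f ->
  {ae mu, forall x, normc (fourier f x) <= fine (norm1 mu f)}.
Proof.
move=> f1 f2; have /inLp1P fi := f1; have /inLp2P fs := f2.
have T1 := L2transform_ktransform (unimodular_kerRn n) twopi_gt0 (@plancherel_Rn R n) fi fs.
have := L2transform_unique (unimodular_kerRn n) twopi_gt0 (@plancherel_Rn R n)
  (fourierP f1 f2) T1.
apply: filterS => x /(_ I) ->; rewrite -lee_fin fineK.
  exact: (normc_ktransform_le x (unimodular_kerRn n) fi).
by rewrite ge0_fin_numE ?norm1_ge0//; exact: fi.2.
Qed.

Lemma sqnormRn_ge0 (x : Rn R n) : 0 <= sqnormRn x.
Proof. by apply: sumr_ge0 => i _; rewrite -expr2 sqr_ge0. Qed.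

Variable g : R -> R.
Hypothesis g_ge0 : forall s : R, 0 <= s -> 0 <= g s.
Hypothesis g_ndecr : forall s t : R, 0 <= s -> s <= t -> g s <= g t.

(** [g] is monotone on the nonnegative reals only; composing it with [max 0]
    changes nothing on squared norms and makes it monotone everywhere. *)
Lemma measurable_symbol : measurable_fun setT (fun x : Rn R n => g (sqnormRn x)).
Proof.
have -> : (fun x : Rn R n => g (sqnormRn x)) =
    (fun s => g (Num.max 0 s)) \o (@sqnormRn R n).
  by apply/funext => x; rewrite /= max_r// sqnormRn_ge0.
apply: measurableT_comp; last exact: measurable_sqnormRn.
apply: nondecreasing_measurable => // s t st; apply: g_ndecr.
  by rewrite le_max lexx.
by rewrite ge_max le_max lexx/= le_max st orbT.
Qed.

Variable f : Rn R n -> R[i].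
Hypotheses (fdom : dom_gDelta g f) (f1 : inLp 1 f).
Local Notation phi := (fourier f).
Local Notation psi := (fun x => (g (sqnormRn x))%:C * fourier f x).

Let f2 : inLp 2 f := fdom.1.

Lemma sq_cintegrable_symbol : sq_cintegrable mu psi.
Proof.
have [_ p2 _] := fourierP f1 f2; split.
  by apply: cmeasM; [exact: cmeas_real measurable_symbol|exact: p2.1].
apply: le_lt_trans fdom.2; apply: ge0_le_integral => //.
- by move=> x _; rewrite lee_fin sqr_ge0.
- apply/measurable_EFinP/measurable_sqr_normc.
  by apply: cmeasM; [exact: cmeas_real measurable_symbol|exact: p2.1].
- apply/measurable_EFinP; apply: measurable_funM.
    by apply: measurable_funX; apply: measurableT_comp => //; exact: measurable_symbol.
  exact: measurable_sqr_normc p2.1.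
- by move=> x _; rewrite lee_fin Normc.normcM normc_real exprMn.
Qed.

(** The surjectivity of the transform provides a function for [gDelta] to pick. *)
Lemma gDeltaP : L2transform mu (@kerRn R n) (gDelta g f) psi.
Proof.
apply/is_fourierL2P.
apply: (@xgetPex _ _ [set h | is_fourierL2 h psi]).
have [h hp] := L2transform_onto (unimodular_kerRn n) kerRn_sym twopi_gt0
  (@plancherel_Rn R n) sq_cintegrable_symbol.
by exists h; apply/is_fourierL2P.
Qed.

(** The value of [(g(Delta) f, f)]; that it is real is part of [inner_gDelta]. *)
Definition qform := (2 * pi) ^- n * Rintegral mu setT (fun x => g (sqnormRn x) * normc (phi x) ^+ 2).

Lemma integrable_symbol_sqr :
  mu.-integrable setT (EFin \o (fun x => g (sqnormRn x) * normc (phi x) ^+ 2)).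
Proof.
have [_ p2 _] := fourierP f1 f2.
have := cintegrableM sq_cintegrable_symbol (sq_cintegrableJ p2).
move/cintegrable_Re; congr (mu.-integrable _ _).
by apply/funext => x /=; rewrite -mulrA mulc_conj /= mul0r subr0.
Qed.

(** Parseval's identity for [f] and [g(Delta) f]. *)
Lemma inner_gDelta : inner (gDelta g f) f = qform%:C.
Proof.
have H := L2transform_parseval (unimodular_kerRn n) twopi_gt0 (@plancherel_Rn R n)
  gDeltaP (fourierP f1 f2).
have E : cint mu (fun x => psi x * (phi x)^*) =
    (Rintegral mu setT (fun x => g (sqnormRn x) * normc (phi x) ^+ 2))%:C.
  apply: complex_eqP => /=.
    apply: eq_Rintegral => x _.
    by rewrite -mulrA mulc_conj /= mul0r subr0.
  transitivity (Rintegral mu setT (fun x => 0 : R)).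
    apply: eq_Rintegral => x _.
    by rewrite -mulrA mulc_conj /= mul0r mulr0 addr0.
  by rewrite Rintegral_cst ?mul0r.
have -> : inner (gDelta g f) f = cint mu (fun x => gDelta g f x * (f x)^*) by [].
rewrite /qform rmorphM /= -E H mulrA -rmorphM /= mulVf ?mul1r//.
by rewrite gt_eqF// twopi_gt0.
Qed.

Lemma qform_ge0 : 0 <= qform.
Proof.
apply: mulr_ge0; first by rewrite invr_ge0 ltW// twopi_gt0.
apply: Rintegral_ge0 => x _; rewrite mulr_ge0 ?sqr_ge0//.
exact/g_ge0/sqnormRn_ge0.
Qed.

Local Notation N2 := (fine (sqnorm2 mu f)).
Local Notation N1 := (fine (norm1 mu f)).

(** Frequencies with [g(|x|^2) > 1/t] are charged to the form, the others lie in
    a ball, where the transform is at most the [L^1] norm. *)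
Lemma frequency_splitting (t rho : R) : 0 < t ->
  (forall s, 0 <= s -> g s <= t^-1 -> s <= rho) ->
  (mu [set x | (sqnormRn x <= rho)%R] < +oo)%E ->
  N2 <= t * qform + (2 * pi) ^- n * fine (mu [set x | sqnormRn x <= rho]) * N1 ^+ 2.
Proof.
move=> t0 grho Boo; set B := [set x : Rn R n | _].
have mB : measurable B.
  rewrite -[B]setTI (_ : B = (@sqnormRn R n) @^-1` `]-oo, rho]); last first.
    by apply/seteqP; split => x /=; rewrite in_itv.
  by apply: measurable_sqnormRn => //; exact: measurable_itv.
have c0 := twopi_gt0.
have [_ p2 _] := fourierP f1 f2.
have Pl := L2transform_sqnorm2 (unimodular_kerRn n) c0 (@plancherel_Rn R n) (fourierP f1 f2).
pose G x := g (sqnormRn x) * normc (phi x) ^+ 2.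
have iG : mu.-integrable setT (EFin \o G) := integrable_symbol_sqr.
have iB : mu.-integrable setT (EFin \o (fun x => \1_B x : R)).
  apply: ge0_rintegrable; first exact: measurable_indic.
    by move=> x; rewrite indicE.
  exact: integral_indic_lt.
have iS : mu.-integrable setT (EFin \o (fun x => t * G x + N1 ^+ 2 * \1_B x)).
  by apply: rintegrableD; exact: rintegrableZl.
have key : fine (sqnorm2 mu phi) <= t * Rintegral mu setT G + N1 ^+ 2 * fine (mu B).
  have -> : fine (mu B) = Rintegral mu setT (fun x => \1_B x : R).
    by rewrite /Rintegral integral_indic// setIT.
  rewrite -!RintegralZl// -RintegralD//; try exact: rintegrableZl.
  have iphi := sq_cintegrable_integrable p2.
  apply: fine_le; [exact: sqnorm2_fin_num|exact: integrable_fin_num|].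
  apply: ae_ge0_le_integral => //.
  - by move=> x _; rewrite lee_fin sqr_ge0.
  - by case/integrableP : iphi.
  - move=> x _; rewrite lee_fin; apply: addr_ge0; apply: mulr_ge0; rewrite ?(ltW t0)//.
    + by apply: mulr_ge0; [exact/g_ge0/sqnormRn_ge0|exact: sqr_ge0].
    + exact: sqr_ge0.
  - by case/integrableP : iS.
  have := normc_fourier_le f1 f2; apply: filterS => x px _; rewrite lee_fin.
  have x0 := sqnormRn_ge0 x; have gx0 := g_ge0 x0; have p0 := sqr_ge0 (normc (phi x)).
  have [gx|gx] := leP (g (sqnormRn x)) t^-1.
    rewrite indicE mem_set ?mulr1; last exact: grho.
    apply: (@le_trans _ _ (N1 ^+ 2)).
      by rewrite lerXn2r// ?nnegrE ?normc_ge0// (le_trans _ px)// normc_ge0.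
    by rewrite lerDr; apply: mulr_ge0; [exact: ltW|exact: mulr_ge0].
  apply: (@le_trans _ _ (t * G x)); last by rewrite lerDl mulr_ge0// sqr_ge0.
  rewrite /G mulrA ler_peMl//.
  by rewrite mulrC -ler_pdivrMr// mul1r ltW.
rewrite -(@ler_pM2l _ ((2 * pi) ^+ n))// -Pl.
set V := fine (mu B) in key *; rewrite /qform.
set c := (2 * pi) ^+ n in c0 Pl *.
rewrite (_ : c * _ = (c / c) * (t * Rintegral mu setT G + N1 ^+ 2 * V)).
  by rewrite mulfV ?mul1r// gt_eqF.
by rewrite /G; ring.
Qed.

End euclidean_L2.

(** * Volume of balls, and the two inequalities *)

Section ball_volume.
Context {R : realType}.
Local Notation line := (measurableTypeR R).
Local Notation lambda := (@lebesgue_measure R).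

(** Indexed by the squared radius, so that a slice at height [a] has parameter
    [s - a ^+ 2]. *)
Definition ball_volume n (s : R) : \bar R := lebesgue_Rn n [set x | sqnormRn x <= s].

Lemma measurable_ball n s : measurable [set x : Rn R n | sqnormRn x <= s].
Proof.
rewrite -[X in measurable X]setTI (_ : [set x | _] = (@sqnormRn R n) @^-1` `]-oo, s]); last first.
  by apply/seteqP; split => x /=; rewrite in_itv.
by apply: measurable_sqnormRn => //; exact: measurable_itv.
Qed.

Lemma sqnormRn_cons n (p : line * Rn R n) :
  sqnormRn (cons_Rn p) = p.1 ^+ 2 + sqnormRn p.2.
Proof. by rewrite /sqnormRn dotRn_cons expr2. Qed.

Definition cons_ball n s : set (line * Rn R n) := [set p | p.1 ^+ 2 + sqnormRn p.2 <= s].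

Lemma measurable_cons_ball n s : measurable (@cons_ball n s).
Proof.
rewrite -[X in measurable X]setTI
  (_ : cons_ball s = (@cons_Rn R n) @^-1` [set x | sqnormRn x <= s]); last first.
  by apply/seteqP; split => p /=; rewrite sqnormRn_cons.
by apply: measurable_cons_Rn => //; exact: measurable_ball.
Qed.

Lemma ball_volumeS_prod n s :
  ball_volume n.+1 s = prod_measure lambda (lebesgue_Rn n) (cons_ball s).
Proof.
rewrite /ball_volume lebesgue_Rn_cons /pushforward; congr (prod_measure _ _ _).
by apply/seteqP; split => p /=; rewrite sqnormRn_cons.
Qed.

Lemma xsection_cons_ball n s (a : line) :
  xsection (@cons_ball n s) a = [set x | sqnormRn x <= s - a ^+ 2].
Proof.
by apply/seteqP; split => x; rewrite /xsection/= inE /cons_ball/= lerBrDl.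
Qed.

Lemma ball_volumeS n s :
  ball_volume n.+1 s = (\int[lambda]_a ball_volume n (s - a ^+ 2))%E.
Proof.
rewrite ball_volumeS_prod; apply: eq_integral => a _ /=.
by rewrite xsection_cons_ball.
Qed.

Lemma measurable_ball_slice n s :
  measurable_fun setT (fun a : line => ball_volume n (s - a ^+ 2)).
Proof.
have := measurable_fun_xsection (lebesgue_Rn n) (@measurable_cons_ball n s).
by congr measurable_fun; apply/funext => a /=; rewrite xsection_cons_ball.
Qed.

(** Slicing reduces the scaling of a ball to the change of variable [a := r * b]
    on the line. *)
Lemma ball_volume_scale n (r s : R) : 0 < r ->
  ball_volume n (r ^+ 2 * s) = ((r ^+ n)%:E * ball_volume n s)%E.
Proof.
move=> r0; elim: n s => [|n IHn] s.
  rewrite expr0 mul1e /ball_volume /= !diracE; congr ((_ : nat)%:R%:E).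
  by congr nat_of_bool; apply/idP/idP; rewrite !inE /= /sqnormRn /dotRn !big_ord0 pmulr_rge0// exprn_gt0.
rewrite !ball_volumeS (@ge0_integral_affine _ r 0)//; last first.
  exact: (@measurable_ball_slice n (r ^+ 2 * s)).
rewrite [r ^+ n.+1]exprS EFinM -muleA; congr (_ * _)%E.
rewrite -ge0_integralZl//; last 2 first.
- exact: measurable_ball_slice.
- by rewrite lee_fin exprn_ge0// ltW.
by apply: eq_integral => a _; rewrite addr0 exprMn -mulrBr IHn.
Qed.

Lemma prod_measure_setX n (A : set line) (B : set (Rn R n)) :
  measurable A -> measurable B ->
  prod_measure lambda (lebesgue_Rn n) (A `*` B) = (lambda A * lebesgue_Rn n B)%E.
Proof. by move=> mA mB; exact: product_measure1E. Qed.

Lemma lebesgue_centered (b : R) : 0 <= b -> lambda `[- b, b]%classic = (2 * b)%:E.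
Proof.
rewrite le_eqVlt => /orP[/eqP <-|b0].
  by rewrite oppr0 mulr0 lebesgue_measure_itv/= ltxx.
rewrite lebesgue_measure_itv/= lte_fin (_ : (- b < b)%R); last by lra.
by rewrite -EFinB; congr EFin; ring.
Qed.

Lemma sqr_le_centered (a s : R) : 0 <= s -> (a \in `[- Num.sqrt s, Num.sqrt s]) = (a ^+ 2 <= s).
Proof.
move=> s0; rewrite in_itv/= -ler_norml -[in RHS](sqr_sqrtr s0) -real_normK ?num_real//.
by rewrite ler_pXn2r// nnegrE.
Qed.

(** The ball is contained in the product of an interval and a ball. *)
Lemma ball_volumeS_le n s : 0 <= s ->
  (ball_volume n.+1 s <= (2 * Num.sqrt s)%:E * ball_volume n s)%E.
Proof.
move=> s0; rewrite ball_volumeS_prod -lebesgue_centered ?sqrtr_ge0//.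
rewrite -prod_measure_setX; [|exact: measurable_itv|exact: measurable_ball].
apply: le_measure; rewrite ?inE; first exact: measurable_cons_ball.
  by apply: measurableX; [exact: measurable_itv|exact: measurable_ball].
move=> [a x] /= H; have := sqnormRn_ge0 x; have := sqr_ge0 a; move: H; rewrite /cons_ball/=.
move=> H a0 x0; split => /=; last by lra.
by have := sqr_le_centered a s0; rewrite /in_mem/= => ->; lra.
Qed.

Lemma ball_volume_lt0 n s : s < 0 -> ball_volume n s = 0%E.
Proof.
move=> s0; rewrite /ball_volume (_ : [set x | _] = set0) ?measure0//.
by apply/seteqP; split => x //=; have := sqnormRn_ge0 x; lra.
Qed.

Lemma ball_volume_lty n s : (ball_volume n s < +oo)%E.
Proof.
have [s0|s0] := ltP s 0; first by rewrite ball_volume_lt0.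
elim: n => [|n IHn]; first by rewrite /ball_volume /= diracE ltry.
apply: le_lt_trans (ball_volumeS_le n s0) _.
by rewrite lte_mul_pinfty// lee_fin mulr_ge0// sqrtr_ge0.
Qed.

(** The ball contains the product of an interval and a ball, each of half the
    squared radius. *)
Lemma ball_volume_gt0 n s : 0 < s -> (0 < ball_volume n s)%E.
Proof.
elim: n s => [|n IHn] s s0.
  by rewrite /ball_volume /= diracE mem_set// /sqnormRn /dotRn/= big_ord0 ltW.
have s2 : 0 < s / 2 by lra.
apply: (@lt_le_trans _ _ ((2 * Num.sqrt (s / 2))%:E * ball_volume n (s / 2))%E).
  by rewrite mule_gt0 ?IHn// lte_fin mulr_gt0// sqrtr_gt0.
rewrite ball_volumeS_prod -lebesgue_centered ?sqrtr_ge0//.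
rewrite -prod_measure_setX; [|exact: measurable_itv|exact: measurable_ball].
apply: le_measure; rewrite ?inE; last 2 first.
  exact: measurable_cons_ball.
  move=> [a x] /= [aI xB]; rewrite /cons_ball/=.
  by move: aI; rewrite sqr_le_centered ?(ltW s2)//; lra.
by apply: measurableX; [exact: measurable_itv|exact: measurable_ball].
Qed.

(** For [s = 0] the formula holds because the power vanishes and so does the length
    of the interval in [ball_volumeS_le]; both need [0 < n]. *)
Lemma ball_volumeE n s : (0 < n)%N -> 0 <= s ->
  ball_volume n s = (omega R n * s `^ (n%:R / 2))%:E.
Proof.
move=> n0; have fv k t : ball_volume k t \is a fin_num.
  by rewrite ge0_fin_numE ?ball_volume_lty ?measure_ge0.
rewrite le_eqVlt => /orP[/eqP <-|s0].
  rewrite powR0 ?mulr0; last by rewrite mulf_neq0// pnatr_eq0 -lt0n.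
  case: n n0 => // n _; apply/eqP; rewrite eq_le measure_ge0 andbT.
  by apply: le_trans (ball_volumeS_le n (lexx 0)) _; rewrite sqrtr0 mulr0 mul0e.
have r0 : 0 < Num.sqrt s by rewrite sqrtr_gt0.
have := ball_volume_scale n 1 r0; rewrite sqr_sqrtr ?(ltW s0)// mulr1 => ->.
rewrite -[X in (_ * X)%E]fineK ?fv// -EFinM mulrC; congr (_ * _)%:E.
by rewrite -powR_mulrn ?(ltW r0)// -powR12_sqrt ?(ltW s0)// -powRrM mulrC.
Qed.

Lemma omega_gt0 n : 0 < omega R n.
Proof.
by rewrite fine_gt0// ball_volume_lty ball_volume_gt0.
Qed.

End ball_volume.

Section rate.
Context {R : realType}.
Variable g : R -> R.
Hypothesis g0 : g 0 = 0.

Lemma rarrow_ge0 u : 0 <= u -> (0 <= rarrow g u)%E.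
Proof. by move=> u0; apply: ereal_sup_ubound; exists 0 => //=; rewrite g0. Qed.

Lemma le_rarrow u rho s : rarrow g u = rho%:E -> 0 <= s -> g s <= u -> s <= rho.
Proof.
move=> gu s0 gs; rewrite -lee_fin -gu.
by apply: ereal_sup_ubound; exists s.
Qed.

End rate.

Section nash.
Context {R : realType} (n : nat) (n_gt0 : (0 < n)%N) (g : R -> R).
Hypothesis g_ge0 : forall s : R, 0 <= s -> 0 <= g s.
Hypothesis g_ndecr : forall s t : R, 0 <= s -> s <= t -> g s <= g t.
Hypothesis g0 : g 0 = 0.
Variable f : Rn R n -> R[i].
Hypotheses (fdom : dom_gDelta g f) (f1 : inLp 1 f).
Local Notation mu := (lebesgue_Rn n).
Local Notation N2 := (fine (sqnorm2 mu f)).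
Local Notation N1 := (fine (norm1 mu f)).

Lemma nash_finite (t rho : R) : 0 < t -> rarrow g t^-1 = rho%:E ->
  N2 <= t * qform g f + cfourier R n * omega R n * rho `^ (n%:R / 2) * N1 ^+ 2.
Proof.
move=> t0 gt; have rho0 : 0 <= rho.
  by rewrite -lee_fin -gt rarrow_ge0// invr_ge0 ltW.
have := frequency_splitting g_ge0 g_ndecr fdom f1 t0 (fun s s0 gs => le_rarrow gt s0 gs) (ball_volume_lty n rho).
have := ball_volumeE n_gt0 rho0; rewrite /ball_volume => -> /=.
by rewrite /cfourier !mulrA.
Qed.

Lemma cfourier_omega_gt0 : 0 < cfourier R n * omega R n.
Proof. by rewrite mulr_gt0 ?omega_gt0// invr_gt0 twopi_gt0. Qed.

Lemma poweR_half_infty : (+oo `^ (n%:R / 2) = +oo :> \bar R)%E.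
Proof. by rewrite poweRyr// mulf_neq0// pnatr_eq0 -lt0n. Qed.

Lemma sqnorm2_eq0_of_norm1 : norm1 mu f = 0%E -> sqnorm2 mu f = 0%E.
Proof.
have /inLp1P fi := f1; move=> /(norm1_eq0 fi.1) f0.
rewrite (ae_eq_sqnorm2 fi.1 (cmeas_cst _ 0) f0).
by apply: integral0_eq => x _; rewrite Normc.normc0 expr0n.
Qed.

Lemma norms_finite : norm1 mu f = N1%:E /\ sqnorm2 mu f = N2%:E.
Proof.
have /inLp1P fi := f1; have /inLp2P f2 := fdom.1.
rewrite !fineK//; first exact: sqnorm2_fin_num.
by rewrite ge0_fin_numE ?norm1_ge0//; exact: fi.2.
Qed.

(** When the generalized inverse is infinite, so is the right-hand side, except
    that [+oo * 0 = 0] when [f] has norm 0, in which case the left-hand side is 0. *)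
Lemma nash_inequality (t : R) : 0 < t ->
  (cLnorm 2 f ^+ 2 <= t%:E * (qform g f)%:E +
    beta n ((rarrow g t^-1)^-1) * cLnorm 1 f ^+ 2)%E.
Proof.
move=> t0; have [E1 E2] := norms_finite.
have q0 := qform_ge0 g_ge0 f.
have : (0 <= rarrow g t^-1)%E by apply: rarrow_ge0 => //; rewrite invr_ge0 ltW.
rewrite cLnorm2E cLnorm1E /beta inveK.
case E : (rarrow g t^-1) => [rho| |//] _.
  rewrite E1 E2 poweR_EFin -!EFin_expe -!EFinM -EFinD lee_fin.
  exact: nash_finite.
rewrite poweR_half_infty gt0_muley ?lte_fin ?cfourier_omega_gt0//.
have [N10|N1n0] := eqVneq (norm1 mu f) 0%E.
  rewrite (sqnorm2_eq0_of_norm1 N10) N10 expe2 mul0e mule0 adde0 -EFinM lee_fin.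
  by rewrite mulr_ge0// ltW.
have N1p : (0 < norm1 mu f)%E by rewrite lt0e N1n0 norm1_ge0.
by rewrite gt0_mulye ?expe2 ?mule_gt0// addey -?EFinM// leey.
Qed.

(** Each [t] in the supremum is an instance of [nash_finite] at [t^-1], divided by
    the squared norm of [f]; where the generalized inverse is infinite the term is
    [-oo]. *)
Lemma nash_rate : (cLnorm 1 f <= 1)%E ->
  (cLnorm 2 f ^+ 2 * Dg n g (fine (cLnorm 2 f ^+ 2)) <= (qform g f)%:E)%E.
Proof.
rewrite cLnorm2E cLnorm1E; have [E1 E2] := norms_finite.
rewrite E1 lee_fin E2 => N1le.
have q0 := qform_ge0 g_ge0 f.
have N20 : 0 <= N2 by rewrite fine_ge0 ?sqnorm2_ge0.
have N10 : 0 <= N1 by rewrite fine_ge0 ?norm1_ge0.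
rewrite /=; move: N20; rewrite le_eqVlt => /orP[/eqP <-|N2p].
  (* the supremum may be infinite here, but [0 * +oo = 0] *)
  by rewrite mul0e lee_fin.
rewrite -lee_pdivlMl// -EFinM; apply: ge_ereal_sup => _ [t /= t0 <-].
have K := cfourier_omega_gt0.
have : (0 <= rarrow g t)%E by apply: rarrow_ge0 => //; exact: ltW.
case E : (rarrow g t) => [rho| |//] _; last first.
  rewrite poweR_half_infty gt0_muley ?lte_fin; first by rewrite /= leNye.
  by rewrite -mulrA mulr_gt0// divr_gt0.
have ti : 0 < t^-1 by rewrite invr_gt0.
have := nash_finite (rho := rho) ti; rewrite invrK => /(_ E) H.
rewrite poweR_EFin -EFinM -EFinB lee_fin.
set P := rho `^ _ in H *; have P0 : 0 <= P := powR_ge0 _ _.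
rewrite ler_pdivlMl//.
have {}H : N2 <= t^-1 * qform g f + cfourier R n * omega R n * P.
  apply: le_trans H _; rewrite lerD2l ler_piMr ?expr_le1//.
  by rewrite mulr_ge0// ltW.
have := ler_wpM2l (ltW t0) H.
rewrite mulrDr mulrA mulfV ?gt_eqF// mul1r.
rewrite (_ : N2 * _ = t * N2 - (N2 / N2) * (t * (cfourier R n * omega R n * P))); last by ring.
by rewrite mulfV ?gt_eqF// mul1r lerBlDr.
Qed.

End nash.

Theorem theorem7p1 (R : realType) (n : nat) (n_gt0 : (0 < n)%N)
    (g : R -> R)
    (g_ge0 : forall s : R, 0 <= s -> 0 <= g s)
    (g_ndecr : forall s t : R, 0 <= s -> s <= t -> g s <= g t)
    (g0 : g 0 = 0) :
  (forall (t : R) (f : Rn R n -> R[i]),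
     0 < t -> dom_gDelta g f -> inLp 1 f ->
     exists2 q : R, inner (gDelta g f) f = q%:C%C &
       (cLnorm 2 f ^+ 2 <=
        t%:E * q%:E + beta n ((rarrow g t^-1)^-1) * cLnorm 1 f ^+ 2)%E)
  /\
  (forall f : Rn R n -> R[i],
     dom_gDelta g f -> inLp 1 f -> (cLnorm 1 f <= 1)%E ->
     exists2 q : R, inner (gDelta g f) f = q%:C%C &
       (cLnorm 2 f ^+ 2 * Dg n g (fine (cLnorm 2 f ^+ 2)) <= q%:E)%E).
Proof.
split=> [t f t0 fdom f1|f fdom f1 fle1]; exists (qform g f).
- exact: inner_gDelta.
- exact: nash_inequality.
- exact: inner_gDelta.
- exact: nash_rate.
Qed.
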